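(* Let $l$ be a prime, let $N,N'\ge1$ with $N'\mid N$ and $d:=N/N'$. The formula $\delta_{NN'}(\lambda,\mu,f,g):=(\lambda,[[\mu]],f,\delta_{NN'}(g))$ defines a map $\delta_{NN'}:\underline{\mathrm{GTM}}(N)_l\to\underline{\mathrm{GTM}}(N')_l$, such that $\delta_{NN'}(\underline g_1\,\underline g_2)=\delta_{NN'}(\underline g_1)\,\delta_{NN'}(\underline g_2)$ for all $\underline g_1\in\underline{\mathrm{GTM}}(N)_l$ and all $\underline g_2=(\lambda_2,\mu_2,f_2,g_2)\in\underline{\mathrm{GTM}}(N)_l$ such that the image of $\mu_2$ in $\mathbb Z/d\mathbb Z$ is invertible, and which restricts to a group morphism $\delta_{NN'}:\mathrm{GTM}(N)_l\to\mathrm{GTM}(N')_l$.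
   Context: For a group $G$, $G_l$ is its pro-$l$ completion. For a surjective morphism $\varphi:\Gamma\to\Gamma_0$ with kernel $\Gamma_1$, the partial pro-$l$ completion is $\Gamma(\varphi,l)=\varprojlim\Gamma/M$, over subgroups $M\subset\Gamma_1$ normal in $\Gamma$ with $\Gamma_1/M$ a finite $l$-group; it is an extension of $\Gamma_0$ by $(\Gamma_1)_l$, functorial in commutative squares. $\mathbb Z_l(N):=\mathbb Z(\mathrm{can}:\mathbb Z\to\mathbb Z/N\mathbb Z,\,l)=\varprojlim_k\mathbb Z/Nl^k\mathbb Z$, a ring, with natural ring maps $\mathbb Z_l(N)\to\mathbb Z/N\mathbb Z$, $[-]:\mathbb Z_l(N)\to\mathbb Z_l$ and, for $N'|N$, $[[-]]:\mathbb Z_l(N)\to\mathbb Z_l(N')$, all induced by the identity of $\mathbb Z$. $F_2$ is free on $x,y$; $\varphi_N:F_2\to\mathbb Z/N\mathbb Z$, $x\mapsto\bar1,y\mapsto\bar0$; $\mathrm{Ker}\,\varphi_N$ is free on $X:=x^N$, $y(\alpha):=x^\alpha yx^{-\alpha}$ ($0\le\alpha\le N-1$). $P_4$: pure braid group with Artin generators $x_{ij}=(\sigma_{j-1}\cdots\sigma_{i+1})\sigma_i^2(\sigma_{j-1}\cdots\sigma_{i+1})^{-1}$, with strands numbered $1,\dots,4$ or $0,\dots,3$; with strands $0,\dots,3$, $\varphi_{3,N}:P_4\to(\mathbb Z/N\mathbb Z)^3$ sends $x_{0i}$ to the $i$-th basis vector and $x_{ij}$ ($i\geq1$) to $0$.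 For $\mu\in\mathbb Z_l(N)$, $x^\mu$ and $(x^{-1}y^{-1})^\mu\in F_2(\varphi_N,l)$ are the images of $\mu$ under the extensions $\mathbb Z_l(N)\to F_2(\varphi_N,l)$ of $k\mapsto x^k$, $k\mapsto(x^{-1}y^{-1})^k$; for $s\in\mathbb Z_l$, $y^s$ is defined similarly. $\underline{\mathrm{GTM}}(N)_l$ is the set of $(\lambda,\mu,f,g)\in(2\mathbb Z_l+1)\times\mathbb Z_l(N)\times(F_2)_l\times F_2(\varphi_N,l)$ such that: $f(y,x)=f(x,y)^{-1}$; $f(x_3,x_1)x_3^{(\lambda-1)/2}f(x_2,x_3)x_2^{(\lambda-1)/2}f(x_1,x_2)x_1^{(\lambda-1)/2}=1$ for $x_1x_2x_3=1$; $f(x_{12},x_{23}x_{24})f(x_{13}x_{23},x_{34})=f(x_{23},x_{34})f(x_{12}x_{13},x_{24}x_{34})f(x_{12},x_{23})$ in $(P_4)_l$ (strands $1,\dots,4$); $g(x,y)^{-1}y^{\frac{\lambda-1}2}g(x^{-1}y^{-1},y)(x^{-1}y^{-1})^\mu g(x^{-1}y^{-1},y)^{-1}y^{\frac{\lambda+1}2}g(x,y)x^\mu=1$ in $F_2(\varphi_N,l)$; $g(x_{01},x_{12}x_{13})g(x_{02}x_{12},x_{23})=f(x_{12},x_{23})g(x_{01}x_{02},x_{13}x_{23})g(x_{01},x_{12})$ in $P_4(\varphi_{3,N},l)$ (strands $0,\dots,3$). (Here $f(u,v),g(u,v)$ are images under the morphisms of completions induced by $x\mapsto u,y\mapsto v$.)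 For such elements one has $\lambda=[\mu]$ and $g\in(\mathrm{Ker}\,\varphi_N)_l$. Product: $(\lambda_1,\mu_1,f_1,g_1)(\lambda_2,\mu_2,f_2,g_2)=(\lambda_1\lambda_2,\mu_1\mu_2,f_1(f_2x^{\lambda_2}f_2^{-1},y^{\lambda_2})f_2,\ g_1(g_2x^{\mu_2}g_2^{-1},y^{\lambda_2})g_2)$. $\mathrm{GTM}(N)_l$ is the group of invertible elements of the semigroup $\underline{\mathrm{GTM}}(N)_l$. $\delta_{NN'}:(\mathrm{Ker}\,\varphi_N)_l\to(\mathrm{Ker}\,\varphi_{N'})_l$ is induced by the morphism $\mathrm{Ker}\,\varphi_N\to\mathrm{Ker}\,\varphi_{N'}$: $x^N\mapsto x^{N'}$, and for $0\le\alpha\le N-1$, $x^\alpha yx^{-\alpha}\mapsto x^{\alpha/d}yx^{-\alpha/d}$ if $d|\alpha$, $x^\alpha yx^{-\alpha}\mapsto1$ if $d\nmid\alpha$. *)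

(* Defs.v *)
From HB Require Import structures.
From mathcomp Require Import all_boot all_order all_algebra all_fingroup.
From mathcomp Require Import generic_quotient.
From mathcomp Require Import boolp classical_sets cardinality.

Set Implicit Arguments.
Unset Strict Implicit.
Unset Printing Implicit Defensive.

Import GRing.Theory.
Local Open Scope classical_set_scope.
Local Open Scope group_scope.

Notation gmorph := UMagmaMorphism.type.

Section MkGmorph.
Variables (G H : groupType) (f : G -> H) (fM : {morph f : a b / a * b}).

Definition mk_gmorph_fun := let _ := fM in f.

Lemma mk_gmorph_fun1 : mk_gmorph_fun 1 = 1.
Proof. by apply: (mulgI (f 1)); rewrite -fM !mulg1. Qed.

HB.instance Definition _ := isMultiplicative.Build G H mk_gmorph_fun fM.
HB.instance Definition _ :=
  Multiplicative_isUMagmaMorphism.Build G H mk_gmorph_fun mk_gmorph_fun1.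

Definition mk_gmorph : gmorph G H := mk_gmorph_fun.

End MkGmorph.

Definition gexpz (G : groupType) (w : G) (z : int) : G :=
  match z with Posz n => w ^+ n | Negz n => w ^- n.+1 end.

Section Gexpz.
Variables (G : groupType) (w : G).

Lemma gexpzSr (z : int) : gexpz w (z + 1)%R = gexpz w z * w.
Proof.
case: z => [n|[|n]].
- by rewrite addrC -intS /= expgSr.
- by rewrite NegzE addNr /= expg1 mulVg.
- rewrite NegzE (intS n.+1) opprD addrAC addNr add0r -NegzE /=.
  by rewrite [w ^+ n.+2]expgS invgM mulgVK.
Qed.

Lemma gexpzD (y z : int) : gexpz w (y + z)%R = gexpz w y * gexpz w z.
Proof.
elim/int_rect: z => [|n IH|n IH]; first by rewrite addr0 /= mulg1.
  by rewrite intS [(1 + _)%R]addrC addrA !gexpzSr IH mulgA.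
have e : (- (n.+1)%:Z + 1 = - n%:Z)%R by rewrite intS opprD addrAC addNr add0r.
by apply: (mulIg w); rewrite -gexpzSr -addrA e IH -mulgA -gexpzSr e.
Qed.

Lemma gexpzN (z : int) : gexpz w (- z)%R = (gexpz w z)^-1.
Proof. by apply: (mulgI (gexpz w z)); rewrite -gexpzD subrr /= mulgV. Qed.

End Gexpz.

Lemma gexpzMn (G : groupType) (w : G) (n : nat) (z : int) :
  gexpz w (n%:Z * z)%R = gexpz (w ^+ n) z.
Proof.
elim/int_rect: z => [|k IH|k IH]; first by rewrite mulr0.
  by rewrite -PoszM /= expgM.
by rewrite mulrN !gexpzN -PoszM /= expgM.
Qed.

Section Presentation.
Variable T : choiceType.

(* The letter (t, b) stands for t if b = false, and for t^-1 if b = true. *)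
Definition word : choiceType := seq (T * bool).

Variable R : word -> word -> Prop.

Inductive pres_eqv : word -> word -> Prop :=
| pres_refl u : pres_eqv u u
| pres_sym u v : pres_eqv u v -> pres_eqv v u
| pres_trans u v w : pres_eqv u v -> pres_eqv v w -> pres_eqv u w
| pres_cancel u v t b : pres_eqv (u ++ [:: (t, b); (t, ~~ b)] ++ v) (u ++ v)
| pres_rel u v r s : R r s -> pres_eqv (u ++ r ++ v) (u ++ s ++ v).

Definition pres_eqvb (u v : word) : bool := `[< pres_eqv u v >].

Lemma pres_eqvb_refl : reflexive pres_eqvb.
Proof. by move=> u; apply/asboolP/pres_refl. Qed.
Lemma pres_eqvb_sym : symmetric pres_eqvb.
Proof. by move=> u v; apply/asboolP/asboolP; apply: pres_sym. Qed.
Lemma pres_eqvb_trans : transitive pres_eqvb.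
Proof.
move=> v u w /asboolP uv /asboolP vw.
by apply/asboolP; apply: pres_trans uv vw.
Qed.

Canonical pres_equiv :=
  EquivRel pres_eqvb pres_eqvb_refl pres_eqvb_sym pres_eqvb_trans.

(* The group < T | r = s for (r, s) in R >. *)
Definition pres := {eq_quot pres_equiv}%qT.
HB.instance Definition _ := Choice.on pres.
HB.instance Definition _ := EqQuotient.on pres.

Definition word_inv (u : word) : word := [seq (a.1, ~~ a.2) | a <- rev u].

Definition pres_one : pres := \pi_pres%qT [::].
Definition pres_mul (x y : pres) : pres := \pi_pres%qT (repr x ++ repr y).
Definition pres_inv (x : pres) : pres := \pi_pres%qT (word_inv (repr x)).

Lemma pres_piP (u v : word) :
  \pi_pres%qT u = \pi_pres%qT v <-> pres_eqv u v.
Proof.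
split; first by move/eqquotP/asboolP.
by move=> uv; apply/eqquotP/asboolP.
Qed.

Lemma pres_repr (u : word) : pres_eqv (repr (\pi_pres%qT u)) u.
Proof. by apply/pres_piP; rewrite reprK. Qed.

Lemma pres_cat u u' v v' :
  pres_eqv u u' -> pres_eqv v v' -> pres_eqv (u ++ v) (u' ++ v').
Proof.
have l z a b : pres_eqv a b -> pres_eqv (z ++ a) (z ++ b).
  elim=> {a b} [a|a b _ IH|a b c _ IH1 _ IH2|a b t e|a b r s rs].
  - exact: pres_refl.
  - exact: pres_sym.
  - exact: pres_trans IH1 IH2.
  - by rewrite !(catA z); apply: pres_cancel.
  - by rewrite !(catA z); apply: pres_rel.
have r z a b : pres_eqv a b -> pres_eqv (a ++ z) (b ++ z).
  elim=> {a b} [a|a b _ IH|a b c _ IH1 _ IH2|a b t e|a b r s rs].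
  - exact: pres_refl.
  - exact: pres_sym.
  - exact: pres_trans IH1 IH2.
  - by rewrite -!catA; apply: pres_cancel.
  - by rewrite -!catA; apply: pres_rel.
move=> uu vv; apply: pres_trans (r _ _ _ uu) _; exact: l.
Qed.

Lemma word_invK : involutive word_inv.
Proof.
move=> u; rewrite /word_inv -map_rev revK -map_comp -[RHS]map_id.
by apply: eq_map => -[t b] /=; rewrite negbK.
Qed.

Lemma pres_catV u : pres_eqv (u ++ word_inv u) [::].
Proof.
elim: u => [|[t b] u IH]; first exact: pres_refl.
rewrite /word_inv rev_cons map_rcons /= -cats1 -/(word_inv u).
have -> : (t, b) :: u ++ word_inv u ++ [:: (t, ~~ b)]
        = [:: (t, b)] ++ (u ++ word_inv u) ++ [:: (t, ~~ b)] by rewrite -catA.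
apply: (@pres_trans _ ([:: (t, b)] ++ [::] ++ [:: (t, ~~ b)])).
  apply: pres_cat; first exact: pres_refl.
  by apply: pres_cat; [exact: IH | exact: pres_refl].
exact: (pres_cancel [::] [::]).
Qed.

Lemma pres_mulA : associative pres_mul.
Proof.
move=> x y z; apply/pres_piP.
apply: (@pres_trans _ (repr x ++ repr y ++ repr z)).
  by apply: pres_cat; [exact: pres_refl | exact: pres_repr].
rewrite catA; apply/pres_sym.
by apply: pres_cat; [exact: pres_repr | exact: pres_refl].
Qed.

Lemma pres_mul1 : left_id pres_one pres_mul.
Proof.
move=> x; rewrite -[RHS]reprK; apply/pres_piP.
exact: (pres_cat (pres_repr [::]) (pres_refl _)).
Qed.

Lemma pres_mulr1 : right_id pres_one pres_mul.
Proof.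
move=> x; rewrite -[RHS]reprK; apply/pres_piP.
by rewrite -[X in pres_eqv _ X]cats0; apply: (pres_cat (pres_refl _) (pres_repr [::])).
Qed.

Lemma pres_mulV : left_inverse pres_one pres_inv pres_mul.
Proof.
move=> x; apply/pres_piP.
apply: pres_trans (pres_cat (pres_repr _) (pres_refl _)) _.
by rewrite -{2}[repr x]word_invK; apply: pres_catV.
Qed.

Lemma pres_mulrV : right_inverse pres_one pres_inv pres_mul.
Proof.
move=> x; apply/pres_piP.
apply: pres_trans (pres_cat (pres_refl _) (pres_repr _)) _.
exact: pres_catV.
Qed.

HB.instance Definition _ :=
  isGroup.Build pres pres_mulA pres_mul1 pres_mulr1 pres_mulV pres_mulrV.

Definition pres_gen (t : T) : pres := \pi_pres%qT [:: (t, false)].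

Section Lift.
Variables (H : groupType) (f : T -> H).

Definition letter_eval (a : T * bool) : H := if a.2 then (f a.1)^-1 else f a.1.
Definition word_eval (u : word) : H := \prod_(a <- u) letter_eval a.

Hypothesis fR : forall r s, R r s -> word_eval r = word_eval s.

Lemma word_eval_eqv u v : pres_eqv u v -> word_eval u = word_eval v.
Proof.
elim=> {u v} [||u v w _ -> _ ->||] //.
- move=> u v t b; rewrite /word_eval !big_cat /= !big_cons big_nil /= mulg1.
  by case: b; rewrite /letter_eval /= ?mulVg ?mulgV mul1g.
- by move=> u v r s rs; rewrite /word_eval !big_cat /= -/(word_eval r) -/(word_eval s) (fR rs).
Qed.

Definition pres_lift_fun (x : pres) : H := word_eval (repr x).

Lemma pres_lift_pi u : pres_lift_fun (\pi_pres%qT u) = word_eval u.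
Proof. exact/word_eval_eqv/pres_repr. Qed.

Lemma pres_lift_funM : {morph pres_lift_fun : x y / x * y}.
Proof. by move=> x y; rewrite pres_lift_pi /word_eval big_cat. Qed.

Definition pres_lift : gmorph pres H := mk_gmorph pres_lift_funM.

Lemma pres_lift_gen t : pres_lift (pres_gen t) = f t.
Proof.
by rewrite [LHS]pres_lift_pi /word_eval big_cons big_nil mulg1.
Qed.

End Lift.

Lemma pres_ind (P : pres -> Prop) :
    P 1 -> (forall x y, P x -> P y -> P (x * y)) ->
    (forall x, P x -> P x^-1) -> (forall t, P (pres_gen t)) ->
  forall x, P x.
Proof.
move=> P1 PM PV Pg x; rewrite -[x]reprK; elim: (repr x) => [//|[t b] u IH].
have -> : \pi_pres%qT ((t, b) :: u) = \pi_pres%qT [:: (t, b)] * \pi_pres%qT u.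
  apply/pres_piP; apply/pres_sym.
  exact: (pres_cat (pres_repr [:: (t, b)]) (pres_repr u)).
apply: PM => //; case: b; last exact: Pg.
have <- : (pres_gen t)^-1 = \pi_pres%qT [:: (t, true)]; last exact/PV/Pg.
apply: (mulgI (pres_gen t)); rewrite mulgV; apply/pres_piP/pres_sym.
apply: pres_trans (pres_cat (pres_repr _) (pres_repr _)) _.
exact: (pres_cancel [::] [::] t false).
Qed.

End Presentation.

Section KernelGroup.
Variables (G H : groupType) (phi : gmorph G H).

Record kerg := Kerg { kerg_val : G; kerg_prop : phi kerg_val == 1 }.

HB.instance Definition _ := [isSub for kerg_val].
HB.instance Definition _ := [Choice of kerg by <:].

Lemma kerg_closed : group_closed [pred g | phi g == 1].
Proof.
split=> [|a b]; rewrite !inE; first by rewrite gmulf1.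
by move=> /eqP pa /eqP pb; rewrite gmulfF pa pb divgg.
Qed.

HB.instance Definition _ :=
  SubChoice_isSubGroup.Build G [pred g | phi g == 1] kerg kerg_closed.

Definition kerg_incl : gmorph kerg G := (val : kerg -> G).

End KernelGroup.

Section Completion.
Variables (l : nat) (G H : groupType) (phi : gmorph G H).

Definition lcos (g : G) (M : set G) : set G := [set g * m | m in M].

(* M is a subgroup of Ker phi, normal in G, and (Ker phi) / M is a finite
   l-group: it is finite and each of its elements is killed by a power of l. *)
Record is_level (M : set G) : Prop := IsLevel {
  level1 : M 1;
  levelF : forall a b, M a -> M b -> M (a * b^-1);
  level_ker : forall a, M a -> phi a = 1;
  levelJ : forall g a, M a -> M (g * a * g^-1);
  level_fin : finite_set [set lcos g M | g in [set g | phi g = 1]];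
  level_lgrp : forall g, phi g = 1 -> exists k, M (g ^+ (l ^ k)) }.

Record level := Level { lset :> set G; levelP : is_level lset }.

(* The compatible families (c_M)_M of cosets c_M of M, that is the elements of
   the inverse limit of the groups G / M. *)
Record is_compatible (c : level -> set G) : Prop := IsCompatible {
  compat_coset : forall M, exists g, c M = lcos g M;
  compat_incl : forall M M' : level, M `<=` M' -> c M `<=` c M' }.

Record completion :=
  Completion { comp :> level -> set G; compP : is_compatible comp }.

HB.instance Definition _ := gen_eqMixin completion.
HB.instance Definition _ := gen_choiceMixin completion.

Lemma completion_eq (c d : completion) : (forall M, c M = d M) -> c = d.
Proof.
case: c d => [c cP] [d dP] /= /funext e; case: _ / e in dP *.
by rewrite (Prop_irrelevance cP dP).
Qed.

Section Levels.
Variable M : level.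

Lemma levelV a : lset M a -> lset M a^-1.
Proof. by move=> Ma; rewrite -[a^-1]mul1g; apply: levelF (level1 (levelP M)) Ma; case: M. Qed.

Lemma levelM a b : lset M a -> lset M b -> lset M (a * b).
Proof.
by move=> Ma Mb; rewrite -[b]invgK; apply: levelF (Ma) (levelV Mb); case: M.
Qed.

Lemma levelJV g a : lset M a -> lset M (g^-1 * a * g).
Proof.
by move=> Ma; rewrite -{2}[g]invgK; apply: levelJ Ma; case: M.
Qed.

Lemma lcosE g h : lcos g M h <-> lset M (g^-1 * h).
Proof.
split=> [[m Mm <-]|Mgh]; first by rewrite mulKg.
by exists (g^-1 * h) => //; rewrite mulVKg.
Qed.

Lemma lcos_eqP g h : lcos g M = lcos h M <-> lset M (g^-1 * h).
Proof.
split=> [e|Mgh].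
  by apply/lcosE; rewrite e; exists 1; rewrite ?mulg1 //; case: (levelP M).
apply/seteqP; split=> k /lcosE Mk; apply/lcosE.
  have -> : h^-1 * k = (g^-1 * h)^-1 * (g^-1 * k).
    by rewrite invgM invgK mulgA mulgK.
  exact/levelM/Mk/levelV.
have -> : g^-1 * k = (g^-1 * h) * (h^-1 * k) by rewrite mulgA mulgK.
exact: levelM.
Qed.

Lemma lcos_refl g : lcos g M g.
Proof. by apply/lcosE; rewrite mulVg; case: (levelP M). Qed.

Lemma comp_repr (c : completion) g : c M g -> c M = lcos g M.
Proof.
by have [h ->] := compat_coset (compP c) M; move=> /lcosE Mg; apply/lcos_eqP.
Qed.

Lemma comp_ex (c : completion) : exists g, c M g.
Proof.
by have [h ->] := compat_coset (compP c) M; exists h; apply: lcos_refl.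
Qed.

Lemma lcos_mul g h :
  [set a * b | a in lcos g M & b in lcos h M] = lcos (g * h) M.
Proof.
apply/seteqP; split=> [_ [a /lcosE Ma [b /lcosE Mb <-]]|k /lcosE Mk].
  apply/lcosE.
  have -> : (g * h)^-1 * (a * b) = h^-1 * (g^-1 * a) * h * (h^-1 * b).
    by rewrite invgM !mulgA mulgK.
  exact/levelM/Mb/levelJV.
exists g; first exact: lcos_refl.
exists (g^-1 * k); last by rewrite mulVKg.
by apply/lcosE; rewrite mulgA -invgM.
Qed.

Lemma lcos_inv g : [set a^-1 | a in lcos g M] = lcos g^-1 M.
Proof.
apply/seteqP; split=> [_ [a /lcosE Ma <-]|k /lcosE Mk].
  apply/lcosE; rewrite invgK.
  have -> : g * a^-1 = g * (g^-1 * a)^-1 * g^-1 by rewrite invgM invgK !mulgA mulgK.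
  by apply: levelJ; [case: M | apply: levelV].
exists k^-1; last by rewrite invgK.
apply/lcosE; have -> : g^-1 * k^-1 = g^-1 * (g^-1^-1 * k)^-1 * g.
  by rewrite invgK invgM !mulgA mulgKV.
exact/levelJV/levelV.
Qed.

End Levels.

Lemma lcos_sub g (M M' : level) : M `<=` M' -> lcos g M `<=` lcos g M'.
Proof. by move=> MM h /lcosE Mh; apply/lcosE/MM. Qed.

Lemma inc_compatible g : is_compatible (fun M => lcos g M).
Proof. by split=> [M|M M']; [exists g | apply: lcos_sub]. Qed.

Definition inc_fun (g : G) : completion := Completion (inc_compatible g).

Lemma mul_compatible (c d : completion) :
  is_compatible (fun M => [set a * b | a in c M & b in d M]).
Proof.
split=> [M|M M' MM _ [a ca [b db <-]]].
  have [g /comp_repr ->] := comp_ex M c; have [h /comp_repr ->] := comp_ex M d.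
  by exists (g * h); rewrite lcos_mul.
exists a; first exact: (compat_incl (compP c) MM).
by exists b => //; apply: (compat_incl (compP d) MM).
Qed.

Lemma inv_compatible (c : completion) :
  is_compatible (fun M => [set a^-1 | a in c M]).
Proof.
split=> [M|M M' MM _ [a ca <-]].
  by have [g /comp_repr ->] := comp_ex M c; exists g^-1; rewrite lcos_inv.
by exists a => //; apply: (compat_incl (compP c) MM).
Qed.

Definition completion_mul c d := Completion (mul_compatible c d).
Definition completion_inv c := Completion (inv_compatible c).

Lemma completion_mulA : associative completion_mul.
Proof.
move=> a b c; apply: completion_eq => M /=.
have [x /comp_repr ->] := comp_ex M a; have [y /comp_repr ->] := comp_ex M b.
by have [z /comp_repr ->] := comp_ex M c; rewrite !lcos_mul mulgA.
Qed.

Lemma completion_mul1 : left_id (inc_fun 1) completion_mul.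
Proof.
move=> c; apply: completion_eq => M /=.
by have [x /comp_repr ->] := comp_ex M c; rewrite lcos_mul mul1g.
Qed.

Lemma completion_mulr1 : right_id (inc_fun 1) completion_mul.
Proof.
move=> c; apply: completion_eq => M /=.
by have [x /comp_repr ->] := comp_ex M c; rewrite lcos_mul mulg1.
Qed.

Lemma completion_mulV : left_inverse (inc_fun 1) completion_inv completion_mul.
Proof.
move=> c; apply: completion_eq => M /=.
by have [x /comp_repr ->] := comp_ex M c; rewrite lcos_inv lcos_mul mulVg.
Qed.

Lemma completion_mulrV : right_inverse (inc_fun 1) completion_inv completion_mul.
Proof.
move=> c; apply: completion_eq => M /=.
by have [x /comp_repr ->] := comp_ex M c; rewrite lcos_inv lcos_mul mulgV.
Qed.

HB.instance Definition _ := isGroup.Build completion completion_mulA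
  completion_mul1 completion_mulr1 completion_mulV completion_mulrV.

Lemma inc_funM : {morph inc_fun : a b / a * b}.
Proof. by move=> a b; apply: completion_eq => M /=; rewrite lcos_mul. Qed.

Definition inc : gmorph G completion := mk_gmorph inc_funM.

Lemma level_top_subproof : is_level [set g | phi g = 1].
Proof.
split=> /=; first exact: gmulf1.
- by move=> a b pa pb; rewrite gmulfF pa pb divgg.
- by [].
- by move=> g a pa; rewrite gmulfF gmulfM pa mulg1 divgg.
- apply: (@sub_finite_set _ _ [set [set g | phi g = 1]]); last exact: finite_set1.
  move=> _ [g /= pg <-] /=; apply/seteqP; split=> [_ [m /= pm <-]|h /= ph].
    by rewrite /= gmulfM pg pm mulg1.
  by exists (g^-1 * h); rewrite ?mulVKg //= gmulfM gmulfV pg ph mulVg.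
- by move=> g pg; exists 0; rewrite /= expg1.
Qed.

Definition level_top := Level level_top_subproof.

(* The morphism from the completion of G to H induced by phi: the level Ker phi
   component of c is a coset of Ker phi, on which phi is constant. *)
Definition proj (c : completion) : H := phi (xget 1 (c level_top)).

Lemma projE (c : completion) (M : level) g : comp c M g -> proj c = phi g.
Proof.
move=> cg; rewrite /proj.
have cg' : c level_top g.
  by apply: (compat_incl (compP c)) cg => a /(level_ker (levelP M)).
case: xgetP => [h _|/(_ g)//]; rewrite (comp_repr cg') => /lcosE /= p.
by rewrite -[h](mulVKg g) gmulfM p mulg1.
Qed.

Lemma proj_inc g : proj (inc g) = phi g.
Proof. by apply: (@projE (inc g) level_top); apply: lcos_refl. Qed.

Lemma projM : {morph proj : c d / c * d}.
Proof.
move=> c d; have [a ca] := comp_ex level_top c; have [b db] := comp_ex level_top d.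
rewrite (projE ca) (projE db) -gmulfM; apply: (@projE _ level_top).
by exists a => //; exists b.
Qed.

(* The value 1 for an incompatible family is never used: the families below are
   compatible under the hypotheses of ext_compatible and zpow_compatible. *)
Definition mk_completion (c : level -> set G) : completion :=
  if pselect (is_compatible c) is left cP then Completion cP else 1.

Lemma mk_completionE c M : is_compatible c -> mk_completion c M = c M.
Proof. by move=> cP; rewrite /mk_completion; case: pselect. Qed.

End Completion.

Arguments inc {l G H phi}.
Arguments comp {l G H phi} _ _.

Section Extension.
Variables (l : nat) (G H G' H' : groupType).
Variables (phi : gmorph G H) (phi' : gmorph G' H').
Variable f : gmorph G (completion l phi').

(* The component at M' of the image of c: f(g)_{M'} for g in c_M, where M is
   any level on which the M'-component of f is trivial. *)
Definition ext_comp (c : completion l phi) (M' : level l phi') : set G' :=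
  [set h | exists M : level l phi,
     (forall a, lset M a -> comp (f a) M' 1) /\
     exists2 g, comp c M g & comp (f g) M' h].

(* The extension of f to a morphism of completions; see ext_inc and extM. It is
   meaningful when f maps Ker phi to the kernel of proj. *)
Definition ext (c : completion l phi) : completion l phi' :=
  mk_completion (ext_comp c).

Hypothesis f_ker : forall a, phi a = 1 -> proj (f a) = 1.

Lemma comp1_eq (c : completion l phi') (M : level l phi') :
  comp c M 1 -> comp c M = lset M.
Proof.
move=> /comp_repr ->; apply/seteqP; split=> [h /lcosE|h Mh]; first by rewrite invg1 mul1g.
by apply/lcosE; rewrite invg1 mul1g.
Qed.

Lemma comp_one M : comp (1 : completion l phi') M 1.
Proof. exact: (@lcos_refl l G' H' phi' M 1). Qed.

Lemma comp_mul (c d : completion l phi') M a b :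
  comp c M a -> comp d M b -> comp (c * d) M (a * b).
Proof. by move=> ca db; exists a => //; exists b. Qed.

Lemma comp_inv (c : completion l phi') M a :
  comp c M a -> comp c^-1 M a^-1.
Proof. by move=> ca; exists a. Qed.

Lemma comp_exp (c : completion l phi') M a n :
  comp c M a -> comp (c ^+ n) M (a ^+ n).
Proof.
move=> ca; elim: n => [|n IH]; first exact: comp_one.
by rewrite !expgS; apply: comp_mul.
Qed.

Definition pull_set (M' : level l phi') : set G :=
  [set a | phi a = 1 /\ comp (f a) M' 1].

Lemma comp_f_eq (M' : level l phi') a b :
  phi a = phi b -> pull_set M' (a^-1 * b) <-> comp (f a) M' = comp (f b) M'.
Proof.
move=> pab.
have [x ax] := comp_ex M' (f a); have [y yb] := comp_ex M' (f b).
have fab : comp (f (a^-1 * b)) M' (x^-1 * y).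
  by rewrite gmulfM gmulfV; apply: comp_mul => //; apply: comp_inv.
rewrite (comp_repr ax) (comp_repr yb) lcos_eqP; split.
  by case=> _ /comp1_eq e; rewrite e in fab.
move=> Mxy; split; first by rewrite gmulfM gmulfV pab mulVg.
rewrite (comp_repr fab); apply/lcosE; rewrite mulg1; exact: levelV.
Qed.

Lemma pull_subproof (M' : level l phi') : is_level l phi (pull_set M').
Proof.
split.
- by split; [exact: gmulf1 | rewrite gmulf1; apply: comp_one].
- move=> a b [pa fa] [pb fb]; split; first by rewrite gmulfM gmulfV pa pb mulgV.
  rewrite gmulfM gmulfV -[1]mulg1 -{2}invg1.
  by apply: comp_mul => //; apply: comp_inv.
- by move=> a [].
- move=> g a [pa fa]; split; first by rewrite !gmulfM gmulfV pa mulg1 mulgV.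
  have [x gx] := comp_ex M' (f g); rewrite !gmulfM gmulfV.
  have -> : 1 = x * 1 * x^-1 by rewrite mulg1 mulgV.
  by apply: comp_mul; [apply: comp_mul | apply: comp_inv].
- pose F (C : set G') : set G := [set g | phi g = 1 /\ comp (f g) M' = C].
  apply: sub_finite_set (finite_image F (level_fin (levelP M'))).
  move=> _ [g /= pg <-] /=; exists (comp (f g) M').
    have [x gx] := comp_ex M' (f g); exists x; last by rewrite (comp_repr gx).
    by rewrite /= -(projE gx); apply: f_ker.
  apply/seteqP; split=> [h [ph e]|_ [a [pa fa] <-]].
    exists (g^-1 * h); last by rewrite mulVKg.
    by apply/comp_f_eq; rewrite ?pg ?ph.
  rewrite /F /= gmulfM pg pa mulg1; split=> //; apply/esym/comp_f_eq.
    by rewrite gmulfM pg pa mulg1.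
  by rewrite mulKg.
- move=> g pg; have [x gx] := comp_ex M' (f g).
  have px : phi' x = 1 by rewrite -(projE gx) f_ker.
  have [k Mk] := level_lgrp (levelP M') px; exists k; split.
    by rewrite gmulfXn pg expg1n.
  rewrite gmulfXn (comp_repr (comp_exp (l ^ k) gx)); apply/lcosE.
  by rewrite mulg1; apply: levelV.
Qed.

Definition pull M' : level l phi := Level (pull_subproof M').

Lemma ext_compE (c : completion l phi) M' g :
  comp c (pull M') g -> ext_comp c M' = comp (f g) M'.
Proof.
move=> cg; apply/seteqP; split=> [h [M [fM [g' cg' fg']]]|h fh]; last first.
  by exists (pull M'); split; [move=> a [] | exists g].
have MP : lset M `<=` pull M'.
  by move=> a Ma; split; [apply: level_ker (levelP M) _ Ma | exact: fM].
have {}cg' := compat_incl (compP c) MP cg'.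
have := cg'; rewrite (comp_repr cg) => /lcosE gg'.
have pgg : phi g = phi g' by rewrite -(projE cg) -(projE cg').
by have /(comp_f_eq M' pgg) -> := gg'.
Qed.

Lemma ext_compatible (c : completion l phi) : is_compatible (ext_comp c).
Proof.
split=> [M|M M' MM].
  have [g cg] := comp_ex (pull M) c; rewrite (ext_compE cg).
  exact: (compat_coset (compP (f g))).
have PP : pull M `<=` pull M'.
  by move=> a [pa fa]; split=> //; apply: (compat_incl (compP _) MM).
have [g cg] := comp_ex (pull M) c; rewrite (ext_compE cg).
rewrite (ext_compE (compat_incl (compP c) PP cg)).
exact: (compat_incl (compP (f g)) MM).
Qed.

Lemma extE (c : completion l phi) M' g :
  comp c (pull M') g -> comp (ext c) M' = comp (f g) M'.
Proof.
by move=> cg; rewrite mk_completionE; [exact: ext_compE | exact: ext_compatible].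
Qed.

Lemma ext_inc g : ext (inc g) = f g.
Proof. by apply: completion_eq => M'; apply: extE; apply: lcos_refl. Qed.

Lemma extM : {morph ext : c d / c * d}.
Proof.
move=> c d; apply: completion_eq => M'.
have [g cg] := comp_ex (pull M') c; have [h dh] := comp_ex (pull M') d.
have cd : comp (c * d) (pull M') (g * h) by exists g => //; exists h.
by rewrite (extE cd) gmulfM /= (extE cg) (extE dh).
Qed.

End Extension.

Lemma modz_dvdm (a m d : int) : (d %| m)%Z -> ((a %% m)%Z = a %[mod d])%Z.
Proof.
by move=> /dvdzP[q e]; rewrite [in RHS](divz_eq a m) [X in (_ * X + _)%R]e mulrA modzMDl.
Qed.

Section Zl.
Variables l n : nat.

(* The inverse limit over k of the rings Z/n(l^k)Z: an element of Z/nZ is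
   represented by its remainder modulo n. *)
Record zl := Zl {
  zlseq :> nat -> int;
  zlP : forall k, zlseq k = (zlseq k.+1 %% (n * l ^ k)%N%:Z)%Z }.

HB.instance Definition _ := gen_eqMixin zl.
HB.instance Definition _ := gen_choiceMixin zl.

Lemma zl_eq (a b : zl) : (forall k, a k = b k) -> a = b.
Proof.
case: a b => [a aP] [b bP] /= /funext e; case: _ / e in bP *.
by congr Zl; apply: Prop_irrelevance.
Qed.

Definition zlmod (k : nat) : int := (n * l ^ k)%N%:Z.

Lemma zlmodS k : (zlmod k %| zlmod k.+1)%Z.
Proof. by rewrite /zlmod dvdzE /= expnS mulnCA dvdn_mull. Qed.

Definition zl_coherent (a : nat -> int) :=
  forall k, (a k.+1 = a k %[mod zlmod k])%Z.

Lemma zl_mk_subproof a : zl_coherent a ->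
  forall k, (a k %% zlmod k)%Z = ((a k.+1 %% zlmod k.+1)%Z %% zlmod k)%Z.
Proof. by move=> aP k; rewrite modz_dvdm ?zlmodS // aP. Qed.

Definition zl_mk a (aP : zl_coherent a) : zl :=
  Zl (zl_mk_subproof aP).

Lemma zl_coh (a : zl) : zl_coherent a.
Proof. by move=> k; rewrite (zlP a k) modz_mod. Qed.

Lemma zl_modK (a : zl) k : (a k %% zlmod k)%Z = a k.
Proof. by rewrite (zlP a k) modz_mod. Qed.

Lemma zl_const_coh (z : int) : zl_coherent (fun=> z).
Proof. by []. Qed.

Lemma zl_add_coh (a b : zl) : zl_coherent (fun k => a k + b k)%R.
Proof. by move=> k; rewrite -modzDm !zl_coh modzDm. Qed.

Lemma zl_opp_coh (a : zl) : zl_coherent (fun k => - a k)%R.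
Proof. by move=> k; rewrite -modzNm zl_coh modzNm. Qed.

Lemma zl_mul_coh (a b : zl) : zl_coherent (fun k => a k * b k)%R.
Proof. by move=> k; rewrite -modzMm !zl_coh modzMm. Qed.

Definition zl_int (z : int) : zl := zl_mk (zl_const_coh z).
Definition zl_add (a b : zl) : zl := zl_mk (zl_add_coh a b).
Definition zl_opp (a : zl) : zl := zl_mk (zl_opp_coh a).
Definition zl_mul (a b : zl) : zl := zl_mk (zl_mul_coh a b).

Lemma zl_addA : associative zl_add.
Proof. by move=> a b c; apply: zl_eq => k /=; rewrite modzDml modzDmr addrA. Qed.

Lemma zl_addC : commutative zl_add.
Proof. by move=> a b; apply: zl_eq => k /=; rewrite addrC. Qed.

Lemma zl_add0 : left_id (zl_int 0) zl_add.
Proof. by move=> a; apply: zl_eq => k /=; rewrite modzDml add0r zl_modK. Qed.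

Lemma zl_addN : left_inverse (zl_int 0) zl_opp zl_add.
Proof. by move=> a; apply: zl_eq => k /=; rewrite modzDml addNr. Qed.

HB.instance Definition _ :=
  GRing.isZmodule.Build zl zl_addA zl_addC zl_add0 zl_addN.

Lemma zl_mulA : associative zl_mul.
Proof. by move=> a b c; apply: zl_eq => k /=; rewrite modzMml modzMmr mulrA. Qed.

Lemma zl_mulC : commutative zl_mul.
Proof. by move=> a b; apply: zl_eq => k /=; rewrite mulrC. Qed.

Lemma zl_mul1 : left_id (zl_int 1) zl_mul.
Proof. by move=> a; apply: zl_eq => k /=; rewrite modzMml mul1r zl_modK. Qed.

Lemma zl_mulDl : left_distributive zl_mul zl_add.
Proof.
move=> a b c; apply: zl_eq => k /=.
by rewrite modzMml modzDm mulrDl.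
Qed.

HB.instance Definition _ :=
  GRing.Zmodule_isComPzRing.Build zl zl_mulA zl_mulC zl_mul1 zl_mulDl.

End Zl.

Section ZlRed.
Variables (l n n' : nat) (nn' : (n' %| n)%N).

Lemma zl_red_coh (a : zl l n) : @zl_coherent l n' a.
Proof.
move=> k; have d : (zlmod l n' k %| zlmod l n k)%Z.
  by rewrite dvdzE /= dvdn_mul.
by rewrite -(modz_dvdm _ d) zl_coh modz_dvdm.
Qed.

(* The ring morphism Z_l(n) -> Z_l(n') induced by the identity of Z. *)
Definition zl_red (a : zl l n) : zl l n' := zl_mk (zl_red_coh a).

End ZlRed.

Section Zpow.
Variables (l n : nat) (G H : groupType) (phi : gmorph G H) (w : G).

Definition zpow_comp (a : zl l n) (M : level l phi) : set G :=
  [set h | exists2 k, lset M (w ^+ (n * l ^ k)) & lcos (gexpz w (a k)) M h].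

(* The image of a under the extension Z_l(n) -> completion of z |-> w ^ z; it is
   meaningful when w ^ n is in Ker phi, see zpow_int and zpowD. *)
Definition zpow (a : zl l n) : completion l phi := mk_completion (zpow_comp a).

Hypothesis wn : phi w ^+ n = 1.

Lemma zpow_level (M : level l phi) : exists k, lset M (w ^+ (n * l ^ k)).
Proof.
have /(level_lgrp (levelP M))[k Mk] : phi (w ^+ n) = 1 by rewrite gmulfXn.
by exists k; rewrite expgM.
Qed.

Lemma level_gexpz (M : level l phi) g z : lset M g -> lset M (gexpz g z).
Proof.
move=> Mg; have MX m : lset M (g ^+ m).
  elim: m => [|m IH]; first exact: level1 (levelP M).
  by rewrite expgS; apply: levelM.
by case: z => m /=; [|apply: levelV].
Qed.

Lemma zl_leq (a : zl l n) j k : (j <= k)%N -> (a k = a j %[mod zlmod l n j])%Z.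
Proof.
move=> /subnK <-; elim: (k - j)%N => [//|i IH]; rewrite addSn -IH.
have d : (zlmod l n j %| zlmod l n (i + j))%Z.
  by rewrite /zlmod dvdzE /= expnD mulnCA dvdn_mull.
by rewrite -(modz_dvdm _ d) zl_coh modz_dvdm.
Qed.

Lemma zpow_compE a (M : level l phi) k :
  lset M (w ^+ (n * l ^ k)) -> zpow_comp a M = lcos (gexpz w (a k)) M.
Proof.
have key i j : (i <= j)%N -> lset M (w ^+ (n * l ^ i)) ->
    lcos (gexpz w (a i)) M = lcos (gexpz w (a j)) M.
  move=> ij Mi; apply/lcos_eqP; rewrite -gexpzN -gexpzD.
  have /eqP := zl_leq a ij; rewrite eqz_mod_dvd => /dvdzP[q e].
  by rewrite addrC e mulrC gexpzMn; apply: level_gexpz.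
move=> Mk; apply/seteqP; split=> [h [j Mj]|h hk]; last by exists k.
by have [jk|/ltnW kj] := leqP j k; [rewrite (key j k)|rewrite -(key k j)].
Qed.

Lemma zpow_compatible a : is_compatible (zpow_comp a).
Proof.
split=> [M|M M' MM].
  have [k Mk] := zpow_level M; exists (gexpz w (a k)); exact: zpow_compE.
have [k Mk] := zpow_level M; rewrite (zpow_compE a Mk).
by rewrite (zpow_compE a (MM _ Mk)); apply: lcos_sub.
Qed.

Lemma zpowE a (M : level l phi) k :
  lset M (w ^+ (n * l ^ k)) -> comp (zpow a) M = lcos (gexpz w (a k)) M.
Proof.
by move=> Mk; rewrite mk_completionE; [apply: zpow_compE | apply: zpow_compatible].
Qed.

Lemma gexpz_modz (M : level l phi) k z : lset M (w ^+ (n * l ^ k)) ->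
  lcos (gexpz w (z %% zlmod l n k)%Z) M = lcos (gexpz w z) M.
Proof.
move=> Mk; apply/lcos_eqP; rewrite -gexpzN -gexpzD.
rewrite {2}(divz_eq z (zlmod l n k)) addrC addrK mulrC gexpzMn.
exact: level_gexpz.
Qed.

Lemma zpow_int z : zpow (zl_int l n z) = inc (gexpz w z).
Proof.
apply: completion_eq => M; have [k Mk] := zpow_level M.
by rewrite (zpowE _ Mk) /= gexpz_modz.
Qed.

Lemma zpowD (a b : zl l n) : zpow (a + b)%R = zpow a * zpow b.
Proof.
apply: completion_eq => M; have [k Mk] := zpow_level M.
by rewrite (zpowE _ Mk) /= !(zpowE _ Mk) lcos_mul -gexpzD gexpz_modz.
Qed.

End Zpow.

Arguments zpow {l n G H phi} w a.

Definition F2 : groupType := pres (fun _ _ : word bool => False).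
Definition Fx : F2 := pres_gen _ false.
Definition Fy : F2 := pres_gen _ true.

Definition lift2 (G : groupType) (u v : G) : gmorph F2 G :=
  pres_lift (fun r s (rs : False) => False_ind
    (word_eval (fun b : bool => if b then v else u) r = word_eval _ s) rs).

Lemma lift2x (G : groupType) (u v : G) : lift2 u v Fx = u.
Proof. exact: pres_lift_gen. Qed.
Lemma lift2y (G : groupType) (u v : G) : lift2 u v Fy = v.
Proof. exact: pres_lift_gen. Qed.

Lemma F2_ind (P : F2 -> Prop) :
    P 1 -> (forall a b, P a -> P b -> P (a * b)) -> (forall a, P a -> P a^-1) ->
    P Fx -> P Fy ->
  forall a, P a.
Proof. by move=> P1 PM PV Px Py; apply: pres_ind => // -[]. Qed.

(* The additive group Z/NZ, N >= 1; it is trivial for N = 1. *)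
Definition Zmod (N : nat) : groupType := 'I_N.-1.+1.
Definition zbar (N z : nat) : Zmod N := inZp z.

Definition phi2 (N : nat) : gmorph F2 (Zmod N) := lift2 (zbar N 1) (zbar N 0).

(* c(u, v): the image of c under the morphism of completions induced by x |-> u
   and y |-> v, for u and v in a completion (sub2) or in a group G' (at2). *)
Definition sub2 l (H G' H' : groupType) (phi : gmorph F2 H)
    (phi' : gmorph G' H') (c : completion l phi) (u v : completion l phi') :
  completion l phi' := ext (lift2 u v) c.

Definition at2 l (H G' H' : groupType) (phi : gmorph F2 H)
    (phi' : gmorph G' H') (c : completion l phi) (u v : G') :
  completion l phi' := sub2 c (inc u) (inc v).

Arguments at2 {l H G' H' phi phi'} c u v.

Section Wreath.
Variables (S : finType) (A : groupType).

(* The wreath product of A by the permutations of S. *)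
Record wreath := Wreath { wlab : {ffun S -> A}; wperm : {perm S} }.

HB.instance Definition _ := gen_eqMixin wreath.
HB.instance Definition _ := gen_choiceMixin wreath.

Lemma wreath_eq a b :
  (forall p, wlab a p = wlab b p) -> (forall p, wperm a p = wperm b p) -> a = b.
Proof. by case: a b => [a s] [b t] /= /ffunP -> /permP ->. Qed.

Definition wreath_one := Wreath [ffun=> 1] 1.
Definition wreath_mul a b :=
  Wreath [ffun p => wlab a p * wlab b (wperm a p)] (wperm a * wperm b).
Definition wreath_inv a :=
  Wreath [ffun p => (wlab a ((wperm a)^-1 p))^-1] (wperm a)^-1.

Lemma wreath_mulA : associative wreath_mul.
Proof.
by move=> a b c; apply: wreath_eq => p /=; rewrite ?ffunE ?permM /= ?ffunE ?mulgA.
Qed.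
Lemma wreath_mul1 : left_id wreath_one wreath_mul.
Proof.
by move=> a; apply: wreath_eq => p /=; rewrite ?ffunE ?permM ?perm1 ?mul1g.
Qed.
Lemma wreath_mulr1 : right_id wreath_one wreath_mul.
Proof.
by move=> a; apply: wreath_eq => p /=; rewrite ?ffunE ?permM ?perm1 ?mulg1.
Qed.
Lemma wreath_mulV : left_inverse wreath_one wreath_inv wreath_mul.
Proof.
by move=> a; apply: wreath_eq => p /=; rewrite ?ffunE ?mulVg.
Qed.
Lemma wreath_mulrV : right_inverse wreath_one wreath_inv wreath_mul.
Proof.
by move=> a; apply: wreath_eq => p /=; rewrite ?ffunE ?permK ?mulgV.
Qed.

HB.instance Definition _ := isGroup.Build wreath
  wreath_mulA wreath_mul1 wreath_mulr1 wreath_mulV wreath_mulrV.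

Lemma wlabM (a b : wreath) p : wlab (a * b) p = wlab a p * wlab b (wperm a p).
Proof. by rewrite ffunE. Qed.
Lemma wlab1 p : wlab (1 : wreath) p = 1.
Proof. by rewrite ffunE. Qed.
Lemma wlabV (a : wreath) p : wlab a^-1 p = (wlab a ((wperm a)^-1 p))^-1.
Proof. by rewrite ffunE. Qed.
Lemma wpermM (a b : wreath) p : wperm (a * b) p = wperm b (wperm a p).
Proof. exact: permM. Qed.
Lemma wperm1 p : wperm (1 : wreath) p = p.
Proof. exact: perm1. Qed.
Lemma wpermV (a : wreath) : wperm a^-1 = (wperm a)^-1.
Proof. by []. Qed.

End Wreath.

Lemma zbarD N a b : zbar N (a + b) = zbar N a * zbar N b.
Proof. by apply/val_inj; rewrite /= modnDm. Qed.

Lemma zbar0 N : zbar N 0 = 1.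
Proof. by apply/val_inj. Qed.

Lemma zbarN N : zbar N N = 1.
Proof. by apply/val_inj; case: N => //= N; rewrite modnn. Qed.

Lemma zbar1X N a : zbar N 1 ^+ a = zbar N a.
Proof.
elim: a => [|a IH]; first by rewrite zbar0.
by rewrite expgS IH -zbarD.
Qed.

Lemma zbar_val N (p : 'I_N.-1.+1) : zbar N p = p.
Proof. exact: valZpK. Qed.

Lemma phi2x N a : phi2 N (Fx ^+ a) = zbar N a.
Proof. by rewrite gmulfXn /phi2 lift2x zbar1X. Qed.

Lemma phi2y N : phi2 N Fy = 1.
Proof. by rewrite /phi2 lift2y zbar0. Qed.

Lemma kerX_subproof N : phi2 N (Fx ^+ N) == 1.
Proof. by rewrite phi2x zbarN. Qed.

Lemma kery_subproof N a : phi2 N (Fx ^+ a * Fy * Fx ^- a) == 1.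
Proof. by rewrite !gmulfM phi2y mulg1 gmulfV mulgV. Qed.

Definition kerX N : kerg (phi2 N) := Kerg (kerX_subproof N).
Definition kery N a : kerg (phi2 N) := Kerg (kery_subproof N a).

Section Delta.
Variables (N N' : nat) (hN : (0 < N)%N) (hNN : (N' %| N)%N).
Let d := (N %/ N')%N.

Let dN : (d * N' = N)%N. Proof. exact: divnK. Qed.

Let N'0 : (0 < N')%N. Proof. exact: dvdn_gt0 hN hNN. Qed.

Let d0 : (0 < d)%N. Proof. by rewrite divn_gt0 ?N'0 // dvdn_leq. Qed.

Definition zshift (z : Zmod N) : {perm 'I_N.-1.+1} := perm (@mulIg (Zmod N) z).

(* The image of a word of Ker phi_N is obtained by reading its letters from left
   to right, starting from 0 in Z/NZ: in state a, with 0 <= a < N, the letter x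
   leads to the state a + 1 and outputs x if d | a + 1, while the letter y keeps
   the state and outputs y if d | a. *)
Definition delta_x : wreath 'I_N.-1.+1 F2 :=
  Wreath [ffun a : 'I_N.-1.+1 => if (d %| a.+1)%N then Fx else 1]
    (zshift (zbar N 1)).
Definition delta_y : wreath 'I_N.-1.+1 F2 :=
  Wreath [ffun a : 'I_N.-1.+1 => if (d %| a)%N then Fy else 1] 1.
Definition delta_wreath : gmorph F2 (wreath 'I_N.-1.+1 F2) :=
  lift2 delta_x delta_y.

Lemma delta_wpermE (g : F2) (p : Zmod N) :
  wperm (delta_wreath g) p = p * phi2 N g.
Proof.
elim/F2_ind: g p => [|a b IHa IHb|a IH||] p.
- by rewrite !gmulf1 wperm1 mulg1.
- by rewrite !gmulfM wpermM IHb IHa mulgA.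
- rewrite !gmulfV wpermV; apply: (@perm_inj _ (wperm (delta_wreath a))).
  by rewrite permKV IH mulgVK.
- by rewrite /delta_wreath lift2x permE /phi2 lift2x.
- by rewrite /delta_wreath lift2y perm1 phi2y mulg1.
Qed.

Let q (p : 'I_N.-1.+1) : Zmod N' := zbar N' (p %/ d).

Lemma delta_wlab_phi (g : F2) (p : 'I_N.-1.+1) :
  phi2 N' (wlab (delta_wreath g) p) = (q p)^-1 * q (wperm (delta_wreath g) p).
Proof.
elim/F2_ind: g p => [|a b IHa IHb|a IH||] p.
- by rewrite !gmulf1 wperm1 wlab1 gmulf1 mulVg.
- by rewrite !gmulfM wpermM wlabM gmulfM IHb IHa mulgA mulgK.
- rewrite !gmulfV wlabV wpermV gmulfV IH permKV invgM invgK //.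
- have e : wperm (delta_wreath Fx) p = zbar N p.+1.
    by rewrite delta_wpermE (phi2x N 1) -{1}(zbar_val p) -zbarD addn1.
  have -> : q (wperm (delta_wreath Fx) p) = zbar N' (p.+1 %/ d).
    rewrite e /q /=; move: (nat_of_ord p) (ltn_ord p) => m; rewrite (prednK hN).
    rewrite leq_eqVlt => /orP[/eqP ->|/modn_small -> //].
    by rewrite modnn div0n -{1}dN mulKn // zbarN zbar0.
  rewrite divnS // zbarD /delta_wreath lift2x ffunE.
  case: ifP => _; last by rewrite gmulf1 zbar0 mul1g mulVg.
  by rewrite (phi2x N' 1) -zbarD addnC zbarD mulKg.
- rewrite delta_wpermE phi2y mulg1 mulVg /delta_wreath lift2y ffunE.
  by case: ifP; rewrite ?phi2y ?gmulf1.
Qed.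

Definition deltaK_val (k : kerg (phi2 N)) : F2 :=
  wlab (delta_wreath (val k)) ord0.

Lemma kerg_wperm (k : kerg (phi2 N)) p : wperm (delta_wreath (val k)) p = p.
Proof. by rewrite delta_wpermE (eqP (kerg_prop k)) mulg1. Qed.

Lemma deltaK_subproof (k : kerg (phi2 N)) : phi2 N' (deltaK_val k) == 1.
Proof. by rewrite delta_wlab_phi kerg_wperm mulVg. Qed.

Definition deltaK_fun (k : kerg (phi2 N)) : kerg (phi2 N') :=
  Kerg (deltaK_subproof k).

Lemma deltaK_funM : {morph deltaK_fun : a b / a * b}.
Proof.
move=> a b; apply/val_inj => /=.
by rewrite /deltaK_val /= gmulfM wlabM kerg_wperm.
Qed.

(* delta_{NN'}; it is characterized by its values deltaK_X and deltaK_y on the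
   generators X and y(a), 0 <= a < N, of Ker phi_N. *)
Definition deltaK : gmorph (kerg (phi2 N)) (kerg (phi2 N')) :=
  mk_gmorph deltaK_funM.

Lemma wlab_Fx a : (a <= N)%N -> wlab (delta_wreath (Fx ^+ a)) ord0 = Fx ^+ (a %/ d).
Proof.
elim: a => [_|a IH aN]; first by rewrite gmulf1 wlab1 div0n.
rewrite expgSr gmulfM wlabM (IH (ltnW aN)) delta_wpermE phi2x.
have -> : (1 : Zmod N) * zbar N a = zbar N a by rewrite mul1g.
rewrite divnS // addnC expgnDr; congr (_ * _).
rewrite /delta_wreath lift2x ffunE /= (prednK hN) modn_small //.
by case: (d %| _)%N.
Qed.

Lemma deltaK_X : deltaK (kerX N) = kerX N'.
Proof.
apply/val_inj; rewrite /= /deltaK_val /= wlab_Fx //.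
by rewrite -{1}dN mulKn.
Qed.

Lemma deltaK_y a : (a < N)%N ->
  deltaK (kery N a) = if (d %| a)%N then kery N' (a %/ d) else 1.
Proof.
move=> aN; apply/val_inj.
have pa : wperm (delta_wreath (Fx ^+ a)) ord0 = zbar N a.
  by rewrite delta_wpermE phi2x; apply: mul1g.
have py p : wperm (delta_wreath Fy) p = p by rewrite delta_wpermE phi2y mulg1.
have ly : wlab (delta_wreath Fy) (zbar N a) = if (d %| a)%N then Fy else 1.
  by rewrite /delta_wreath lift2y ffunE /= (prednK hN) modn_small.
transitivity (wlab (delta_wreath (Fx ^+ a * Fy * Fx ^- a)) ord0) => //.
rewrite !gmulfM gmulfV !wlabM wpermM pa py wlabV -{2}pa permK ly.
rewrite wlab_Fx ?(ltnW aN) //.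
by case: ifP => _ //=; rewrite mulg1 mulgV.
Qed.

End Delta.

Inductive braid_rel : word 'I_3 -> word 'I_3 -> Prop :=
| braid_rel3 (i j : 'I_3) : j = i.+1 :> nat ->
    braid_rel [:: (i, false); (j, false); (i, false)]
              [:: (j, false); (i, false); (j, false)]
| braid_rel2 (i j : 'I_3) : (i.+1 < j)%N ->
    braid_rel [:: (i, false); (j, false)] [:: (j, false); (i, false)].

Definition B4 : groupType := pres braid_rel.

(* With strands numbered 0, ..., 3, sigma k exchanges strands k and k + 1. *)
Definition sigma (k : nat) : B4 := pres_gen _ (inord k).

Definition swap_perm (i : 'I_3) : {perm 'I_4} := tperm (inord i) (inord i.+1).

Lemma swap_permE (i : 'I_3) (p : 'I_4) : swap_perm i p =
  (if p == i :> nat then i.+1 else if p == i.+1 :> nat then i : nat else p) :> nat.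
Proof.
have li : (i < 4)%N := ltnW (ltn_ord i).
have li1 : (i.+1 < 4)%N := ltn_ord i.
rewrite /swap_perm; case: tpermP => [->|->|/eqP]; rewrite ?inordK ?eqxx //.
  by rewrite gtn_eqF ?leqnn //.
rewrite -val_eqE /= inordK // => /negPf -> /eqP.
by rewrite -val_eqE /= inordK // => /negPf ->.
Qed.

Lemma swap_perm_rel r s :
  braid_rel r s -> word_eval swap_perm r = word_eval swap_perm s.
Proof.
move=> rs; apply/permP => p; apply/val_inj.
case: rs => [i j ij|i j ij]; rewrite /word_eval !big_cons !big_nil /letter_eval /=
  !mulg1 !permM !swap_permE; move: ij;
  by case: i j p => [[|[|[|i]]] ?] [[|[|[|j]]] ?] [[|[|[|[|p]]]] ?].
Qed.

Definition braid_perm : gmorph B4 {perm 'I_4} := pres_lift swap_perm_rel.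

Definition P4 : groupType := kerg braid_perm.

Definition artin_conj (i j : nat) : B4 :=
  \prod_(k <- rev (iota i.+1 (j - i.+1))) sigma k.

Lemma artin_subproof i j :
  braid_perm (artin_conj i j * sigma i ^+ 2 * (artin_conj i j)^-1) == 1.
Proof.
have s2 : braid_perm (sigma i ^+ 2) = 1.
  by rewrite gmulfXn [braid_perm _]pres_lift_gen expgS expg1 tperm2.
by rewrite gmulfM gmulfV [X in X * _]gmulfM s2 mulg1 mulgV.
Qed.

(* The Artin generators x_ij, 0 <= i < j <= 3, for strands 0, ..., 3. *)
Definition x_ (i j : nat) : P4 := Kerg (artin_subproof i j).
(* The Artin generators x_ij, 1 <= i < j <= 4, for strands 1, ..., 4. *)
Definition x1_ (i j : nat) : P4 := x_ i.-1 j.-1.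

Section Phi3.
Variable N : nat.

Definition pair_perm_fun (i : 'I_3) (p : 'I_4 * 'I_4) : 'I_4 * 'I_4 :=
  (swap_perm i p.1, swap_perm i p.2).

Lemma pair_perm_inj i : injective (pair_perm_fun i).
Proof. by move=> [a b] [c e] [/perm_inj -> /perm_inj ->]. Qed.

(* The label at (a, b) of a braid counts, with signs and modulo N, the crossings
   where the strands issued from a and b occupy positions i and i + 1, in this
   order. *)
Definition crossing (i : 'I_3) : wreath ('I_4 * 'I_4)%type (Zmod N) :=
  Wreath [ffun p : 'I_4 * 'I_4 => zbar N ((p.1 == i :> nat) && (p.2 == i.+1 :> nat))]
    (perm (@pair_perm_inj i)).

Lemma crossing_rel r s :
  braid_rel r s -> word_eval crossing r = word_eval crossing s.
Proof.
move=> rs; apply: wreath_eq => -[a b].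
{ case: rs => [i j ij|i j ij]; rewrite /word_eval !big_cons !big_nil !mulg1
    !wlabM ?wpermM /letter_eval /= !permE !ffunE /pair_perm_fun /=.
  all: rewrite !swap_permE -!zbarD; move: ij; case: i j => [[|[|[|i]]] ?] [[|[|[|j]]] ?] //= _.
  all: by congr (zbar N _); case: a b => [[|[|[|[|a]]]] ?] [[|[|[|[|b]]]] ?]. }
case: rs => [i j ij|i j ij]; rewrite /word_eval !big_cons !big_nil !mulg1
    ?wpermM /letter_eval /= !permE /pair_perm_fun /=.
all: congr pair; apply/val_inj; rewrite /= !swap_permE; move: ij.
all: case: i j => [[|[|[|i]]] ?] [[|[|[|j]]] ?] //= _.
all: by case: a b => [[|[|[|[|a]]]] ?] [[|[|[|[|b]]]] ?].
Qed.

Definition crossings : gmorph B4 (wreath ('I_4 * 'I_4)%type (Zmod N)) :=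
  pres_lift crossing_rel.

Lemma crossings_perm (g : B4) (p : 'I_4 * 'I_4) :
  wperm (crossings g) p = (braid_perm g p.1, braid_perm g p.2).
Proof.
elim/pres_ind: g p => [|a b IHa IHb|a IH|i] p.
- by rewrite !gmulf1 wperm1 !perm1; case: p.
- by rewrite !gmulfM wpermM IHb IHa !permM.
- rewrite !gmulfV wpermV; apply: (@perm_inj _ (wperm (crossings a))).
  by rewrite permKV IH /= !permKV; case: p.
- have -> : crossings (pres_gen braid_rel i) = crossing i by apply: pres_lift_gen.
  have -> : braid_perm (pres_gen braid_rel i) = swap_perm i by apply: pres_lift_gen.
  by rewrite permE.
Qed.

Definition phi3_fun (g : P4) : {ffun 'I_3 -> Zmod N} :=
  [ffun j => wlab (crossings (val g)) (ord0, lift ord0 j)].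

Lemma phi3_funM : {morph phi3_fun : a b / a * b}.
Proof.
move=> a b; apply/ffunP => j; rewrite !ffunE /= gmulfM wlabM crossings_perm.
by rewrite !(eqP (kerg_prop a)) !perm1.
Qed.

(* phi_{3,N}: its components are the linking numbers modulo N of strand 0 with
   the strands 1, 2, 3; its values on the Artin generators are given by phi3_x. *)
Definition phi3 : gmorph P4 {ffun 'I_3 -> Zmod N} := mk_gmorph phi3_funM.

Lemma wlab_conj (c s : B4) (p : 'I_4 * 'I_4) : braid_perm s = 1 ->
  wlab (crossings (c * s * c^-1)) p = wlab (crossings s) (wperm (crossings c) p).
Proof.
move=> s1; rewrite !gmulfM gmulfV !wlabM wpermM wlabV [wperm (crossings s) _]crossings_perm.
rewrite s1 !perm1 -surjective_pairing permK.
set u := wlab _ _; set v := wlab _ _.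
have C (y z : Zmod N) : y * z = z * y by apply: Zp_mulgC.
by rewrite C mulgA mulVg mul1g.
Qed.

Lemma braid_perm_prod (s : seq nat) (p : 'I_4) : all (fun k => k < 3)%N s ->
  braid_perm (\prod_(k <- s) sigma k) p =
  foldl (fun a k => if a == k then k.+1 else if a == k.+1 then k else a) p s :> nat.
Proof.
elim: s p => [|k s IH] p /=; first by rewrite big_nil gmulf1 perm1.
case/andP=> k3 s3; rewrite big_cons gmulfM permM IH //.
have -> : braid_perm (sigma k) = swap_perm (inord k) by apply: pres_lift_gen.
by rewrite swap_permE inordK.
Qed.

Lemma phi3_x i j : (i < j < 4)%N ->
  phi3 (x_ i j) = [ffun k : 'I_3 => zbar N ((i == 0) && (j == k.+1))].
Proof.
move=> ij; apply/ffunP => k; rewrite !ffunE.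
transitivity (wlab (crossings (artin_conj i j * sigma i ^+ 2 * (artin_conj i j)^-1))
  (ord0, lift ord0 k)) => //.
rewrite wlab_conj; last first.
  by rewrite gmulfXn [braid_perm _]pres_lift_gen expgS expg1 tperm2.
have gE m : crossings (sigma m) = crossing (inord m) by apply: pres_lift_gen.
rewrite gmulfXn expgS expg1 wlabM gE ![wlab (crossing _) _]ffunE permE -zbarD.
rewrite /pair_perm_fun crossings_perm /fst /snd !swap_permE.
have i3 : (i < 3)%N by case/andP: ij => ij j4; apply: leq_trans ij _.
have s3 : all (fun k => k < 3)%N (rev (iota i.+1 (j - i.+1))).
  by case/andP: ij; clear; case: i j => [|[|[|i]]] [|[|[|[|j]]]].
rewrite inordK // /artin_conj !braid_perm_prod //.
congr (zbar N _); case/andP: ij; clear.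
by case: i j k => [|[|[|i]]] [|[|[|[|j]]]] [[|[|[|k]]] ?].
Qed.

End Phi3.

Lemma triv_subproof (G : groupType) :
  {morph (fun _ : G => 1 : Zmod 1) : a b / a * b}.
Proof. by move=> a b; rewrite mulg1. Qed.

Definition triv (G : groupType) : gmorph G (Zmod 1) := mk_gmorph (@triv_subproof G).

Definition prol (l : nat) (G : groupType) : groupType := completion l (triv G).

Lemma gexpz1 (G : groupType) z : gexpz (1 : G) z = 1.
Proof. by case: z => n /=; rewrite expg1n ?invg1. Qed.

(* sub2 c u v is meaningful for c in the completion of F_2 relative to phi2 N as
   soon as u and v satisfy these hypotheses. *)
Lemma lift2_ker l N (G' H' : groupType) (phi' : gmorph G' H')
    (u v : completion l phi') : (0 < N)%N -> proj u ^+ N = 1 -> proj v = 1 ->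
  forall a, phi2 N a = 1 -> proj (lift2 u v a) = 1.
Proof.
move=> N0 uN v1 a.
have P1 : proj (1 : completion l phi') = 1.
  by apply: (mulgI (proj (1 : completion l phi'))); rewrite -projM !mulg1.
have PV (c : completion l phi') : proj c^-1 = (proj c)^-1.
  by apply: (mulgI (proj c)); rewrite -projM !mulgV.
have [z ez uz] : exists2 z, phi2 N a = gexpz (zbar N 1) z
                          & proj (lift2 u v a) = gexpz (proj u) z.
  elim/F2_ind: a => [|a b [y ey uy] [z ez uz]|a [z ez uz]||].
  - by exists 0%R; rewrite !gmulf1.
  - by exists (y + z)%R; rewrite gmulfM ?projM ?ey ?ez ?uy ?uz gexpzD.
  - by exists (- z)%R; rewrite gmulfV ?PV ?ez ?uz gexpzN.
  - by exists 1%R; rewrite ?lift2x ?(phi2x N 1) /= ?expg1.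
  - by exists 0%R; [exact: phi2y | rewrite lift2y v1].
have N0z : (0 < Posz N)%R by [].
have Nz : (Posz N != 0)%R by rewrite -lt0n.
have := ltz_pmod z N0z; have := modz_ge0 z Nz; have := divz_eq z N.
rewrite ez uz; move: (z %% N)%Z (z %/ N)%Z => [r|//] t -> _ rN.
rewrite !gexpzD mulrC !gexpzMn uN zbar1X zbarN !gexpz1 !mul1g /= zbar1X.
by move=> /(congr1 val) /=; rewrite prednK // modn_small // => ->.
Qed.

Lemma zl_half_uniq l (a b : zl l 1) :
  prime l -> (2 * a + 1 = 2 * b + 1)%R -> a = b.
Proof.
move=> lp /addIr; rewrite !mulr_natl !mulr2n => ab; apply/subr0_eq; set c := (a - b)%R.
have c2 : (c + c = 0)%R by rewrite /c addrACA ab -opprD subrr.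
have {c2} c2 k : (zlmod l 1 k %| (c k + c k)%R)%Z.
  by apply/dvdz_mod0P; have := congr1 (fun x : zl l 1 => x k) c2; rewrite /= mod0z.
apply: zl_eq => k; rewrite [RHS]mod0z (zlP c k); apply/dvdz_mod0P.
move: (c2 k.+1); rewrite /zlmod !mul1n -mulr2n -mulr_natr !dvdzE abszM.
rewrite [X in (_ * X)%N]/= -[(1 + 1)%N]/2 [X in (X %| _)%N]/= [X in _ -> (X %| _)%N]/=.
move: (absz (c k.+1)) => m.
have [->|l2] := eqVneq l 2; first by rewrite expnSr dvdn_pmul2r.
rewrite Gauss_dvdl; last by apply: coprimeXl; rewrite prime_coprime // dvdn_prime2.
by apply: dvdn_trans; rewrite dvdn_exp2l.
Qed.

Record gtm_elt (l N : nat) := Gtm {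
  gt_lam : zl l 1;
  gt_mu : zl l N;
  gt_f : prol l F2;
  gt_g : completion l (phi2 N) }.

Section Relations.
Variables l N : nat.

Definition f_antisym (f : prol l F2) : Prop :=
  at2 f Fy Fx = (at2 f Fx Fy)^-1 :> prol l F2.

Definition f_hexagon (nu : zl l 1) (f : prol l F2) : Prop :=
  let x1 := Fx in let x2 := Fy in let x3 := (Fx * Fy)^-1 in
  at2 f x3 x1 * zpow x3 nu * at2 f x2 x3 * zpow x2 nu * at2 f x1 x2 * zpow x1 nu
    = 1 :> prol l F2.

Definition f_pentagon (f : prol l F2) : Prop :=
  at2 f (x1_ 1 2) (x1_ 2 3 * x1_ 2 4) * at2 f (x1_ 1 3 * x1_ 2 3) (x1_ 3 4)
    = at2 f (x1_ 2 3) (x1_ 3 4) * at2 f (x1_ 1 2 * x1_ 1 3) (x1_ 2 4 * x1_ 3 4)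
      * at2 f (x1_ 1 2) (x1_ 2 3) :> prol l P4.

Definition g_hexagon (nu : zl l 1) (mu : zl l N) (g : completion l (phi2 N)) :
    Prop :=
  let z := Fx^-1 * Fy^-1 in
  (at2 g Fx Fy)^-1 * zpow Fy nu * at2 g z Fy * zpow z mu * (at2 g z Fy)^-1
    * zpow Fy (nu + 1)%R * at2 g Fx Fy * zpow Fx mu
    = 1 :> completion l (phi2 N).

Definition mixed_pentagon (f : prol l F2) (g : completion l (phi2 N)) : Prop :=
  at2 g (x_ 0 1) (x_ 1 2 * x_ 1 3) * at2 g (x_ 0 2 * x_ 1 2) (x_ 2 3)
    = at2 f (x_ 1 2) (x_ 2 3) * at2 g (x_ 0 1 * x_ 0 2) (x_ 1 3 * x_ 2 3)
      * at2 g (x_ 0 1) (x_ 1 2) :> completion l (phi3 N).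

(* Here nu is (lambda - 1)/2; it is determined by lambda, see zl_half_uniq. *)
Definition GTM_semigroup (q : gtm_elt l N) : Prop :=
  exists nu : zl l 1, gt_lam q = (2 * nu + 1)%R /\
    [/\ f_antisym (gt_f q), f_hexagon nu (gt_f q), f_pentagon (gt_f q),
        g_hexagon nu (gt_mu q) (gt_g q) & mixed_pentagon (gt_f q) (gt_g q)].

Definition gtm_mul (q1 q2 : gtm_elt l N) : gtm_elt l N :=
  let: Gtm lam1 mu1 f1 g1 := q1 in
  let: Gtm lam2 mu2 f2 g2 := q2 in
  Gtm (lam1 * lam2)%R (mu1 * mu2)%R
    (sub2 f1 (f2 * zpow Fx lam2 * f2^-1) (zpow Fy lam2) * f2)
    (sub2 g1 (g2 * zpow Fx mu2 * g2^-1) (zpow Fy lam2) * g2).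

Definition gtm_one : gtm_elt l N := Gtm 1%R 1%R 1 1.

Definition GTM (q : gtm_elt l N) : Prop :=
  GTM_semigroup q /\
  exists q', [/\ GTM_semigroup q', gtm_mul q q' = gtm_one & gtm_mul q' q = gtm_one].

(* The canonical injection of (Ker phi_N)_l into the completion of F_2. *)
Definition ker_inj : prol l (kerg (phi2 N)) -> completion l (phi2 N) :=
  ext (inc \o kerg_incl (phi2 N)).

(* mu 0 represents the image of mu in Z/NZ, and d is a divisor of N. *)
Definition mod_unit (d : nat) (mu : zl l N) : Prop :=
  exists u : int, ((mu 0%N * u)%R = 1 %[mod d])%Z.

End Relations.

Section DeltaGtm.
Variables (l N N' : nat) (hN : (0 < N)%N) (hNN : (N' %| N)%N).

Definition delta_prol :
    prol l (kerg (phi2 N)) -> prol l (kerg (phi2 N')) :=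
  ext (inc \o deltaK hN hNN).

(* delta_{NN'}(g) for g in (Ker phi_N)_l, that is for g in the image of ker_inj. *)
Definition delta_g (g : completion l (phi2 N)) : completion l (phi2 N') :=
  ker_inj (delta_prol (xget 1 [set h | ker_inj h = g])).

Definition delta_gtm (q : gtm_elt l N) : gtm_elt l N' :=
  Gtm (gt_lam q) (zl_red hNN (gt_mu q)) (gt_f q) (delta_g (gt_g q)).

End DeltaGtm.

(* Main.v *)
Require Import Defs.
From mathcomp Require Import all_boot all_order all_algebra all_fingroup.
From mathcomp Require Import boolp classical_sets cardinality zify.

Set Implicit Arguments.
Unset Strict Implicit.
Unset Printing Implicit Defensive.

Import GRing.Theory.
Local Notation comp := Defs.comp.
Local Open Scope classical_set_scope.
Local Open Scope group_scope.

(* The group F_2 acts on Z/dZ through phi_d, and delta_{NN'} is the value at the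
   state 0 of an F_2-valued cocycle for this action; a cocycle for a finite action
   extends to the partial completions, where its values on products can be computed.
   Two words A and V such that A permutes cyclically a set of d states and V outputs
   only in one of them satisfy a transfer principle: the cocycle takes g(A, V) to
   (delta g)(A', V'), where A' is the value on A ^ d and V' the value on V.
   - Multiplicativity is the case A = g_2 x ^ mu_2 g_2 ^ -1, V = y ^ lambda_2: the
     powers of A visit all the states exactly when mu_2 is invertible modulo d.
   - The hexagon equation writes B := Ad(g(z, y))(z ^ mu), z = x ^ -1 y ^ -1, as a
     conjugate of A ^ -1 y ^ -lambda, A := Ad(g)(x ^ mu); one takes the value of the
     cocycle on d-th powers. If mu is not invertible modulo d, the same equation,
     applied to the cocycle which counts the letters y in a given state, shows that
     y ^ lambda = 1, so that no spurious y survives.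
   - For the mixed pentagon one needs a P_4-valued cocycle on P_4, which describes
     the d-th root of a configuration of three points of the punctured plane. The
     four substitutions of the pentagon are compatible with it, except for
     x_01 x_02, which is replaced by x_01 x_02 x_12: this does not change g, because
     x_12 commutes with the two arguments and the x-degree of g is zero. *)

(** * Levels and continuity *)

Section Levels.
Variables (l : nat) (G H : groupType) (phi : gmorph G H).

Lemma lcosI (g : G) (A B : set G) : lcos g (A `&` B) = lcos g A `&` lcos g B.
Proof.
apply/seteqP; split=> [_ [m [Am Bm] <-]|_ [[m Am <-] [m' Bm' /mulgI e]]].
  by split; exists m.
by exists m => //; split=> //; rewrite -e.
Qed.

Lemma finite_lcosI (K A B : set G) :
  finite_set [set lcos g A | g in K] -> finite_set [set lcos g B | g in K] ->
  finite_set [set lcos g (A `&` B) | g in K].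
Proof.
move=> fA fB; apply: sub_finite_set (finite_image (fun p => p.1 `&` p.2) (finite_setX fA fB)).
move=> _ [g Kg <-]; exists (lcos g A, lcos g B); first by split; exists g.
by rewrite lcosI.
Qed.

Lemma lcos_self (K : set G) :
  (forall a b, K a -> K b -> K (a * b^-1)) -> forall g, K g -> lcos g K = K.
Proof.
move=> KF g Kg.
have K1 : K 1 by rewrite -(mulgV g); apply: KF.
have KV a : K a -> K a^-1 by move=> Ka; rewrite -[a^-1]mul1g; apply: KF.
apply/seteqP; split=> [_ [m Km <-]|m Km].
  by rewrite -[m]invgK; apply/KF/KV.
by exists (g^-1 * m); rewrite ?mulVKg // -[m]invgK; apply: KF; apply: KV.
Qed.

(** A coset of the intersection is determined by its cosets for the single [A s]. The factor [K]
    ensures that the empty intersection yields one coset only, [K] itself. *)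
Lemma finite_lcos_bigI (S : finType) (K : set G) (A : S -> set G) :
  (forall a b, K a -> K b -> K (a * b^-1)) ->
  (forall s, finite_set [set lcos g (A s) | g in K]) ->
  finite_set [set lcos g (K `&` [set g | forall s, A s g]) | g in K].
Proof.
move=> KF fA.
have e : K `&` [set g | forall s, A s g] =
         K `&` [set g | forall s, s \in enum S -> A s g].
  by apply/seteqP; split=> g [Kg Ag]; split=> // s; rewrite ?mem_enum; auto;
     apply: Ag; rewrite mem_enum.
rewrite e; elim: (enum S) => [|s r IH].
  apply: (@sub_finite_set _ _ [set K]); last exact: finite_set1.
  move=> _ [g Kg <-] /=; rewrite -[RHS](lcos_self KF Kg); congr lcos.
  by apply/seteqP; split=> [h []|h Kh].
have -> : K `&` [set g | forall t, t \in s :: r -> A t g] =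
    A s `&` (K `&` [set g | forall t, t \in r -> A t g]).
  apply/seteqP; split=> [g [Kg Ag]|g [Ag [Kg Ar]]].
    split; first by apply: Ag; rewrite mem_head.
    by split=> // t tr; apply: Ag; rewrite in_cons tr orbT.
  by split=> // t; rewrite in_cons => /orP[/eqP ->|/Ar].
exact: finite_lcosI.
Qed.

Lemma levelI_subproof (M M' : level l phi) : is_level l phi (M `&` M').
Proof.
split.
- by split; apply: level1 (levelP _).
- by move=> a b [? ?] [? ?]; split; apply: levelF (levelP _) _ _ _ _.
- by move=> a [/(level_ker (levelP _))].
- by move=> g a [? ?]; split; apply: levelJ (levelP _) _ _ _.
- by apply: finite_lcosI; apply: level_fin (levelP _).
- move=> g pg; have [j Mj] := level_lgrp (levelP M) pg.
  have [k Mk] := level_lgrp (levelP M') pg; exists (j + k)%N.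
  have X (L : level l phi) a n : lset L a -> lset L (a ^+ n).
    by apply: (@level_gexpz l G H phi L a n%:Z).
  by rewrite expnD; split; [rewrite expgM | rewrite mulnC expgM]; apply: X.
Qed.

Definition levelI M M' := Level (levelI_subproof M M').

Lemma compIl (c : completion l phi) M M' g : comp c (levelI M M') g -> comp c M g.
Proof. by apply: (compat_incl (compP c)) => a []. Qed.

Lemma compIr (c : completion l phi) M M' g : comp c (levelI M M') g -> comp c M' g.
Proof. by apply: (compat_incl (compP c)) => a []. Qed.

Lemma comp_inc (M : level l phi) g : comp (inc g : completion l phi) M = lcos g M.
Proof. by []. Qed.

Lemma proj1g : proj (1 : completion l phi) = 1.
Proof. by apply: (mulgI (proj (1 : completion l phi))); rewrite -projM !mulg1. Qed.

Lemma projV (c : completion l phi) : proj c^-1 = (proj c)^-1.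
Proof. by apply: (mulgI (proj c)); rewrite -projM !mulgV proj1g. Qed.

Lemma projX (c : completion l phi) n : proj (c ^+ n) = proj c ^+ n.
Proof. by elim: n => [|n IH]; rewrite ?proj1g // !expgS projM IH. Qed.

End Levels.

Section Continuity.
Variable l : nat.

(** Continuity, phrased through the dense image of [G]: the component of [F c] at [M'] can be
    computed on any representative of [c] at a fine enough level. *)
Definition cont (G H G' H' : groupType) (phi : gmorph G H) (phi' : gmorph G' H')
    (F : completion l phi -> completion l phi') : Prop :=
  forall M', exists M, forall c g, comp c M g -> comp (F c) M' = comp (F (inc g)) M'.

Variables (G H G' H' : groupType) (phi : gmorph G H) (phi' : gmorph G' H').
Implicit Types F E : completion l phi -> completion l phi'.

(** [G] is dense in its completion. When [proj c = 1], the representatives of [c] lie in [Ker phi],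
    so a comparison on [Ker phi] suffices. *)
Lemma cont_eq F E : cont F -> cont E ->
  (forall g, phi g = 1 -> F (inc g) = E (inc g)) ->
  forall c, proj c = 1 -> F c = E c.
Proof.
move=> cF cE FE c pc; apply: completion_eq => M'.
have [M FM] := cF M'; have [L EL] := cE M'.
have [g cg] := comp_ex (levelI M L) c.
rewrite (FM _ _ (compIl cg)) (EL _ _ (compIr cg)) FE //.
by rewrite -(projE cg).
Qed.

Lemma cont_ext (f : gmorph G (completion l phi')) :
  (forall a, phi a = 1 -> proj (f a) = 1) -> cont (ext f : completion l phi -> _).
Proof.
move=> f_ker M'; exists (pull f_ker M') => c g cg.
by rewrite (extE cg) ext_inc.
Qed.

Lemma cont_id : cont (fun c : completion l phi => c).
Proof. by move=> M; exists M => c g /comp_repr. Qed.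

Lemma cont_comp (G2 H2 : groupType) (phi2 : gmorph G2 H2)
    (E : completion l phi' -> completion l phi2) F :
  cont E -> cont F -> cont (fun c => E (F c)).
Proof.
move=> cE cF M'; have [M EM] := cE M'; have [L FL] := cF M.
exists L => c g cg; have [h Fh] := comp_ex M (F c).
rewrite (EM _ _ Fh); rewrite (FL _ _ cg) in Fh; by rewrite (EM _ _ Fh).
Qed.

End Continuity.

(** * Cocycles and completions *)

(* A morphism W : G -> wreath S G' is an action of G on S together with the
   G'-valued cocycle (s, g) |-> wlab (W g) s; in its extension to completions
   below, wact is the action and wext the cocycle. *)
Section CocycleExtension.
Variables (l : nat) (S : finType) (G H G' H' : groupType).
Variables (phi : gmorph G H) (phi' : gmorph G' H') (W : gmorph G (wreath S G')).

(** The condition for extending the cocycle to completions: the action factors through [phi], and on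
    [Ker phi] each label is a morphism to [Ker phi'], along which levels pull back. *)
Definition tame := forall g, phi g = 1 ->
  forall s, wperm (W g) s = s /\ phi' (wlab (W g) s) = 1.

(** The labels in all the states are constrained at once, because conjugation by [g] carries the
    label at one state to a conjugate of the label at another; this gives normality. *)
Definition wpull_set (M' : level l phi') : set G :=
  [set g | phi g = 1] `&` [set g | forall s, lset M' (wlab (W g) s)].

Definition wext_comp s (c : completion l phi) (M' : level l phi') : set G' :=
  [set h | exists M : level l phi, M `<=` wpull_set M' /\
     exists2 g, comp c M g & lcos (wlab (W g) s) M' h].

Definition wext s (c : completion l phi) : completion l phi' :=
  mk_completion (wext_comp s c).

(** The default value of [xget] never occurs, since a component is a nonempty coset; under [tame]
    the chosen representative does not matter, see [wactE]. *)
Definition wact (c : completion l phi) s : S :=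
  wperm (W (xget 1 (comp c (level_top l phi)))) s.

Hypothesis tW : tame.

Lemma wperm_eq g h : phi g = phi h -> wperm (W g) =1 wperm (W h).
Proof.
move=> e s; have p : phi (h^-1 * g) = 1 by rewrite gmulfM gmulfV e mulVg.
rewrite -[g](mulVKg h) gmulfM wpermM.
by have [-> _] := tW p (wperm (W h) s).
Qed.

Lemma wlab_sub s g h (M' : level l phi') : phi g = phi h ->
  (forall t, lset M' (wlab (W (g^-1 * h)) t)) ->
  lcos (wlab (W g) s) M' = lcos (wlab (W h) s) M'.
Proof.
move=> e Mgh; apply/lcos_eqP.
by rewrite -{1}[h](mulVKg g) gmulfM wlabM mulKg; apply: Mgh.
Qed.

Lemma wpull_subproof (M' : level l phi') : is_level l phi (wpull_set M').
Proof.
split.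
- split=> [|s]; first exact: gmulf1.
  by rewrite gmulf1 wlab1; apply: level1 (levelP M').
- move=> a b [/= pa Ma] [/= pb Mb]; split=> [|s] /=; first by rewrite gmulfF pa pb divgg.
  have pbV : phi b^-1 = 1 by rewrite gmulfV pb invg1.
  have [_ _] := tW pbV s.
  have [ea _] := tW pa s.
  rewrite gmulfM wlabM ea gmulfV wlabV.
  have -> : (wperm (W b))^-1 s = s.
    by apply: (@perm_inj _ (wperm (W b))); rewrite permKV; have [-> _] := tW pb s.
  exact: levelF (levelP M') _ _ (Ma s) (Mb s).
- by move=> a [].
- move=> g a [/= pa Ma]; split=> [|s] /=; first by rewrite !gmulfM gmulfV pa mulg1 mulgV.
  rewrite gmulfM wlabM gmulfM wlabM wpermM.
  have [-> _] := tW pa (wperm (W g) s).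
  have -> : wlab (W g^-1) (wperm (W g) s) = (wlab (W g) s)^-1.
    by apply: (mulgI (wlab (W g) s)); rewrite -wlabM -gmulfM !mulgV gmulf1 wlab1.
  by apply: levelJ (levelP M') _ _ _.
(* Inside [Ker phi], finiteness is checked state by state: for each state, the coset of [g] is
   determined by that of its label. *)
- apply: (@finite_lcos_bigI G S [set g | phi g = 1] (fun s => [set g | lset M' (wlab (W g) s)])).
    by move=> a b /= pa pb; rewrite gmulfF pa pb divgg.
  move=> s; pose F (C : set G') : set G := [set h | C (wlab (W h) s)].
  apply: sub_finite_set (finite_image F (level_fin (levelP M'))).
  move=> _ [g /= pg <-] /=; exists (lcos (wlab (W g) s) M').
    by exists (wlab (W g) s) => //=; have [] := tW pg s.
  have D h : wlab (W h) s = wlab (W g) s * wlab (W (g^-1 * h)) s.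
    by rewrite -{1}[h](mulVKg g) gmulfM wlabM (proj1 (tW pg s)).
  apply/seteqP; split=> [h /lcosE|_ [m Mm <-]].
    by rewrite (D h) mulKg => Mh; exists (g^-1 * h); rewrite ?mulVKg.
  by apply/lcosE; rewrite (D (g * m)) !mulKg.
(* [f s] is an exponent that works at the state [s]; the sum of all of them works everywhere. *)
- move=> g pg; have [f fP] := fin_all_exists (fun s => level_lgrp (levelP M') (proj2 (tW pg s))).
  exists (\sum_s f s)%N; split=> [|s] /=; first by rewrite gmulfXn pg expg1n.
  have gX n : wlab (W (g ^+ n)) s = wlab (W g) s ^+ n.
    elim: n => [|n IH]; first by rewrite gmulf1 wlab1.
    by rewrite !expgS gmulfM wlabM (proj1 (tW pg s)) IH.
  rewrite gX (bigD1 s) //= expnD expgM.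
  exact: (@level_gexpz l G' H' phi' M' _ (Posz _)).
Qed.

Definition wpull M' : level l phi := Level (wpull_subproof M').

Lemma wext_compE s (c : completion l phi) M' g :
  comp c (wpull M') g -> wext_comp s c M' = lcos (wlab (W g) s) M'.
Proof.
move=> cg; apply/seteqP; split=> [h [M [MP [g' cg' gh]]]|h gh]; last first.
  by exists (wpull M'); split=> //; exists g.
have {}cg' := compat_incl (compP c) (MP : lset M `<=` wpull M') cg'.
have := cg'; rewrite (comp_repr cg) => /lcosE [_ gg'].
by rewrite (@wlab_sub s g g') // -(projE cg) -(projE cg').
Qed.

Lemma wext_compatible s c : is_compatible (wext_comp s c).
Proof.
split=> [M|M M' MM].
  have [g cg] := comp_ex (wpull M) c; rewrite (wext_compE s cg).
  by exists (wlab (W g) s).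
have PP : wpull M `<=` wpull M' by move=> a [pa Ma]; split=> // t; apply: MM.
have [g cg] := comp_ex (wpull M) c; rewrite (wext_compE s cg).
rewrite (wext_compE s (compat_incl (compP c) PP cg)).
exact: lcos_sub.
Qed.

Lemma wextE s c M' g : comp c (wpull M') g -> comp (wext s c) M' = lcos (wlab (W g) s) M'.
Proof.
by move=> cg; rewrite mk_completionE; [exact: wext_compE | exact: wext_compatible].
Qed.

Lemma wext_inc s g : wext s (inc g) = inc (wlab (W g) s).
Proof. by apply: completion_eq => M'; apply: wextE; apply: lcos_refl. Qed.

Lemma wactE c (M : level l phi) g : comp c M g -> wact c =1 wperm (W g).
Proof.
move=> cg; apply: wperm_eq; rewrite -(projE cg).
have [h ch] := comp_ex (level_top l phi) c.
by case: xgetP => [k _ /projE //|/(_ h)].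
Qed.

Lemma wact_inc g : wact (inc g) =1 wperm (W g).
Proof. by apply: (@wactE _ (level_top l phi)); apply: lcos_refl. Qed.

Lemma wact_proj c d : proj c = proj d -> wact c =1 wact d.
Proof.
have [g cg] := comp_ex (level_top l phi) c; have [h dh] := comp_ex (level_top l phi) d.
rewrite (projE cg) (projE dh) => e s; rewrite (wactE cg) (wactE dh).
exact: wperm_eq.
Qed.

Lemma wactM c d s : wact (c * d) s = wact d (wact c s).
Proof.
have [g cg] := comp_ex (level_top l phi) c; have [h dh] := comp_ex (level_top l phi) d.
by rewrite (wactE cg) (wactE dh) (wactE (comp_mul cg dh)) gmulfM wpermM.
Qed.

Lemma wact1 s : wact 1 s = s.
Proof. by rewrite wact_inc gmulf1 wperm1. Qed.

Lemma wact_ker c s : proj c = 1 -> wact c s = s.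
Proof. by move=> pc; rewrite (@wact_proj c 1) ?wact1 // proj1g. Qed.

Lemma wextM s c d : wext s (c * d) = wext s c * wext (wact c s) d.
Proof.
apply: completion_eq => M'.
have [g cg] := comp_ex (wpull M') c; have [h dh] := comp_ex (wpull M') d.
rewrite (wextE s (comp_mul cg dh)) gmulfM wlabM /= (wextE s cg) (wextE _ dh).
by rewrite lcos_mul (wactE cg).
Qed.

Lemma wext1 s : wext s 1 = 1.
Proof. by rewrite wext_inc gmulf1 wlab1. Qed.

Lemma wextV s c : wact c s = s -> wext s c^-1 = (wext s c)^-1.
Proof.
by move=> e; apply: (mulgI (wext s c)); rewrite -{2}e -wextM !mulgV wext1.
Qed.

Lemma wext_proj s c : proj c = 1 -> proj (wext s c) = 1.
Proof.
move=> pc; have [g cg] := comp_ex (wpull (level_top l phi')) c.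
have cW : comp (wext s c) (level_top l phi') (wlab (W g) s).
  by rewrite (wextE s cg); apply: lcos_refl.
by rewrite (projE cW); apply: proj2 (tW _ s); rewrite -(projE cg).
Qed.

Lemma wext_conj s c d : wact c s = s -> wact d s = s ->
  wext s (c * d * c^-1) = wext s c * wext s d * (wext s c)^-1.
Proof. by move=> cs ds; rewrite !wextM wactM cs ds wextV. Qed.

Lemma cont_wext s : cont (wext s).
Proof. by move=> M'; exists (wpull M') => c g cg; rewrite (wextE s cg) wext_inc. Qed.

End CocycleExtension.

Arguments wext {l S G H G' H' phi phi'} W s c.
Arguments wact {l S G H G' phi} W c s.
Arguments wext_inc {l S G H G' H' phi phi' W} tW s g.
Arguments wact_inc {l S G H G' H' phi phi' W} tW g.
Arguments wext1 {l S G H G' H' phi phi' W} tW s.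
Arguments wact1 {l S G H G' H' phi phi' W} tW s.

(** * The cocycle of delta on the free group *)

Section ZpowFacts.
Variables (l m : nat) (G H : groupType) (phi : gmorph G H) (w : G).
Hypothesis wm : phi w ^+ m = 1.

Lemma level_expS (M : level l phi) j k : (j <= k)%N ->
  lset M (w ^+ (m * l ^ j)) -> lset M (w ^+ (m * l ^ k)).
Proof.
move=> jk Mj; rewrite -(subnK jk) addnC expnD mulnA expgM.
exact: (@level_gexpz l G H phi M _ (Posz _)).
Qed.

Lemma proj_zpow (a : zl l m) : proj (zpow w a : completion l phi) = gexpz (phi w) (a 0%N).
Proof.
have M0 : lset (level_top l phi) (w ^+ (m * l ^ 0)) by rewrite /= muln1 gmulfXn.
have c0 : comp (zpow w a : completion l phi) (level_top l phi) (gexpz w (a 0%N)).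
  by rewrite (zpowE wm _ M0); apply: lcos_refl.
by rewrite (projE c0); case: (a 0%N) => k /=; rewrite ?gmulfV gmulfXn.
Qed.

Lemma zpow0 : zpow w (0%R : zl l m) = 1 :> completion l phi.
Proof. by rewrite [0%R]/(zl_int l m 0) (zpow_int l wm) gmulf1. Qed.

Lemma zpowN (a : zl l m) : zpow w (- a)%R = (zpow w a)^-1 :> completion l phi.
Proof. by apply: (mulgI (zpow w a)); rewrite -zpowD // subrr zpow0 mulgV. Qed.

Lemma zpow_gexpzC (a : zl l m) z :
  zpow w a * inc (gexpz w z) = inc (gexpz w z) * zpow w a :> completion l phi.
Proof. by rewrite -(zpow_int l wm) -!zpowD // addrC. Qed.

End ZpowFacts.

Lemma gexpzX (G : groupType) (w : G) z n : gexpz w z ^+ n = gexpz w (n%:Z * z)%R.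
Proof.
elim: n => [|n IH]; first by rewrite mul0r.
by rewrite expgS IH intS mulrDl mul1r gexpzD.
Qed.

Lemma zpow_base1 (l m : nat) (G H : groupType) (phi : gmorph G H) (a : zl l m) :
  zpow 1 a = 1 :> completion l phi.
Proof.
have p1 : phi 1 ^+ m = 1 by rewrite gmulf1 expg1n.
apply: completion_eq => M; have [k Mk] := zpow_level p1 M.
by rewrite (zpowE p1 _ Mk) gexpz1.
Qed.

Lemma zl_red_id (l m : nat) (mm : m %| m) (a : zl l m) : zl_red mm a = a.
Proof. by apply: zl_eq => k /=; rewrite zl_modK. Qed.

(** At a stage fine enough for both completions, [a] may be replaced by an integer, and there the
    hypothesis on the labels applies. *)
Lemma wext_zpow (l : nat) (S : finType) (G H G' H' : groupType)
    (phi : gmorph G H) (phi' : gmorph G' H') (W : gmorph G (wreath S G'))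
    (tW : tame phi phi' W) (m m' : nat) (dm : (m' %| m)%N) (a : zl l m)
    (w : G) (w' : G') (e : nat) (s : S) :
  phi w ^+ m = 1 -> phi' w' ^+ m' = 1 ->
  (forall z, wlab (W (gexpz w (e%:Z * z)%R)) s = gexpz w' z) ->
  wext W s (zpow w a ^+ e : completion l phi) = zpow w' (zl_red dm a) :> completion l phi'.
Proof.
move=> pw pw' We; apply: completion_eq => M'.
have [j Mj] := zpow_level pw (wpull tW M'); have [k Mk] := zpow_level pw' M'.
have {}Mj := level_expS (leq_addr k j) Mj; have {}Mk := level_expS (leq_addl j k) Mk.
have ca : comp (zpow w a ^+ e : completion l phi) (wpull tW M') (gexpz w (e%:Z * a (j + k)%N)%R).
  by rewrite -gexpzX; apply: comp_exp; rewrite (zpowE pw _ Mj); apply: lcos_refl.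
by rewrite (wextE s ca) We (zpowE pw' _ Mk) /= gexpz_modz.
Qed.

Lemma zbar_eqP N i j : (0 < N)%N -> zbar N i = zbar N j <-> i = j %[mod N].
Proof.
move=> N0; split=> [/(congr1 (@nat_of_ord _)) /=|e]; first by rewrite prednK.
by apply/val_inj; rewrite /= prednK.
Qed.

Lemma Zmod_lt N (u : Zmod N) : (0 < N)%N -> (nat_of_ord u < N)%N.
Proof. by move=> N0; rewrite -[X in (_ < X)%N](prednK N0); apply: ltn_ord. Qed.

Lemma Zmod_succ N (u : Zmod N) : (0 < N)%N ->
  nat_of_ord (u * zbar N 1 : Zmod N) = ((nat_of_ord u).+1 %% N)%N.
Proof.
move=> N0; rewrite -{1}(zbar_val u) -zbarD addn1 [LHS]/=.
by move: (nat_of_ord u) => i; rewrite prednK.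
Qed.

Lemma gexpz_zbar1 N (N0 : (0 < N)%N) z : gexpz (zbar N 1) z = 1 <-> (N %| z)%Z.
Proof.
have N0z : (0 < Posz N)%R by [].
have Nz : (Posz N != 0)%R by rewrite -lt0n.
have -> : gexpz (zbar N 1) z = gexpz (zbar N 1) (z %% N)%Z.
  by rewrite {1}(divz_eq z N) gexpzD mulrC gexpzMn zbar1X zbarN gexpz1 mul1g.
have := ltz_pmod z N0z; have := modz_ge0 z Nz.
have -> : (N %| z)%Z = ((z %% N)%Z == 0%R) by apply/dvdz_mod0P/eqP.
case: (z %% N)%Z => // r _ rN; rewrite /= zbar1X; split.
  by move=> /(congr1 (@nat_of_ord _)) /=; rewrite prednK // modn_small // => ->.
by move=> /eqP[->]; rewrite zbar0.
Qed.

(** The exponent sum of [x] serves all the moduli at once, so that different [N] can be compared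
    through integers. *)
Lemma phi2_gexpz (g : F2) : exists z, forall N, phi2 N g = gexpz (zbar N 1) z.
Proof.
elim/F2_ind: g => [|a b [y ey] [z ez]|a [z ez]||].
- by exists 0%R => N; rewrite gmulf1.
- by exists (y + z)%R => N; rewrite gmulfM ey ez gexpzD.
- by exists (- z)%R => N; rewrite gmulfV ez gexpzN.
- by exists 1%R => N; rewrite (phi2x N 1) /= expg1.
- by exists 0%R => N; rewrite phi2y.
Qed.

(* The wreath morphism of which delta_wreath is the lift to the states Z/NZ, when
   u = x; the case u = 1 counts the occurrences of y in a given state. *)
Section Dwreath.
Variable d : nat.

Definition dwreath_x (u : F2) : wreath 'I_d.-1.+1 F2 :=
  Wreath [ffun a : 'I_d.-1.+1 => if a.+1 == d then u else 1] (zshift (zbar d 1)).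
Definition dwreath_y : wreath 'I_d.-1.+1 F2 :=
  Wreath [ffun a : 'I_d.-1.+1 => if a == ord0 then Fy else 1] 1.
Definition dwreath (u : F2) : gmorph F2 (wreath 'I_d.-1.+1 F2) :=
  lift2 (dwreath_x u) dwreath_y.

Lemma dwreath_wperm u (g : F2) (a : Zmod d) : wperm (dwreath u g) a = a * phi2 d g.
Proof.
elim/F2_ind: g a => [|g h IHg IHh|g IH||] a.
- by rewrite !gmulf1 wperm1 mulg1.
- by rewrite !gmulfM wpermM IHh IHg mulgA.
- rewrite !gmulfV wpermV; apply: (@perm_inj _ (wperm (dwreath u g))).
  by rewrite permKV IH mulgVK.
- by rewrite /dwreath lift2x permE /phi2 lift2x.
- by rewrite /dwreath lift2y perm1 phi2y mulg1.
Qed.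

Lemma dwreath_labx u a : wlab (dwreath u Fx) a = if a.+1 == d then u else 1.
Proof. by rewrite /dwreath lift2x ffunE. Qed.

Lemma dwreath_laby u a : wlab (dwreath u Fy) a = if a == ord0 then Fy else 1.
Proof. by rewrite /dwreath lift2y ffunE. Qed.

Hypothesis d0 : (0 < d)%N.

Section LinkingNumber.
Variable n : nat.
Hypothesis n0 : (0 < n)%N.

(** The injection of [Z/nZ] into [Z/dnZ] given by multiplication by [d]; degrees modulo [n] and
    modulo [d n] are compared through it. *)
Definition dmul (u : Zmod n) : Zmod (d * n) := zbar (d * n) (d * u).

Lemma dmulM : {morph dmul : u v / u * v}.
Proof.
move=> u v; rewrite /dmul -zbarD -mulnDr; apply/val_inj.
rewrite [LHS]/= [RHS]/=; move: (nat_of_ord u) (nat_of_ord v) => i j.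
by rewrite !prednK ?muln_gt0 ?d0 // -!muln_modr modn_mod.
Qed.

Lemma dmul1 : dmul 1 = 1.
Proof. by apply: (mulgI (dmul 1)); rewrite -dmulM !mulg1. Qed.

Lemma dmul_inj : injective dmul.
Proof.
move=> u v /zbar_eqP; rewrite muln_gt0 d0 n0 => /(_ isT).
rewrite !modn_small ?ltn_pmul2l ?Zmod_lt // => /eqP; rewrite eqn_pmul2l // => /eqP.
exact: val_inj.
Qed.

Lemma dmul_zbar1 : dmul (zbar n 1) = zbar (d * n) d.
Proof.
apply/zbar_eqP; first by rewrite muln_gt0 d0.
by rewrite /= (prednK n0) muln_modr muln1 modn_mod.
Qed.

Lemma zbar_succ (a : Zmod d) :
  zbar (d * n) (nat_of_ord a).+1 = (if (nat_of_ord a).+1 == d then dmul (zbar n 1) else 1)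
    * zbar (d * n) (nat_of_ord (a * zbar d 1 : Zmod d)).
Proof.
rewrite Zmod_succ //; case: eqP => [->|e]; first by rewrite modnn zbar0 mulg1 dmul_zbar1.
rewrite mul1g modn_small // ltn_neqAle; apply/andP; split; first exact/eqP.
exact: Zmod_lt.
Qed.

(** Euclidean division by [d]: the initial state plus the degree of [g] in [x] is [d] times the
    number of full turns, which the label counts, plus the final state. *)
Lemma dwreath_phi2 (g : F2) (a : Zmod d) :
  dmul (phi2 n (wlab (dwreath Fx g) a)) * zbar (d * n) (nat_of_ord (a * phi2 d g : Zmod d))
  = zbar (d * n) (nat_of_ord a) * phi2 (d * n) g.
Proof.
elim/F2_ind: g a => [|g h IHg IHh|g IH||] a.
- by rewrite !gmulf1 wlab1 gmulf1 !mulg1 dmul1 mul1g.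
- rewrite [phi2 d _]gmulfM [phi2 (d * n) _]gmulfM [dwreath _ _]gmulfM wlabM gmulfM dmulM.
  by rewrite dwreath_wperm -mulgA (mulgA a) IHh mulgA IHg mulgA.
- have := IH (a * (phi2 d g)^-1); rewrite mulgVK !gmulfV wlabV.
  have -> : (wperm (dwreath Fx g))^-1 a = a * (phi2 d g)^-1 :> Zmod d.
    by apply: (@perm_inj _ (wperm (dwreath Fx g))); rewrite permKV dwreath_wperm mulgVK.
  rewrite gmulfV; set u := phi2 n _ => e.
  apply: (mulIg (phi2 (d * n) g)); rewrite mulgVK -mulgA -e mulgA -dmulM.
  by rewrite mulVg dmul1 mul1g.
- rewrite dwreath_labx (phi2x d 1) (phi2x _ 1) -zbarD addn1 zbar_succ.
  by case: ifP; rewrite ?(phi2x _ 1) // gmulf1 dmul1.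
- rewrite dwreath_laby !phi2y !mulg1.
  by case: ifP; rewrite ?phi2y ?gmulf1 dmul1 mul1g.
Qed.

End LinkingNumber.

End Dwreath.

Lemma phi2_dvd d n (g : F2) : (0 < d)%N -> (0 < n)%N -> phi2 (d * n) g = 1 -> phi2 d g = 1.
Proof.
move=> d0 n0; have [z ez] := phi2_gexpz g; rewrite !ez !gexpz_zbar1 ?muln_gt0 ?d0 //.
by apply: dvdz_trans; rewrite dvdzE /= dvdn_mulr.
Qed.

(** In the division formula [dwreath_phi2] the initial and final states cancel, and [dmul] is
    injective. *)
Lemma dwreath_tame d n : (0 < d)%N -> (0 < n)%N ->
  tame (phi2 (d * n)) (phi2 n) (dwreath d Fx).
Proof.
move=> d0 n0 g pg a; have pd := phi2_dvd d0 n0 pg.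
have e : wperm (dwreath d Fx g) a = a by rewrite dwreath_wperm pd mulg1.
split=> //; apply: (dmul_inj d0 n0); rewrite dmul1 //.
apply: (mulIg (zbar (d * n) (nat_of_ord a))); rewrite mul1g.
by have := dwreath_phi2 d0 n0 g a; rewrite pg pd !mulg1.
Qed.

Lemma dwreath1_tame d n : (0 < d)%N -> (0 < n)%N ->
  tame (phi2 (d * n)) (phi2 n) (dwreath d 1).
Proof.
move=> d0 n0 g pg a; split; first by rewrite dwreath_wperm (phi2_dvd d0 n0) ?mulg1.
elim/F2_ind: g a {pg} => [|g h IHg IHh|g IH||] a.
- by rewrite gmulf1 wlab1 gmulf1.
- by rewrite gmulfM wlabM gmulfM IHg IHh mulg1.
- by rewrite gmulfV wlabV gmulfV IH invg1.
- by rewrite dwreath_labx; case: ifP => _; rewrite gmulf1.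
- by rewrite dwreath_laby; case: ifP => _; rewrite ?gmulf1 ?phi2y.
Qed.

(* The cocycle of F_2 induced from the identity of Ker phi_N, for the
   transversal x^a, 0 <= a < N. *)
Section KernelCocycle.
Variables (N : nat).

Lemma ker_label_subproof (a : Zmod N) g :
  phi2 N (Fx ^+ (nat_of_ord a) * g * Fx ^- (nat_of_ord (a * phi2 N g))) == 1.
Proof.
by rewrite gmulfM [X in X * _]gmulfM gmulfV !phi2x !zbar_val mulgV.
Qed.

Definition ker_label a g : kerg (phi2 N) := Kerg (ker_label_subproof a g).

Lemma ker_labelE (a : Zmod N) g : val (ker_label a g) =
  Fx ^+ (nat_of_ord a) * g * Fx ^- (nat_of_ord (a * phi2 N g)).
Proof. by []. Qed.

Definition ker_cocycle_fun (g : F2) : wreath 'I_N.-1.+1 (kerg (phi2 N)) :=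
  Wreath [ffun a : 'I_N.-1.+1 => ker_label a g] (zshift (phi2 N g)).

Lemma ker_cocycle_funM : {morph ker_cocycle_fun : g h / g * h}.
Proof.
move=> g h; apply: wreath_eq => a; last first.
  by rewrite wpermM /= !permE /= gmulfM mulgA.
rewrite wlabM !ffunE /= permE; apply/val_inj.
change (val (ker_label a (g * h)) =
  val (ker_label a g) * val (ker_label ((a : Zmod N) * phi2 N g) h)).
by rewrite !ker_labelE gmulfM !mulgA mulgKV.
Qed.

Definition ker_cocycle : gmorph F2 (wreath 'I_N.-1.+1 (kerg (phi2 N))) :=
  mk_gmorph ker_cocycle_funM.

Lemma ker_cocycle_tame : tame (phi2 N) (triv (kerg (phi2 N))) ker_cocycle.
Proof.
by move=> g pg a; split=> //; rewrite /= permE pg mulg1.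
Qed.

End KernelCocycle.

Lemma ker_inj_ker l N (a : kerg (phi2 N)) : triv (kerg (phi2 N)) a = 1 ->
  proj ((inc \o kerg_incl (phi2 N)) a : completion l (phi2 N)) = 1.
Proof. by move=> _; apply: etrans (proj_inc _ _ (val a)) (eqP (kerg_prop a)). Qed.

(** The preimage is explicit: from the state 0 the cocycle sends an element of [Ker phi_N] to
    itself, so its composition with [ker_inj] is the identity on a dense subset. *)
Lemma ker_inj_surj l N (c : completion l (phi2 N)) : proj c = 1 ->
  ker_inj (wext (ker_cocycle N) ord0 c) = c.
Proof.
have tK := @ker_cocycle_tame N.
move: c; apply: (@cont_eq _ _ _ _ _ _ _ (fun c => ker_inj (wext (ker_cocycle N) ord0 c)) id).
- apply: (@cont_comp _ _ _ _ _ _ _ _ _ _ (@ker_inj l N)).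
    by apply: cont_ext; exact: ker_inj_ker.
  exact: cont_wext.
- exact: cont_id.
- move=> g pg; rewrite (wext_inc tK) /ker_inj (ext_inc (@ker_inj_ker l N)).
  congr (inc _); rewrite ffunE -[RHS]/(id g).
  change (val (ker_label (ord0 : Zmod N) g) = g).
  by rewrite ker_labelE pg mul1g mulg1 /= invg1 mulg1.
Qed.

(** * The map delta as a value of the cocycle *)

Section DeltaAsCocycle.
Variables (d n : nat) (d0 : (0 < d)%N) (n0 : (0 < n)%N).

Lemma zbar_red (u v : Zmod (d * n)) :
  zbar d (nat_of_ord (u * v)) = zbar d (nat_of_ord u) * zbar d (nat_of_ord v).
Proof.
rewrite -zbarD; apply/zbar_eqP => //.
change (nat_of_ord (u * v)) with ((nat_of_ord u + nat_of_ord v) %% (d * n).-1.+1)%N.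
move: (nat_of_ord u) (nat_of_ord v) => i j.
by rewrite prednK ?muln_gt0 ?d0 // modn_dvdm // dvdn_mulr.
Qed.

Lemma phi2_red g : zbar d (nat_of_ord (phi2 (d * n) g)) = phi2 d g.
Proof.
elim/F2_ind: g => [|g h IHg IHh|g IH||].
- by rewrite !gmulf1 /= zbar0.
- by rewrite [phi2 (d * n) _]gmulfM zbar_red IHg IHh gmulfM.
- apply: (mulIg (phi2 d g)); rewrite -{1}IH -zbar_red gmulfV mulVg /= zbar0.
  by rewrite gmulfV mulVg.
- rewrite !(phi2x _ 1); apply/zbar_eqP => //=.
  by rewrite prednK ?muln_gt0 ?d0 // modn_dvdm // dvdn_mulr.
- by rewrite !phi2y zbar0.
Qed.

(** Only the states modulo [d] matter: [d] divides [a + 1] exactly when [a] has remainder [d - 1],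
    and divides [a] exactly when [a] has remainder 0. *)
Lemma delta_wreath_lab g (a : Zmod (d * n)) :
  wlab (delta_wreath (d * n) n g) a = wlab (dwreath d Fx g) (zbar d (nat_of_ord a)).
Proof.
elim/F2_ind: g a => [|g h IHg IHh|g IH||] a.
- by rewrite !gmulf1 !wlab1.
- rewrite !gmulfM !wlabM IHg IHh delta_wpermE dwreath_wperm.
  by rewrite zbar_red phi2_red.
- have := IH (a * (phi2 (d * n) g)^-1); rewrite !gmulfV !wlabV.
  have -> : (wperm (delta_wreath (d * n) n g))^-1 a = a * (phi2 (d * n) g)^-1 :> Zmod _.
    by apply: (@perm_inj _ (wperm (delta_wreath (d * n) n g))); rewrite permKV delta_wpermE mulgVK.
  have -> : (wperm (dwreath d Fx g))^-1 (zbar d (nat_of_ord a)) =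
       zbar d (nat_of_ord (a * (phi2 (d * n) g)^-1)) :> Zmod _.
    apply: (@perm_inj _ (wperm (dwreath d Fx g))); rewrite permKV dwreath_wperm.
    by rewrite -phi2_red -zbar_red mulgVK.
  by move=> ->.
- rewrite dwreath_labx /delta_wreath lift2x ffunE mulnK //.
  congr (if _ then _ else _); rewrite [X in _ = X]/=; move: (nat_of_ord a) => i; rewrite prednK //.
  rewrite {1}(divn_eq i d) -addnS dvdn_addr ?dvdn_mull //.
  have := ltn_pmod i d0; rewrite leq_eqVlt => /orP[/eqP->|lt]; first by rewrite dvdnn eqxx.
  by rewrite gtnNdvd // ltn_eqF.
- rewrite dwreath_laby /delta_wreath lift2y ffunE mulnK //.
  congr (if _ then _ else _); rewrite -val_eqE [RHS]/=.
  by move: (nat_of_ord a) => i; rewrite prednK.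
Qed.

Variables (l : nat) (hN : (0 < d * n)%N) (hNN : (n %| d * n)%N).

(** A preimage [h] of [c] exists by [ker_inj_surj]. Whichever is chosen in [delta_g], the two sides
    are continuous functions of [h] that agree on [Ker phi_N], so the choice has no effect. *)
Lemma delta_gE (c : completion l (phi2 (d * n))) : proj c = 1 ->
  delta_g hN hNN c = wext (dwreath d Fx) ord0 c.
Proof.
move=> pc; rewrite /delta_g; case: xgetP => [h _ /= <-|/(_ _ (ker_inj_surj pc))//].
have tD := dwreath_tame d0 n0.
have ph : proj h = 1 :> Zmod 1 by apply/val_inj; case: (proj h) => -[].
move: h ph; apply: (@cont_eq _ _ _ _ _ _ _ (fun h => ker_inj (delta_prol hN hNN h))
  (fun h => wext (dwreath d Fx) ord0 (ker_inj h))).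
- apply: (@cont_comp _ _ _ _ _ _ _ _ _ _ (@ker_inj l n)).
    by apply: cont_ext; exact: ker_inj_ker.
  by apply: cont_ext => a _; apply: etrans (proj_inc _ _ _) _.
- apply: (@cont_comp _ _ _ _ _ _ _ _ _ _ (wext (dwreath d Fx) ord0)).
    exact: cont_wext.
  by apply: cont_ext; exact: ker_inj_ker.
- move=> g _; rewrite /ker_inj /delta_prol.
  rewrite (ext_inc (@ker_inj_ker l (d * n))).
  have K a : triv (kerg (phi2 (d * n))) a = 1 ->
    proj ((inc \o deltaK hN hNN) a : prol l (kerg (phi2 n))) = 1.
    by move=> _; apply: etrans (proj_inc _ _ _) _.
  rewrite (ext_inc K) (ext_inc (@ker_inj_ker l n)).
  rewrite [RHS](wext_inc tD); congr (inc _).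
  by rewrite -[ord0](zbar0 d) -(delta_wreath_lab _ 1).
Qed.

End DeltaAsCocycle.

(** * The transfer principle *)

(* If A moves the states s i cyclically and V only outputs in the state s 0, then
   reading a word in A and V from s 0 amounts to reading the word in x and y with
   dwreath, up to the coboundary of R. *)
Section Transfer.
Variables (l : nat) (S : finType) (G H G' H' : groupType).
Variables (phi : gmorph G H) (phi' : gmorph G' H') (W : gmorph G (wreath S G')).
Hypothesis tW : tame phi phi' W.
Variables (d n : nat) (d0 : (0 < d)%N) (n0 : (0 < n)%N).
Variables (A V : completion l phi) (A' V' : completion l phi') (s : Zmod d -> S).
Hypothesis pA : proj A ^+ (d * n) = 1.
Hypothesis pV : proj V = 1.
Hypothesis pA' : proj A' ^+ n = 1.
Hypothesis pV' : proj V' = 1.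
Hypothesis sA : forall i, wact W A (s i) = s (i * zbar d 1).
Hypothesis wV : forall i : Zmod d, wext W (s i) V = if i == ord0 then V' else 1.
Hypothesis wA : wext W (s 1) (A ^+ d) = A'.

(** The output of [A ^ i], with [0 <= i < d], read from [s 1]. Here [1 : Zmod d] is the neutral
    element of the multiplicatively written group [Z/dZ], that is the class of 0, also written
    [ord0]. *)
Let R (i : Zmod d) : completion l phi' := wext W (s 1) (A ^+ nat_of_ord i).

Lemma wact_orbit k : wact W (A ^+ k) (s 1) = s (zbar d k).
Proof.
elim: k => [|k IH]; first by rewrite (wact1 tW) zbar0.
by rewrite expgSr (wactM tW) IH sA -zbarD addn1.
Qed.

(** The step from [d - 1] to 0 closes the turn: [A ^ d] has output [A'], and the coboundary starts
    again at [R 1 = 1]. *)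
Lemma transfer_step (i : Zmod d) :
  R i * wext W (s i) A = (if (nat_of_ord i).+1 == d then A' else 1) * R (i * zbar d 1).
Proof.
have e : wact W (A ^+ nat_of_ord i) (s 1) = s i by rewrite wact_orbit zbar_val.
rewrite /R -e -(wextM tW) -expgSr.
rewrite Zmod_succ //; case: eqP => [->|ne]; first by rewrite wA modnn (wext1 tW) mulg1.
rewrite mul1g modn_small // ltn_neqAle; apply/andP; split; first exact/eqP.
exact: Zmod_lt.
Qed.

(** All the initial states are treated together, because in a product the second factor is read from
    the state where the first one ends. *)
Lemma transfer_word (a : F2) (i : Zmod d) :
  wact W (lift2 A V a) (s i) = s (i * phi2 d a) /\
  R i * wext W (s i) (lift2 A V a) =
    lift2 A' V' (wlab (dwreath d Fx a) i) * R (i * phi2 d a).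
Proof.
elim/F2_ind: a i => [|a b IHa IHb|a IH||] i.
- by rewrite !gmulf1 mulg1 (wact1 tW) (wext1 tW) wlab1 gmulf1 mulg1 mul1g.
- have [sa wa] := IHa i; have [sb wb] := IHb (i * phi2 d a).
  rewrite !gmulfM (wactM tW) sa sb mulgA; split=> //.
  by rewrite (wextM tW) sa mulgA wa wlabM gmulfM -[LHS]mulgA wb dwreath_wperm !mulgA.
- have [] := IH (i * (phi2 d a)^-1); rewrite mulgVK !gmulfV wlabV.
  have -> : (wperm (dwreath d Fx a))^-1 i = i * (phi2 d a)^-1 :> Zmod _.
    by apply: (@perm_inj _ (wperm (dwreath d Fx a))); rewrite permKV dwreath_wperm mulgVK.
  rewrite gmulfV; move: (i * _) (lift2 A V a) (lift2 A' V' _) => j T L sa wa; split.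
    by rewrite -{1}sa -(wactM tW) mulgV (wact1 tW).
  apply: (mulgI L); rewrite mulVKg mulgA -wa -mulgA -sa -(wextM tW) mulgV.
  by rewrite (wext1 tW) mulg1.
- rewrite dwreath_labx (phi2x d 1) !lift2x sA transfer_step; split=> //.
  by congr (_ * _); case: ifP => _; rewrite ?lift2x ?gmulf1.
- rewrite dwreath_laby phi2y !lift2y (wact_ker tW) // mulg1; split=> //.
  rewrite wV; case: ifP => [/eqP ->|_].
    by rewrite lift2y /R /= (wext1 tW) mulg1 mul1g.
  by rewrite gmulf1 mulg1 mul1g.
Qed.

(** A word of [Ker phi_d] returns to its initial state and [R 1 = 1], so the coboundary disappears;
    continuity extends this from words to [c]. *)
Lemma transfer (c : completion l (phi2 (d * n))) : proj c = 1 ->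
  wext W (s 1) (sub2 c A V) = sub2 (wext (dwreath d Fx) ord0 c : completion l (phi2 n)) A' V'.
Proof.
have N0 : (0 < d * n)%N by rewrite muln_gt0 d0.
have K := lift2_ker N0 pA pV; have K' := lift2_ker n0 pA' pV'.
have tD := dwreath_tame d0 n0.
move: c; apply: (@cont_eq _ _ _ _ _ _ _ (fun c => wext W (s 1) (sub2 c A V))
  (fun c => sub2 (wext (dwreath d Fx) ord0 c : completion l (phi2 n)) A' V')).
- apply: (@cont_comp _ _ _ _ _ _ _ _ _ _ (wext W (s 1))); first exact: cont_wext.
  exact: cont_ext.
- apply: (@cont_comp _ _ _ _ _ _ _ _ _ _ (fun c => sub2 c A' V')); first exact: cont_ext.
  exact: cont_wext.
- move=> g pg; rewrite /sub2 (ext_inc K) (wext_inc tD) (ext_inc K').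
  have [_] := transfer_word g 1; rewrite (phi2_dvd d0 n0 pg) mulg1.
  by rewrite /R /= (wext1 tW) mulg1 mul1g.
Qed.

End Transfer.

Lemma proj_ext (l : nat) (G H G' H' : groupType) (phi : gmorph G H) (phi' : gmorph G' H')
    (f : gmorph G (completion l phi')) (fK : forall a, phi a = 1 -> proj (f a) = 1)
    (c : completion l phi) : proj c = 1 -> proj (ext f c) = 1.
Proof.
move=> pc; have [g cg] := comp_ex (pull fK (level_top l phi')) c.
have pf : proj (f g) = 1 by apply: (fK); rewrite -(projE cg).
have [h fh] := comp_ex (level_top l phi') (f g).
have eh : comp (ext f c) (level_top l phi') h by rewrite (extE cg).
by rewrite (projE eh) -(projE fh).
Qed.

Lemma wlab_gexpz (S : finType) (G G' : groupType) (W : gmorph G (wreath S G')) (w : G) s z :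
  wperm (W w) s = s -> wlab (W (gexpz w z)) s = gexpz (wlab (W w) s) z.
Proof.
move=> ws; have X n : wlab (W (w ^+ n)) s = wlab (W w) s ^+ n /\ wperm (W (w ^+ n)) s = s.
  elim: n => [|n [IH IHs]]; first by rewrite gmulf1 wlab1 wperm1.
  by rewrite !expgS gmulfM wlabM wpermM ws IH IHs.
case: z => n /=; first by have [] := X n.
have [Xn Xs] := X n.+1; rewrite gmulfV wlabV -Xn; congr (wlab _ _)^-1.
by apply: (@perm_inj _ (wperm (W (w ^+ n.+1)))); rewrite permKV Xs.
Qed.

Lemma zbar_eq1 d k : (0 < k <= d)%N -> (zbar d k == 1) = (k == d).
Proof.
case/andP=> k0; have d0 : (0 < k <= d)%N -> (0 < d)%N by case/andP; apply: leq_trans.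
rewrite leq_eqVlt => /orP[/eqP ->|kd]; first by rewrite zbarN !eqxx.
rewrite (ltn_eqF kd); apply/eqP; rewrite -(zbar0 d) zbar_eqP ?d0 ?k0 ?(ltnW kd) //.
by rewrite mod0n modn_small // => k0'; rewrite k0' in k0.
Qed.

Section DwreathValues.
Variables (l d n : nat) (d0 : (0 < d)%N) (n0 : (0 < n)%N).
Notation N := (d * n)%N.
Implicit Types (c : completion l (phi2 N)) (i s : Zmod d).

(** The translation by which [c] acts on the states of [dwreath], see [wact_dwreath]. *)
Definition red c : Zmod d := zbar d (nat_of_ord (proj c)).

Lemma redM c c' : red (c * c') = red c * red c'.
Proof. by rewrite /red projM zbar_red. Qed.

Lemma red1 c : proj c = 1 -> red c = 1.
Proof. by rewrite /red => ->; rewrite /= zbar0. Qed.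

Lemma redV c : red c^-1 = (red c)^-1.
Proof. by apply: (mulgI (red c)); rewrite -redM !mulgV red1 // proj1g. Qed.

Lemma redX c k : red (c ^+ k) = red c ^+ k.
Proof.
by elim: k => [|k IH]; [rewrite red1 ?proj1g | rewrite !expgS redM IH].
Qed.

Lemma wact_dwreath u c i : tame (phi2 N) (phi2 n) (dwreath d u) ->
  wact (dwreath d u) c i = i * red c.
Proof.
move=> tD; have [g cg] := comp_ex (level_top l (phi2 N)) c.
by rewrite (wactE tD cg) dwreath_wperm /red (projE cg) phi2_red.
Qed.

Lemma red_zpow (w : F2) (a : zl l N) : phi2 N w ^+ N = 1 ->
  red (zpow w a) = gexpz (phi2 d w) (a 0%N).
Proof.
move=> wN; rewrite /red proj_zpow //.
have -> : gexpz (phi2 N w) (a 0%N) = phi2 N (gexpz w (a 0%N)).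
  by case: (a 0%N) => k /=; rewrite ?gmulfV gmulfXn.
by rewrite phi2_red //; case: (a 0%N) => k /=; rewrite ?gmulfV gmulfXn.
Qed.

Lemma Zmod_exp m (u : Zmod m) : u ^+ m = 1.
Proof. by rewrite -[u]zbar_val -zbar1X -expgM mulnC expgM zbar1X zbarN expg1n. Qed.

Lemma wext_zpow_y u (tD : tame (phi2 N) (phi2 n) (dwreath d u)) (a : zl l 1) i :
  wext (dwreath d u) i (zpow Fy a : completion l (phi2 N)) =
  (if i == ord0 then zpow Fy a else 1) :> completion l (phi2 n).
Proof.
have yi : wperm (dwreath d u Fy) i = i by rewrite dwreath_wperm phi2y mulg1.
rewrite -[zpow Fy a]expg1.
rewrite (wext_zpow tD (dvdnn 1) a (w' := wlab (dwreath d u Fy) i)) ?phi2y //.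
- by rewrite zl_red_id dwreath_laby; case: ifP => // _; rewrite zpow_base1.
- by rewrite dwreath_laby; case: ifP; rewrite ?phi2y ?gmulf1.
- by move=> z; rewrite mul1r wlab_gexpz.
Qed.

Lemma wlab_Fx_exp k : (k <= d)%N ->
  wlab (dwreath d Fx (Fx ^+ k)) ord0 = if k == d then Fx else 1.
Proof.
elim: k => [|k IH] kd; first by rewrite gmulf1 wlab1 ltn_eqF.
have e : wperm (dwreath d Fx (Fx ^+ k)) ord0 = zbar d k.
  by rewrite (dwreath_wperm _ _ (1 : Zmod d)) phi2x; apply: mul1g.
rewrite expgSr gmulfM wlabM (IH (ltnW kd)) (ltn_eqF kd) e dwreath_labx.
by rewrite /= prednK // modn_small //; apply: mul1g.
Qed.

(** The word [x^-1 y^-1] runs through the states backwards. The first step leaves 0 for [d - 1] and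
    outputs [x^-1]; the letter [y^-1] is output on the return to 0, at the [d]-th step. *)
Lemma wlab_z_exp k : (k <= d)%N -> wlab (dwreath d Fx ((Fx^-1 * Fy^-1) ^+ k)) ord0 =
  (if k == 0%N then 1 else Fx^-1) * (if k == d then Fy^-1 else 1).
Proof.
elim: k => [|k IH] kd; first by rewrite gmulf1 wlab1 (ltn_eqF d0) mul1g.
have e : wperm (dwreath d Fx ((Fx^-1 * Fy^-1) ^+ k)) ord0 = (zbar d k)^-1 :> Zmod d.
  rewrite (dwreath_wperm _ _ (1 : Zmod d)) gmulfXn gmulfM !gmulfV phi2y invg1.
  by rewrite mulg1 (phi2x d 1) expVgn zbar1X; apply: mul1g.
have pV g (i : Zmod d) : (wperm (dwreath d Fx g))^-1 i = i * (phi2 d g)^-1 :> Zmod d.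
  by apply: (@perm_inj _ (wperm (dwreath d Fx g))); rewrite permKV dwreath_wperm mulgVK.
rewrite expgSr gmulfM wlabM (IH (ltnW kd)) (ltn_eqF kd) mulg1 e.
rewrite gmulfM wlabM !gmulfV wlabV wpermV wlabV !pV phi2y invg1 mulg1.
rewrite (phi2x d 1) dwreath_labx dwreath_laby.
have -> : (zbar d k)^-1 * (zbar d 1)^-1 = (zbar d k.+1)^-1.
  by rewrite -[k.+1]add1n zbarD invgM.
have E (u : Zmod d) : ((nat_of_ord u).+1 == d) = (u * zbar d 1 == 1).
  by rewrite -{2}(zbar_val u) -zbarD addn1 zbar_eq1 // Zmod_lt.
rewrite [X in if X then Fx else _]E [X in if X then Fy else _](_ : _ = (k.+1 == d)).
  have -> : ((zbar d k.+1)^-1 * zbar d 1 == 1) = (k == 0%N).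
    rewrite -[k.+1]addn1 zbarD invgM.
    case: k kd {IH e} => [|k] kd; first by rewrite zbar0 invg1 mulg1 mulVg !eqxx.
    have C (y z : Zmod d) : y * z = z * y by apply: Zp_mulgC.
    rewrite C mulVKg invg_eq1 zbar_eq1 ?(ltnW kd) //.
    by rewrite (ltn_eqF kd).
  by case: (k == 0%N); case: (k.+1 == d); rewrite ?invg1 ?mul1g ?mulg1.
by rewrite -(zbar_eq1 (d := d)) // -[RHS]invg_eq1.
Qed.

End DwreathValues.

(** * Multiplicativity *)

Lemma conjVXg (G : groupType) (g x : G) k : (g * x * g^-1) ^+ k = g * x ^+ k * g^-1.
Proof.
have C y : g * y * g^-1 = y ^ g^-1 by rewrite conjgE invgK mulgA.
by rewrite !C conjXg.
Qed.

Section Multiplicativity.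
Variables (l d n : nat) (d0 : (0 < d)%N) (n0 : (0 < n)%N).
Notation N := (d * n)%N.

Let N0 : (0 < N)%N. Proof. by rewrite muln_gt0 d0. Qed.

Lemma phi2_Nexp m (w : F2) : phi2 m w ^+ m = 1.
Proof. exact: Zmod_exp. Qed.

Lemma proj_zpow_y m (a : zl l 1) : proj (zpow Fy a : completion l (phi2 m)) = 1.
Proof. by rewrite proj_zpow phi2y ?gexpz1. Qed.

Lemma proj_sub2 m (G' H' : groupType) (phi' : gmorph G' H') (m0 : (0 < m)%N)
    (c : completion l (phi2 m)) (u v : completion l phi') :
  proj c = 1 -> proj u ^+ m = 1 -> proj v = 1 -> proj (sub2 c u v) = 1.
Proof. by move=> pc pu pv; apply: proj_ext => //; apply: lift2_ker. Qed.

Lemma wext_zpow_x (mu : zl l N) (dm : n %| N) :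
  wext (dwreath d Fx) ord0 (zpow Fx mu ^+ d : completion l (phi2 N)) =
  zpow Fx (zl_red dm mu) :> completion l (phi2 n).
Proof.
apply: wext_zpow; rewrite ?phi2_Nexp //; first exact: dwreath_tame.
move=> z; rewrite gexpzMn wlab_gexpz ?wlab_Fx_exp ?eqxx //.
by rewrite (dwreath_wperm _ _ (1 : Zmod d)) phi2x zbarN; apply: mul1g.
Qed.

Lemma wext_zpow_z (mu : zl l N) (dm : n %| N) :
  wext (dwreath d Fx) ord0 (zpow (Fx^-1 * Fy^-1) mu ^+ d : completion l (phi2 N)) =
  zpow (Fx^-1 * Fy^-1) (zl_red dm mu) :> completion l (phi2 n).
Proof.
apply: wext_zpow; rewrite ?phi2_Nexp //; first exact: dwreath_tame.
move=> z; rewrite gexpzMn wlab_gexpz ?wlab_z_exp ?eqxx //.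
  by rewrite (gtn_eqF d0).
by rewrite (dwreath_wperm _ _ (1 : Zmod d)) gmulfXn Zmod_exp; apply: mul1g.
Qed.

(** Multiplying [i mu = 0] by the inverse [u] gives [i = 0] modulo [d]: an element acting by the
    translation [mu] meets the state 0 once per turn. *)
Lemma red_unit (mu : zl l N) (i : Zmod d) : mod_unit d mu ->
  (gexpz (zbar d 1) (mu 0%N) ^+ (nat_of_ord i) == 1) = (i == ord0).
Proof.
case=> u mu1; apply/eqP/eqP => [|->]; last by rewrite expg0.
rewrite gexpzX gexpz_zbar1 // => di; apply/val_inj => /=.
have {}di : (d %| (Posz (nat_of_ord i) * (mu 0%N * u))%R)%Z by rewrite mulrA dvdz_mulr.
have {di} : (d %| Posz (nat_of_ord i))%Z.
  apply/dvdz_mod0P; rewrite -[X in (X %% _)%Z](mulr1 (Posz (nat_of_ord i))).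
  by rewrite -modzMmr -mu1 modzMmr; apply/dvdz_mod0P.
rewrite dvdzE /=; have := Zmod_lt i d0; move: (nat_of_ord i) => [//|k] kd.
by rewrite gtnNdvd.
Qed.

Variables (g1 g2 : completion l (phi2 N)) (mu : zl l N) (lam : zl l 1).
Hypotheses (pg1 : proj g1 = 1) (pg2 : proj g2 = 1).
Hypothesis mu_unit : mod_unit d mu.

Lemma delta_g_mul (hN : (0 < N)%N) (hNN : n %| N) :
  delta_g hN hNN (sub2 g1 (g2 * zpow Fx mu * g2^-1) (zpow Fy lam) * g2) =
  sub2 (delta_g hN hNN g1)
    (delta_g hN hNN g2 * zpow Fx (zl_red hNN mu) * (delta_g hN hNN g2)^-1)
    (zpow Fy lam) * delta_g hN hNN g2.
Proof.
set A := g2 * _ * _; set V := zpow Fy lam.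
have tD := dwreath_tame d0 n0.
have rA : red A = gexpz (zbar d 1) (mu 0%N).
  rewrite !redM // redV // red1 // invg1 mulg1 red_zpow ?phi2_Nexp //.
  by rewrite (phi2x d 1); apply: mul1g.
have pS : proj (sub2 g1 A V) = 1.
  by apply: proj_sub2; rewrite ?Zmod_exp ?proj_zpow_y.
rewrite !delta_gE ?projM ?pS ?pg1 ?pg2 ?mulg1 // (wextM tD) (wact_ker tD) //.
congr (_ * _).
(* [g2] acts trivially on the states, so [A] translates them by the class of [mu]; [s] enumerates
   its orbit from 0. *)
pose s (i : Zmod d) : Zmod d := red A ^+ nat_of_ord i.
apply: (transfer tD d0 n0 (s := s)) => //; rewrite ?Zmod_exp ?proj_zpow_y //.
- move=> i; rewrite (wact_dwreath d0 n0 _ _ tD) /s -expgSr Zmod_succ //.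
  by rewrite {1}(divn_eq (nat_of_ord i).+1 d) expgnDr mulnC expgM Zmod_exp expg1n mul1g.
- by move=> i; rewrite wext_zpow_y // /s rA red_unit.
(* [A ^ d] fixes the state 0, and its value there is that of the [d]-th power of [x ^ mu],
   conjugated by the value of [g2]. *)
- have XA : A ^+ d = g2 * zpow Fx mu ^+ d * g2^-1.
    exact: conjVXg.
  have [s2 sx] : wact (dwreath d Fx) g2 ord0 = ord0 /\
      wact (dwreath d Fx) (zpow Fx mu ^+ d : completion l (phi2 N)) ord0 = ord0.
    split; first by rewrite (wact_ker tD).
    rewrite (wact_dwreath d0 n0 _ _ tD) redX // Zmod_exp; exact: mulg1.
  by rewrite XA (wext_conj tD) // wext_zpow_x.
Qed.

End Multiplicativity.

(** * The hexagon equation *)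

Section WextPower.
Variables (l : nat) (S : finType) (G H G' H' : groupType).
Variables (phi : gmorph G H) (phi' : gmorph G' H') (W : gmorph G (wreath S G')).
Hypothesis tW : tame phi phi' W.
Variables (s : S) (w y : completion l phi).
Hypothesis py : proj y = 1.

Lemma wact_mulX m : wact W ((w * y) ^+ m) s = wact W (w ^+ m) s.
Proof. by apply: (wact_proj tW); rewrite !projX projM py mulg1. Qed.

(** [y] does not move the states, so the [j]-th factor [y] is read in the state reached by [w ^ j];
    if it outputs nothing there, it can be erased. *)
Lemma wext_mulX m :
  (forall j, (0 < j <= m)%N -> wext W (wact W (w ^+ j) s) y = 1 :> completion l phi') ->
  wext W s ((w * y) ^+ m) = wext W s (w ^+ m) :> completion l phi'.
Proof.
elim: m => [//|m IH] wy.
have wym : wext W (wact W w (wact W (w ^+ m) s)) y = 1 :> completion l phi'.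
  by rewrite -(wactM tW) -expgSr wy ?ltnS ?leqnn.
rewrite !expgSr !(wextM tW) IH => [|j /andP[j0 jm]]; last first.
  by apply: wy; rewrite j0 (leq_trans jm).
by rewrite wact_mulX wym mulg1.
Qed.

(** As in [wext_mulX], but the last factor [y] is kept: it is the one read when a cyclic orbit
    closes. *)
Lemma wext_mulX_last m : (0 < m)%N ->
  (forall j, (0 < j < m)%N -> wext W (wact W (w ^+ j) s) y = 1 :> completion l phi') ->
  wext W s ((w * y) ^+ m) = wext W s (w ^+ m) * wext W (wact W (w ^+ m) s) y :> completion l phi'.
Proof.
case: m => [//|m] _ wy; rewrite !expgSr !(wextM tW) wext_mulX; last first.
  by move=> j /andP[j0 jm]; apply: wy; rewrite j0.
by rewrite wact_mulX (wactM tW) mulgA.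
Qed.

End WextPower.

(** The hexagon solved for the conjugate of [Z]. With [lambda = nu + nu + 1], the inverse of
    [y ^ (nu + 1)] is split as [y ^ -lambda] times [y ^ nu], which makes the other side a conjugate
    too. *)
Lemma hexagon_conj l m (g gz X Z : completion l (phi2 m)) (nu : zl l 1) :
  g^-1 * zpow Fy nu * gz * Z * gz^-1 * zpow Fy (nu + 1)%R * g * X = 1 <->
  gz * Z * gz^-1 =
    (zpow Fy nu)^-1 * ((g * X * g^-1)^-1 * zpow Fy (- (nu + nu + 1))%R) * zpow Fy nu.
Proof.
have y1 : phi2 m Fy ^+ 1 = 1 by rewrite phi2y.
have e : zpow Fy (- (nu + nu + 1))%R * zpow Fy nu =
    (zpow Fy (nu + 1)%R)^-1 :> completion l (phi2 m).
  rewrite -zpowN // -zpowD //; congr zpow.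
  by rewrite -addrA opprD addrAC addNr add0r.
have -> : (zpow Fy nu)^-1 * ((g * X * g^-1)^-1 * zpow Fy (- (nu + nu + 1))%R) * zpow Fy nu =
    (zpow Fy nu)^-1 * (g * X * g^-1)^-1 * (zpow Fy (nu + 1)%R)^-1.
  by rewrite -e !mulgA.
have -> : g^-1 * zpow Fy nu * gz * Z * gz^-1 = g^-1 * zpow Fy nu * (gz * Z * gz^-1).
  by rewrite !mulgA.
move: (zpow Fy nu) (zpow Fy (nu + 1)%R) (gz * Z * gz^-1) => a b c; split=> [h|->].
  apply: (mulgI (g^-1 * a)); apply: (mulIg (b * g * X)).
  by rewrite !mulgA in h *; rewrite h !invgM invgK !mulgA mulgK !mulgKV mulVg.
by rewrite !invgM invgK !mulgA mulgK !mulgKV mulVg.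
Qed.

Section Hexagon.
Variables (l d n : nat) (d0 : (0 < d)%N) (n0 : (0 < n)%N).
Notation N := (d * n)%N.
Notation z := (Fx^-1 * Fy^-1).
Variables (g : completion l (phi2 N)) (mu : zl l N) (nu : zl l 1).
Hypothesis pg : proj g = 1.
Hypothesis hexg : g_hexagon nu mu g.

Let N0 : (0 < N)%N. Proof. by rewrite muln_gt0 d0. Qed.

Lemma at2_xy m (m0 : (0 < m)%N) (c : completion l (phi2 m)) : proj c = 1 ->
  at2 c Fx Fy = c :> completion l (phi2 m).
Proof.
have K := lift2_ker (l := l) m0 (u := inc Fx) (v := inc Fy) (phi' := phi2 m).
have {}K : forall a, phi2 m a = 1 -> proj (lift2 (inc Fx) (inc Fy) a : completion l (phi2 m)) = 1.
  by apply: K; rewrite proj_inc ?Zmod_exp ?phi2y.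
move: c; apply: (@cont_eq _ _ _ _ _ _ _ (fun c => at2 c Fx Fy) id).
- exact: cont_ext.
- exact: cont_id.
move=> a _; rewrite /at2 /sub2 (ext_inc K); elim/F2_ind: a => [|a b IHa IHb|a IH||].
- by rewrite !gmulf1.
- by rewrite gmulfM IHa IHb -gmulfM.
- by rewrite gmulfV IH -gmulfV.
- by rewrite lift2x.
- by rewrite lift2y.
Qed.

Let gz : completion l (phi2 N) := at2 g z Fy.
Let X : completion l (phi2 N) := zpow Fx mu.
Let Z : completion l (phi2 N) := zpow z mu.
Let A := g * X * g^-1.
Let B := gz * Z * gz^-1.
Let t : Zmod d := gexpz (zbar d 1) (mu 0%N).
(** This is minus lambda, the exponent of [y] in [hexB]. *)
Let lam := (- (nu + nu + 1))%R : zl l 1.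
Let Yl : completion l (phi2 N) := zpow Fy lam.
Let Yn : completion l (phi2 N) := zpow Fy nu.

Let y1 m : phi2 m Fy ^+ 1 = 1. Proof. by rewrite phi2y. Qed.

Let hexB : B = Yn^-1 * (A^-1 * Yl) * Yn.
Proof. by apply/hexagon_conj; move: hexg; rewrite /g_hexagon at2_xy. Qed.

Let pgz : proj gz = 1.
Proof. by apply: proj_sub2 => //; rewrite proj_inc ?Zmod_exp ?phi2y. Qed.

Let redX' : red X = t.
Proof. by rewrite red_zpow ?phi2_Nexp // (phi2x d 1). Qed.

Let redZ : red Z = t^-1.
Proof.
rewrite red_zpow ?phi2_Nexp // gmulfM !gmulfV phi2y invg1 mulg1 (phi2x d 1) /t.
by case: (mu 0%N) => k /=; rewrite expVgn ?invgK.
Qed.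

Let redAV : red A^-1 = t^-1.
Proof.
by rewrite redV // !redM // redX' redV // red1 // invg1 mulg1 mul1g.
Qed.

Lemma wlab1_Fx b i : wlab (dwreath d 1 (gexpz Fx b)) i = 1.
Proof.
have E k j : wlab (dwreath d 1 (Fx ^+ k)) j = 1.
  elim: k j => [|k IH] j; first by rewrite gmulf1 wlab1.
  by rewrite expgS gmulfM wlabM IH dwreath_labx if_same mulg1.
by case: b => k /=; rewrite ?gmulfV ?wlabV E ?invg1.
Qed.

(** Here [mu] is not invertible modulo [d], so the orbit of 0 under the translation [t] misses a
    state [a]. The cocycle with [u = 1] sees only the letters [y]. On [B ^ m], with [m] the order of
    [t], it is trivial from [a], while from 0 it is a conjugate of [y ^ -lambda]. But [B] is
    conjugate to [Z], which commutes with the powers of [z], so triviality at [a] passes to 0. *)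
Lemma zpow_y_trivial j : (0 < j < d)%N -> t ^+ j = 1 ->
  zpow Fy lam = 1 :> completion l (phi2 n).
Proof.
move=> jd tj; have tW := dwreath1_tame d0 n0.
(* [m] is the order of [t]; by minimality the orbit of 0 does not return to 0 before the [m]-th
   step. *)
have [m /andP[m0 /eqP tm] mmin] : exists2 m, (0 < m)%N && (t ^+ m == 1) &
    forall k, (0 < k)%N && (t ^+ k == 1) -> (m <= k)%N.
  have ex : exists m, (0 < m)%N && (t ^+ m == 1).
    by exists j; rewrite tj eqxx andbT; case/andP: jd.
  by exists (ex_minn ex); case: ex_minnP.
have md : (m < d)%N.
  by case/andP: jd => j0 jd; apply: leq_ltn_trans jd; apply: mmin; rewrite j0 tj eqxx.
(* The orbit of 0 has at most [m < d] elements; from a state outside it, 0 is never reached. *)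
have [a at1] : exists a : Zmod d, forall k, a * t^-1 ^+ k != 1.
  pose f (i : 'I_m) : 'I_d.-1.+1 := t ^+ nat_of_ord i.
  have /subsetPn[a _ aI] : ~~ ('I_d.-1.+1 \subset codom f).
    have fm : (#|codom f| < d)%N.
      by apply: leq_ltn_trans (card_size _) _; rewrite size_codom card_ord.
    apply/negP => /subset_leq_card; rewrite card_ord; move: #|codom f| fm => k.
    by move=> kd; rewrite prednK // leqNgt kd.
  exists (a : Zmod d) => k; apply/negP => /eqP ak; move/negP: aI; apply.
  have -> : a = t ^+ k :> Zmod d by rewrite -[LHS](mulgK (t^-1 ^+ k)) ak expVgn invgK mul1g.
  rewrite (divn_eq k m) expgnDr mulnC expgM tm expg1n mul1g.
  by apply/codomP; exists (Ordinal (ltn_pmod k m0)).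
have actA k i : wact (dwreath d 1) (A^-1 ^+ k) i = i * t^-1 ^+ k :> Zmod d.
  by rewrite (wact_dwreath d0 n0 _ _ tW) redX // redAV.
have tVm : t^-1 ^+ m = 1 by rewrite expVgn tm invg1.
(* [A] is conjugate to a power of [x], and the letters [x] output nothing when [u = 1]. *)
have wA i : wext (dwreath d 1) i (A^-1 ^+ m) = 1 :> completion l (phi2 n).
  have -> : A^-1 = g * X^-1 * g^-1 by rewrite /A !invgM invgK mulgA.
  have XV : X^-1 = zpow Fx (- mu)%R by rewrite zpowN // phi2_Nexp.
  have Xi : wact (dwreath d 1) (X^-1 ^+ m) i = i.
    by rewrite (wact_dwreath d0 n0 _ _ tW) redX // redV // redX' tVm; apply: mulg1.
  rewrite conjVXg (wext_conj tW (wact_ker tW i pg) Xi) XV.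
  rewrite (wext_zpow tW (dvdnn N) _ (w' := 1)) ?phi2_Nexp //.
  - by rewrite zpow_base1 mulg1 mulgV.
  - by rewrite gmulf1 expg1n.
  - by move=> b; rewrite gexpz1 wlab1_Fx.
have Zi i : wact (dwreath d 1) (Z ^+ m) i = i.
  by rewrite (wact_dwreath d0 n0 _ _ tW) redX // redZ tVm; apply: mulg1.
have wB i : wext (dwreath d 1) i (Z ^+ m) = 1 :> completion l (phi2 n) <->
   wext (dwreath d 1) i (B ^+ m) = 1 :> completion l (phi2 n).
  rewrite conjVXg (wext_conj tW (wact_ker tW i pgz) (Zi i)).
  split=> [->|e]; first by rewrite mulg1 mulgV.
  by apply: (mulgI (wext (dwreath d 1) i gz)); apply: (mulIg (wext (dwreath d 1) i gz)^-1);
     rewrite e mulg1 mulgV.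
have pYl : proj Yl = 1 by apply: proj_zpow_y.
have pYn : proj Yn = 1 by apply: proj_zpow_y.
have BE : B ^+ m = Yn^-1 * (A^-1 * Yl) ^+ m * Yn.
  by rewrite hexB -{2}[Yn]invgK conjVXg invgK.
have pYnV : proj Yn^-1 = 1 by rewrite projV pYn invg1.
have BW i : wext (dwreath d 1) i (B ^+ m) = wext (dwreath d 1) i Yn^-1 *
    wext (dwreath d 1) i ((A^-1 * Yl) ^+ m) * wext (dwreath d 1) i Yn :> completion l (phi2 n).
  rewrite BE !(wextM tW) (wactM tW) !(wact_ker tW _ pYnV) (wact_mulX tW) //.
  by rewrite actA tVm; congr (_ * _ * wext _ _ _); apply: mulg1.
have wa : wext (dwreath d 1) a (Z ^+ m) = 1 :> completion l (phi2 n).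
  have a0 : (a == ord0) = false by have := at1 0%N; rewrite mulg1 => /negbTE.
  apply/wB; rewrite BW wext_mulX // => [|k _]; last first.
    by rewrite actA wext_zpow_y // (negbTE (at1 k)).
  rewrite wA mulg1 (wextV tW) ?(wact_ker tW) // wext_zpow_y // a0.
  by rewrite invg1 mulg1.
(* [z ^ a] leads from [a] to 0 and commutes with [Z ^ m], so the triviality of [Z ^ m] at [a]
   implies its triviality at 0. *)
have : wext (dwreath d 1) ord0 (Z ^+ m) = 1 :> completion l (phi2 n).
  pose za : completion l (phi2 N) := inc (z ^+ nat_of_ord a).
  have zC : commute za (Z ^+ m).
    apply: commuteX; apply/esym.
    exact: (zpow_gexpzC (phi2_Nexp N z) mu (Posz (nat_of_ord a))).
  have za0 : wact (dwreath d 1) za a = ord0.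
    rewrite (wact_inc tW) dwreath_wperm gmulfXn gmulfM !gmulfV phi2y invg1 mulg1.
    by rewrite (phi2x d 1) expVgn zbar1X zbar_val mulgV.
  have := congr1 (wext (dwreath d 1) a : _ -> completion l (phi2 n)) zC.
  rewrite !(wextM tW) za0 Zi wa mul1g -[RHS]mulg1; exact: mulgI.
(* From 0, only the last of the [m] factors [Yl] is output. *)
move/wB; rewrite BW wext_mulX_last // => [|k /andP[k0 km]]; last first.
  rewrite actA wext_zpow_y //; case: eqP => // /eqP.
  rewrite mul1g expVgn invg_eq1 => tk.
  by have := mmin k; rewrite k0 tk leqNgt km => /(_ isT).
rewrite wA mul1g actA tVm (wextV tW) ?(wact_ker tW) // !wext_zpow_y //.
rewrite mulg1 /= => e.
by apply: (mulgI (zpow Fy nu)^-1); apply: (mulIg (zpow Fy nu)); rewrite e mulg1 mulVg.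
Qed.

Lemma hexagon_delta (hN : (0 < N)%N) (hNN : n %| N) :
  g_hexagon nu (zl_red hNN mu) (delta_g hN hNN g).
Proof.
have tW := dwreath_tame d0 n0.
have pz m : phi2 m z = (zbar m 1)^-1.
  by rewrite gmulfM !gmulfV phi2y invg1 mulg1 (phi2x m 1).
rewrite delta_gE //; set g' : completion l (phi2 n) := wext _ _ g.
have pg' : proj g' = 1 by apply: wext_proj.
have Egz : wext (dwreath d Fx) ord0 gz = at2 g' z Fy :> completion l (phi2 n).
  transitivity (wext (dwreath d Fx) ((1 : Zmod d)^-1) gz : completion l (phi2 n)).
    by rewrite invg1.
  (* [z] moves the states backwards, hence the enumeration by inverses. *)
  apply: (transfer tW d0 n0 (s := fun i : Zmod d => i^-1 : 'I_d.-1.+1));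
    rewrite ?proj_inc ?Zmod_exp ?phi2y //.
  - move=> i; rewrite (wact_inc tW) dwreath_wperm pz.
    have C (u v : Zmod d) : u * v = v * u by apply: Zp_mulgC.
    by rewrite C invgM.
  - move=> i; rewrite (wext_inc tW) dwreath_laby.
    by rewrite -[_ == _]/(i^-1 == 1) invg_eq1; case: ifP => _; rewrite ?gmulf1.
  - rewrite -gmulfXn (wext_inc tW) invg1.
    by rewrite wlab_z_exp // eqxx (gtn_eqF d0).
(* An intermediate factor [Yl] is either read away from 0, or read at 0 with [t ^ j = 1] and
   [0 < j < d], and then [zpow_y_trivial] kills it. *)
have wY j : (0 < j < d)%N -> wext (dwreath d Fx) (wact (dwreath d Fx) (A^-1 ^+ j) ord0) Yl = 1
    :> completion l (phi2 n).
  move=> jd; rewrite (wact_dwreath d0 n0 _ _ tW) redX // redAV wext_zpow_y //.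
  case: eqP => // /eqP; rewrite mul1g expVgn invg_eq1 => /eqP tj.
  exact: zpow_y_trivial jd tj.
have act1 (c : completion l (phi2 N)) : wact (dwreath d Fx) (c ^+ d) ord0 = ord0.
  by rewrite (wact_dwreath d0 n0 _ _ tW) redX // Zmod_exp; apply: mulg1.
have pYn : proj Yn = 1 by apply: proj_zpow_y.
have pYnV : proj Yn^-1 = 1 by rewrite projV pYn invg1.
(* The [d]-th powers of both sides of [hexB] fix the state 0, and their values there form the same
   relation for [g']. *)
have := congr1 (fun c => wext (dwreath d Fx) ord0 (c ^+ d) : completion l (phi2 n)) hexB.
rewrite conjVXg (wext_conj tW (wact_ker tW ord0 pgz) (act1 Z)) Egz wext_zpow_z //.
rewrite -{2}[Yn]invgK conjVXg invgK !(wextM tW) (wactM tW) (wact_ker tW _ pYnV).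
rewrite act1 (wextV tW) ?(wact_ker tW) // !wext_zpow_y // eqxx wext_mulX_last //;
  last by apply: proj_zpow_y.
rewrite act1 wext_zpow_y // eqxx expVgn (wextV tW) // conjVXg.
rewrite (wext_conj tW (wact_ker tW ord0 pg) (act1 X)) wext_zpow_x // -/g'.
by rewrite /g_hexagon at2_xy // => /hexagon_conj.
Qed.

End Hexagon.

(** * Braids fixing the strand 0 *)

Lemma pres_gen_rel (T : choiceType) (R : word T -> word T -> Prop) (r s : word T) :
  R r s -> word_eval (pres_gen R) r = word_eval (pres_gen R) s.
Proof.
move=> rs.
have E (u : word T) : word_eval (pres_gen R) u = (\pi_(pres R) u)%qT :> pres R.
  elim: u => [|[t b] u IH]; first by rewrite /word_eval big_nil.
  rewrite /word_eval big_cons -/(word_eval _ u) IH.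
  have -> : letter_eval (pres_gen R) (t, b) = (\pi_(pres R) [:: (t, b)])%qT :> pres R.
    case: b => //; rewrite /letter_eval /=; apply: (mulgI (pres_gen R t)); rewrite mulgV.
    apply/pres_piP/pres_sym; apply: pres_trans (pres_cat (pres_repr _ _) (pres_repr _ _)) _.
    exact: (pres_cancel _ [::] [::] t false).
  by apply/pres_piP; exact: (pres_cat (pres_repr _ [:: (t, b)]) (pres_repr _ u)).
rewrite !E; apply/pres_piP.
by have := pres_rel [::] [::] rs; rewrite /= !cats0.
Qed.

Section BraidIdentities.
Variables (G : groupType) (p q : G).
Hypothesis pq : p * q * p = q * p * q.

(** The braid relation with signs. The conditions exclude the patterns [+ - +] and [- + -]; they
    hold when the signs are the comparisons, in a total order, of three elements taken in the pairs
    12, 13, 23. *)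
Lemma braid_sign (a b c : bool) : (a -> c -> b) -> (b -> a || c) ->
  (if a then p else p^-1) * (if b then q else q^-1) * (if c then p else p^-1) =
  (if c then q else q^-1) * (if b then p else p^-1) * (if a then q else q^-1).
Proof.
have pqV : p^-1 * q^-1 * p^-1 = q^-1 * p^-1 * q^-1.
  by have := congr1 inv pq; rewrite !invgM !mulgA.
have e1 : p * q * p^-1 = q^-1 * p * q.
  by apply: (mulgI q); apply: (mulIg p); rewrite !mulgA mulgKV mulgV mul1g pq.
have e2 : p^-1 * q * p = q * p * q^-1.
  by apply: (mulgI p); apply: (mulIg q); rewrite !mulgA mulgKV mulgV mul1g pq.
have e3 : p * q^-1 * p^-1 = q^-1 * p^-1 * q.
  by have := congr1 inv e1; rewrite !invgM !invgK !mulgA.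
have e4 : p^-1 * q^-1 * p = q * p^-1 * q^-1.
  by have := congr1 inv e2; rewrite !invgM !invgK !mulgA.
by case: a; case: b; case: c => /= h1 h2; first [done | by have := h1 isT isT | by have := h2 isT].
Qed.

End BraidIdentities.

(* The Artin group of type B_3: the letter 0 stands for the square of sigma 0,
   and the letters 1 and 2 for sigma 1 and sigma 2; it is the group of the braids
   on 4 strands which fix the strand 0. *)
Inductive brel : word 'I_3 -> word 'I_3 -> Prop :=
| brel4 (i j : 'I_3) : i = 0%N :> nat -> j = 1%N :> nat ->
    brel [:: (i, false); (j, false); (i, false); (j, false)]
         [:: (j, false); (i, false); (j, false); (i, false)]
| brel3 (i j : 'I_3) : i = 1%N :> nat -> j = 2%N :> nat ->
    brel [:: (i, false); (j, false); (i, false)] [:: (j, false); (i, false); (j, false)]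
| brel2 (i j : 'I_3) : i = 0%N :> nat -> j = 2%N :> nat ->
    brel [:: (i, false); (j, false)] [:: (j, false); (i, false)].

Definition BB : groupType := pres brel.
Definition bgen (k : nat) : BB := pres_gen brel (inord k).
Local Notation bt := (bgen 0).
Local Notation b1 := (bgen 1).
Local Notation b2 := (bgen 2).

Lemma word_evalE (T : choiceType) (G : groupType) (f : T -> G) (u : word T) :
  word_eval f u = foldr (fun a g => letter_eval f a * g) 1 u.
Proof. by rewrite /word_eval unlock. Qed.

Lemma BB_rel4 : bt * b1 * bt * b1 = b1 * bt * b1 * bt.
Proof.
have := pres_gen_rel (@brel4 (inord 0) (inord 1) _ _).
by rewrite !inordK // !word_evalE /= !mulg1 !mulgA; apply.
Qed.

Lemma BB_rel3 : b1 * b2 * b1 = b2 * b1 * b2.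
Proof.
have := pres_gen_rel (@brel3 (inord 1) (inord 2) _ _).
by rewrite !inordK // !word_evalE /= !mulg1 !mulgA; apply.
Qed.

Lemma BB_rel2 : bt * b2 = b2 * bt.
Proof.
have := pres_gen_rel (@brel2 (inord 0) (inord 2) _ _).
by rewrite !inordK // !word_evalE /= !mulg1; apply.
Qed.

Lemma B4_rel01 : sigma 0 * sigma 1 * sigma 0 = sigma 1 * sigma 0 * sigma 1.
Proof.
have := pres_gen_rel (@braid_rel3 (inord 0) (inord 1) _).
by rewrite !inordK // !word_evalE /= !mulg1 !mulgA; apply.
Qed.

Lemma B4_rel12 : sigma 1 * sigma 2 * sigma 1 = sigma 2 * sigma 1 * sigma 2.
Proof.
have := pres_gen_rel (@braid_rel3 (inord 1) (inord 2) _).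
by rewrite !inordK // !word_evalE /= !mulg1 !mulgA; apply.
Qed.

Lemma B4_rel02 : sigma 0 * sigma 2 = sigma 2 * sigma 0.
Proof.
have := pres_gen_rel (@braid_rel2 (inord 0) (inord 2) _).
by rewrite !inordK // !word_evalE /= !mulg1; apply.
Qed.

Definition iota_gen (i : 'I_3) : B4 := if i == 0%N :> nat then sigma 0 ^+ 2 else sigma i.

Lemma iota_rel r s : brel r s -> word_eval iota_gen r = word_eval iota_gen s.
Proof.
have e01 := B4_rel01.
case=> i j ei ej; rewrite !word_evalE /= !mulg1 /letter_eval /iota_gen /= ei ej /= ?mulgA.
- rewrite !expgS expg0 !mulg1.
  set p := sigma 0 in e01 *; set q := sigma 1 in e01 *.
  have -> : p * p * q * p * p * q = p * (p * q * p) * p * q by rewrite !mulgA.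
  have -> : q * p * p * q * p * p = q * p * (p * q * p) * p by rewrite !mulgA.
  rewrite e01 !mulgA e01 -!mulgA; congr (_ * (_ * (_ * _))).
  by rewrite !mulgA e01.
- exact: B4_rel12.
- by rewrite !expgS expg0 !mulg1 -[LHS]mulgA B4_rel02 [LHS]mulgA B4_rel02.
Qed.

Definition iotaB : gmorph BB B4 := pres_lift iota_rel.

Lemma iotaB_gen k : (k < 3)%N -> iotaB (bgen k) = if k == 0%N then sigma 0 ^+ 2 else sigma k.
Proof. by move=> k3; rewrite [LHS]pres_lift_gen /iota_gen inordK. Qed.

(* The braid which moves the strand 0 to the position k. *)
Definition mv0 (k : nat) : B4 := \prod_(j <- iota 0 k) sigma j.

(* The label of sigma i at k is the word in BB for
   mv0 k * sigma i * (mv0 k')^-1, where k' is the image of k: see position0_iota. *)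
Definition slab (i k : nat) : BB :=
  if (k < i)%N then bgen i else if k == i then 1 else
  if k == i.+1 then
    (if i == 0%N then bgen 0 else if i == 1%N then (bgen 1)^-1 * bgen 0 * bgen 1
     else (bgen 2)^-1 * (bgen 1)^-1 * bgen 0 * bgen 1 * bgen 2)
  else bgen i.+1.

(** Reidemeister-Schreier rewriting for the braids fixing the strand 0: the state is the current
    position of this strand, and the transversal is [mv0]. *)
Definition position0_gen (i : 'I_3) : wreath 'I_4 BB :=
  Wreath [ffun k : 'I_4 => slab i k] (swap_perm i).

Lemma word_eval_perm (S : finType) (A : groupType) (T : choiceType)
    (f : T -> wreath S A) (g : T -> {perm S}) (u : word T) :
  (forall t, wperm (f t) = g t) -> wperm (word_eval f u) = word_eval g u.
Proof.
move=> fg; rewrite !word_evalE; elim: u => [//|[t b] u IH] /=.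
by rewrite IH /letter_eval /=; case: b; rewrite /= ?fg.
Qed.

Lemma position0_rel r s : braid_rel r s -> word_eval position0_gen r = word_eval position0_gen s.
Proof.
have r4 := BB_rel4; have r3 := BB_rel3; have r2 := BB_rel2.
set t := bgen 0 in r4 r2; set p := bgen 1 in r4 r3; set q := bgen 2 in r3 r2.
have pq : p * q * p^-1 = q^-1 * p * q.
  by apply: (mulgI q); apply: (mulIg p); rewrite !mulgA mulgKV mulgV mul1g r3.
have pq' : p * q^-1 * p^-1 = q^-1 * p^-1 * q.
  by have := congr1 inv pq; rewrite !invgM !invgK !mulgA.
have tqV : t * q^-1 = q^-1 * t.
  by apply: (mulgI q); apply: (mulIg q); rewrite !mulgA mulgV mul1g mulgKV r2.
have tpt : p^-1 * t * p * t * p = t * p * t.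
  by apply: (mulgI p); rewrite !mulgA mulgV mul1g r4.
have pqpV : q^-1 * p^-1 * q^-1 = p^-1 * q^-1 * p^-1.
  by have := congr1 inv r3; rewrite !invgM !mulgA.
have pt3 : p^-1 * t * p * q * p^-1 * t * p = p^-1 * q^-1 * t * p * t * q * p.
  have -> : p^-1 * t * p * q * p^-1 * t * p = p^-1 * t * (p * q * p^-1) * t * p.
    by rewrite !mulgA.
  by rewrite pq !mulgA -(mulgA p^-1) tqV !mulgA -(mulgA _ q t) -r2 !mulgA.
move=> rs; apply: wreath_eq => k; last first.
  by rewrite !(word_eval_perm _ (g := swap_perm)) // (swap_perm_rel rs).
case: rs => i j ij; rewrite /word_eval !big_cons !big_nil !mulg1 !wlabM ?wpermM
  /letter_eval /= !ffunE !swap_permE; move: ij.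
- case: i j k => [[|[|[|i]]] ?] [[|[|[|j]]] ?] [[|[|[|[|k]]]] ?] //= _;
    rewrite /slab /= -/t -/p -/q ?mulg1 ?mul1g // !mulgA ?mulgV ?mul1g ?tpt ?r3 //.
  (* The remaining case is that of the strand 0 moving from position 3 to position 1, which outputs
     two conjugates of [t]. *)
  rewrite pt3.
  have -> : q^-1 * p^-1 * t * p * q * p^-1 * t * p * q =
    q^-1 * (p^-1 * t * p * q * p^-1 * t * p) * q by rewrite !mulgA.
  rewrite pt3 !mulgA pqpV.
  have -> : p^-1 * q^-1 * p^-1 * t * p * t * q * p * q =
    p^-1 * q^-1 * (p^-1 * t * p * t * p) * q * p.
    by rewrite -!mulgA (mulgA q p q) -r3 !mulgA.
  by rewrite tpt !mulgA.
- case: i j k => [[|[|[|i]]] ?] [[|[|[|j]]] ?] [[|[|[|[|k]]]] ?] //= _;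
    rewrite /slab /= -/t -/p -/q ?mulg1 ?mul1g // !mulgA.
rewrite pq' -(mulgA _ q t) -r2 -!mulgA; do 3 congr (_ * _).
by rewrite !mulgA r3.
Qed.

Definition position0 : gmorph B4 (wreath 'I_4 BB) := pres_lift position0_rel.

Lemma position0_sigma i : (i < 3)%N -> position0 (sigma i) = position0_gen (inord i).
Proof. by move=> _; apply: pres_lift_gen. Qed.

Lemma position0_wperm b : wperm (position0 b) = braid_perm b.
Proof.
elim/pres_ind: b => [|a b IHa IHb|a IH|i].
- by rewrite !gmulf1.
- by rewrite !gmulfM -IHa -IHb.
- by rewrite !gmulfV -IH.
- have -> : position0 (pres_gen braid_rel i) = position0_gen i by apply: pres_lift_gen.
  by have -> : braid_perm (pres_gen braid_rel i) = swap_perm i by apply: pres_lift_gen.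
Qed.

Lemma slab_iota (i k : nat) : (i < 3)%N -> (k < 4)%N ->
  iotaB (slab i k) * mv0 (if k == i then i.+1 else if k == i.+1 then i else k) = mv0 k * sigma i.
Proof.
have e01 := B4_rel01; have e12 := B4_rel12; have e02 := B4_rel02.
have i0 : iotaB (bgen 0) = sigma 0 * sigma 0 by rewrite iotaB_gen //= expgS expg1.
have i1 : iotaB (bgen 1) = sigma 1 by rewrite iotaB_gen.
have i2 : iotaB (bgen 2) = sigma 2 by rewrite iotaB_gen.
have m0 : mv0 0 = 1 by rewrite /mv0 big_nil.
have m1 : mv0 1 = sigma 0 by rewrite /mv0 /= big_cons big_nil mulg1.
have m2 : mv0 2 = sigma 0 * sigma 1 by rewrite /mv0 /= !big_cons big_nil mulg1.
have m3 : mv0 3 = sigma 0 * sigma 1 * sigma 2 by rewrite /mv0 /= !big_cons big_nil mulg1 mulgA.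
case: i => [|[|[|i]]] // _; case: k => [|[|[|[|k]]]] // _; rewrite /slab /=
  ?gmulf1 ?gmulfM ?gmulfV ?i0 ?i1 ?i2 ?m0 ?m1 ?m2 ?m3 ?mul1g ?mulg1 ?mulgA //.
- by rewrite -(mulgA _ _ (sigma 0)) -e02 !mulgA e01.
- apply: (mulgI (sigma 1)); rewrite !mulgA mulgV mul1g.
  by rewrite -(mulgA _ (sigma 0) (sigma 1)) -(mulgA (sigma 0)) e01 !mulgA e01.
- by rewrite -e02 -!mulgA (mulgA (sigma 1)) e12 !mulgA.
- apply: (mulgI (sigma 2)); rewrite !mulgA mulgV mul1g.
  apply: (mulgI (sigma 1)); rewrite !mulgA mulgV mul1g.
  move: (sigma 0) (sigma 1) (sigma 2) e01 e12 e02 {i0 i1 i2 m0 m1 m2 m3} => p q r pq qr pr.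
  have -> : p * p * q * r * p * q = p * (p * q * p) * r * q.
    by rewrite -!mulgA (mulgA r p) -pr !mulgA.
  have -> : p * (p * q * p) * r * q = (p * q * p) * (q * r * q) by rewrite {1}pq !mulgA.
  have -> : q * r * p * q * r * r = q * p * (r * q * r) * r.
    by rewrite -!mulgA (mulgA r p) -pr !mulgA.
  by rewrite -qr pq -!mulgA (mulgA q r q) qr !mulgA.
Qed.

(** The identity behind the rewriting, checked on generators and propagated by the cocycle rule; at
    [k = 0] it makes [word0] a section of [iotaB] over the braids fixing the strand 0. *)
Lemma position0_iota (b : B4) (k : 'I_4) :
  iotaB (wlab (position0 b) k) * mv0 (braid_perm b k) = mv0 k * b.
Proof.
elim/pres_ind: b k => [|a b IHa IHb|a IH|i] k.
- by rewrite !gmulf1 wlab1 gmulf1 perm1 mul1g mulg1.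
- by rewrite !gmulfM wlabM position0_wperm permM gmulfM -mulgA IHb mulgA IHa mulgA.
- rewrite !gmulfV wlabV position0_wperm.
  have := IH ((braid_perm a)^-1 k); rewrite permKV => e.
  by apply: (mulIg a); rewrite mulgVK -mulgA -e gmulfV mulKg.
- have -> : position0 (pres_gen braid_rel i) = position0_gen i by apply: pres_lift_gen.
  have -> : braid_perm (pres_gen braid_rel i) = swap_perm i by apply: pres_lift_gen.
  rewrite ffunE swap_permE slab_iota //; congr (_ * _).
  by rewrite /sigma inord_val.
Qed.

Definition word0 (b : B4) : BB := wlab (position0 b) ord0.

Lemma word0M a b : braid_perm a ord0 = ord0 -> word0 (a * b) = word0 a * word0 b.
Proof. by move=> a0; rewrite /word0 gmulfM wlabM position0_wperm a0. Qed.

Lemma word0V a : braid_perm a ord0 = ord0 -> word0 a^-1 = (word0 a)^-1.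
Proof.
move=> a0; rewrite /word0 gmulfV wlabV position0_wperm; congr (wlab _ _)^-1.
by apply: (@perm_inj _ (braid_perm a)); rewrite permKV a0.
Qed.

Lemma word0_iota b : braid_perm b ord0 = ord0 -> iotaB (word0 b) = b.
Proof.
move=> b0; have := position0_iota b ord0.
by rewrite b0 /mv0 big_nil mulg1 mul1g.
Qed.

(** * Roots of braids *)

(* d-th roots of the configurations 0 < z_1 < z_2 < z_3: the state (a, b, c) is
   the choice of the branches exp(2 i pi a / d) z_1 ^ (1/d), and so on. The letter 0
   turns z_1 around 0, so its root makes a full turn only when a reaches d. The letter
   1 exchanges z_1 and z_2; their roots have distinct arguments if a <> b, so that
   they pass each other on the side given by the sign of b - a. *)
Section Angle.
Variable d : nat.
Notation Id := 'I_d.-1.+1.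

Definition astate : finType := (Id * Id * Id)%type.

Definition amove_fun (i : nat) (s : astate) : astate :=
  let: (a, b, c) := s in
  if i == 0%N then (zshift (zbar d 1) a, b, c) else
  if i == 1%N then (b, a, c) else (a, c, b).

Lemma amove_inj i : injective (amove_fun i).
Proof.
move=> [[a b] c] [[a' b'] c']; rewrite /amove_fun.
by case: i => [|[|i]] /= [] => [/perm_inj||] -> -> ->.
Qed.

Definition amove i : {perm astate} := perm (@amove_inj i).

Lemma amoveE i s : amove i s = amove_fun i s.
Proof. exact: permE. Qed.

Definition alab (i : nat) (s : astate) : BB :=
  let: (a, b, c) := s in
  if i == 0%N then (if a.+1 == d then bgen 0 else 1) else
  if i == 1%N then (if (a <= b)%N then bgen 1 else (bgen 1)^-1) else
  (if (b <= c)%N then bgen 2 else (bgen 2)^-1).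

Definition angle_gen (i : 'I_3) : wreath astate BB :=
  Wreath [ffun s => alab i s] (amove i).

Hypothesis d0 : (0 < d)%N.

Lemma zshift1_val (a : Id) : zshift (zbar d 1) a = (if a.+1 == d then 0 else a.+1)%N :> nat.
Proof.
have -> : zshift (zbar d 1) a = (a : Zmod d) * zbar d 1 by rewrite permE.
rewrite Zmod_succ //; have := Zmod_lt (a : Zmod d) d0; move: (nat_of_ord a) => k kd.
by case: eqP => [->|/eqP ne]; rewrite ?modnn // modn_small // ltn_neqAle ne.
Qed.

Lemma angle_rel r s : brel r s -> word_eval angle_gen r = word_eval angle_gen s.
Proof.
have r4 := BB_rel4; have r3 := BB_rel3; have r2 := BB_rel2.
move=> rs; apply: wreath_eq => -[[a b] c]; last first.
  by case: rs => i j ei ej; rewrite /word_eval !big_cons !big_nil !mulg1 !wpermM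
    /letter_eval /= ei ej !amoveE.
have ad : (a < d)%N := Zmod_lt (a : Zmod d) d0.
have bd : (b < d)%N := Zmod_lt (b : Zmod d) d0.
case: rs => i j ei ej; rewrite /word_eval !big_cons !big_nil !mulg1 !wlabM ?wpermM
    /letter_eval /= ei ej !ffunE !amoveE /=.
- rewrite !zshift1_val.
  (* Whether [a] or [b] reaches [d] decides which letters 0 are output. If both do, the relation is
     [r4]; otherwise the two letters 1 on each side have opposite signs and cancel. *)
  case: (a.+1 =P d) => ea; case: (b.+1 =P d) => eb; rewrite ?mul1g ?mulg1 ?leq0n;
    do ?(case: leqP => ?); try lia;
    by rewrite ?mulgA ?r4 ?mulgV ?mulVg ?mul1g ?mulg1 ?mulgK ?mulgKV.
(* The signs are the comparisons of the branches [a], [b], [c]. *)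
- rewrite !mulgA; apply: (braid_sign r3); first exact: leq_trans.
  by move=> ac; case: leqP => //= ba; apply: leq_trans (ltnW ba) ac.
- have r2' : bgen 0 * (bgen 2)^-1 = (bgen 2)^-1 * bgen 0.
    by apply: (mulgI (bgen 2)); apply: (mulIg (bgen 2)); rewrite !mulgA mulgV mul1g mulgKV r2.
  by case: ifP => _; case: ifP => _; rewrite ?mul1g ?mulg1.
Qed.

Definition angle : gmorph BB (wreath astate BB) := pres_lift angle_rel.

Lemma angle_wperm k s : (k < 3)%N -> wperm (angle (bgen k)) s = amove_fun k s.
Proof.
move=> k3; have -> : angle (bgen k) = angle_gen (inord k) by apply: pres_lift_gen.
by rewrite [LHS]amoveE inordK.
Qed.

Lemma angle_wlab k s : (k < 3)%N -> wlab (angle (bgen k)) s = alab k s.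
Proof.
move=> k3; have -> : angle (bgen k) = angle_gen (inord k) by apply: pres_lift_gen.
by rewrite ffunE inordK.
Qed.

Lemma angle_wlabt a b c : wlab (angle (bgen 0)) (a, b, c) = if a.+1 == d then bgen 0 else 1.
Proof. by rewrite angle_wlab. Qed.

Lemma angle_wlab1 a b c :
  wlab (angle (bgen 1)) (a, b, c) = if (a <= b)%N then bgen 1 else (bgen 1)^-1.
Proof. by rewrite angle_wlab. Qed.

Lemma angle_wlab2 a b c :
  wlab (angle (bgen 2)) (a, b, c) = if (b <= c)%N then bgen 2 else (bgen 2)^-1.
Proof. by rewrite angle_wlab. Qed.

Lemma angle_wpermt a b c : wperm (angle (bgen 0)) (a, b, c) = (zshift (zbar d 1) a, b, c).
Proof. by rewrite angle_wperm. Qed.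

Lemma angle_wperm1 a b c : wperm (angle (bgen 1)) (a, b, c) = (b, a, c).
Proof. by rewrite angle_wperm. Qed.

Lemma angle_wperm2 a b c : wperm (angle (bgen 2)) (a, b, c) = (a, c, b).
Proof. by rewrite angle_wperm. Qed.

Definition aget (s : astate) (m : nat) : Zmod d :=
  if m == 1%N then s.1.1 else if m == 2%N then s.1.2 else s.2.

Lemma BB_ind (P : BB -> Prop) :
    P 1 -> (forall x y, P x -> P y -> P (x * y)) -> (forall x, P x -> P x^-1) ->
    P (bgen 0) -> P (bgen 1) -> P (bgen 2) -> forall x, P x.
Proof.
move=> P1 PM PV P0' P1' P2'; apply: pres_ind => // -[[|[|[|k]]] k3] //.
- by have -> : Ordinal k3 = inord 0 by apply/val_inj; rewrite /= inordK.
- by have -> : Ordinal k3 = inord 1 by apply/val_inj; rewrite /= inordK.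
- by have -> : Ordinal k3 = inord 2 by apply/val_inj; rewrite /= inordK.
Qed.

Lemma braid_perm_sigma k (p : 'I_4) : (k < 3)%N -> braid_perm (sigma k) p =
  (if p == k :> nat then k.+1 else if p == k.+1 :> nat then k : nat else p) :> nat.
Proof.
move=> k3; have -> : braid_perm (sigma k) = swap_perm (inord k) by apply: pres_lift_gen.
by rewrite swap_permE inordK.
Qed.

Lemma braid_perm_sigmaV k : (k < 3)%N -> (braid_perm (sigma k))^-1 = braid_perm (sigma k).
Proof.
move=> k3; apply: (mulgI (braid_perm (sigma k))); rewrite mulgV.
have -> : braid_perm (sigma k) = swap_perm (inord k) by apply: pres_lift_gen.
exact: esym (tperm2 _ _).
Qed.

Lemma iotaB_t : iotaB (bgen 0) = sigma 0 * sigma 0.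
Proof. by rewrite iotaB_gen. Qed.

Lemma iotaB_1 : iotaB (bgen 1) = sigma 1.
Proof. by rewrite iotaB_gen. Qed.

Lemma iotaB_2 : iotaB (bgen 2) = sigma 2.
Proof. by rewrite iotaB_gen. Qed.

Lemma iotaB_permt : braid_perm (iotaB (bgen 0)) = 1.
Proof. by rewrite iotaB_t gmulfM -{1}braid_perm_sigmaV // mulVg. Qed.

Lemma iotaB_perm0 b : braid_perm (iotaB b) ord0 = ord0.
Proof.
elim/BB_ind: b => [|x y IHx IHy|x IH|||].
- by rewrite !gmulf1 perm1.
- by rewrite !gmulfM permM IHx IHy.
- by rewrite !gmulfV; apply: (@perm_inj _ (braid_perm (iotaB x))); rewrite permKV IH.
- by rewrite iotaB_permt perm1.
- by rewrite iotaB_1; apply: ord_inj; rewrite braid_perm_sigma.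
- by rewrite iotaB_2; apply: ord_inj; rewrite braid_perm_sigma.
Qed.

Lemma angle_perm b s : braid_perm (iotaB (wlab (angle b) s)) = braid_perm (iotaB b).
Proof.
elim/BB_ind: b s => [|x y IHx IHy|x IH|||] s.
- by rewrite !gmulf1 wlab1 !gmulf1.
- by rewrite !gmulfM wlabM !gmulfM IHx IHy.
- by rewrite !gmulfV wlabV !gmulfV IH.
- case: s => -[a b] c; rewrite angle_wlabt; case: ifP => // _.
  by rewrite iotaB_permt !gmulf1.
- case: s => -[a b] c; rewrite angle_wlab1; case: ifP => // _.
  by rewrite !gmulfV iotaB_1 braid_perm_sigmaV.
- case: s => -[a b] c; rewrite angle_wlab2; case: ifP => // _.
  by rewrite !gmulfV iotaB_2 braid_perm_sigmaV.
Qed.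

(** The number of turns, modulo [n], of the strand issued from [m] around the strand 0. *)
Definition lk (n : nat) (b : BB) (m : 'I_4) : Zmod n := wlab (crossings n (iotaB b)) (ord0, m).

Lemma lk1 n m : lk n 1 m = 1.
Proof. by rewrite /lk !gmulf1 wlab1. Qed.

Lemma lkM n x y m : lk n (x * y) m = lk n x m * lk n y (braid_perm (iotaB x) m).
Proof. by rewrite /lk !gmulfM wlabM crossings_perm /= iotaB_perm0. Qed.

Lemma lkV n x m : lk n x^-1 (braid_perm (iotaB x) m) = (lk n x m)^-1.
Proof. by apply: (mulgI (lk n x m)); rewrite -lkM !mulgV lk1. Qed.

Lemma lk_gen n k m : (k < 3)%N -> lk n (bgen k) m = zbar n ((k == 0%N) && (m == 1%N :> nat)).
Proof.
move=> k3; have gE i : crossings n (sigma i) = crossing n (inord i) by apply: pres_lift_gen.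
rewrite /lk iotaB_gen //; case: k k3 => [|k] k3 /=; last first.
  by rewrite gE ffunE /= inordK.
rewrite gmulfXn expgS expg1 wlabM crossings_perm gE !ffunE /= !inordK // !braid_perm_sigma //.
by rewrite -zbarD; congr (zbar _ _); case: m => [[|[|m]] ?].
Qed.

(** The analogue of [dwreath_phi2] for each strand: the initial branch plus the turns of the point
    is [d] times the turns of its root plus the final branch. The letters 1 and 2, whatever their
    sign, only permute the branches. *)
Lemma angle_lk n b s (m : 'I_4) : (0 < n)%N -> m != ord0 ->
  dmul d (lk n (wlab (angle b) s) m)
    * zbar (d * n) (nat_of_ord (aget (wperm (angle b) s) (braid_perm (iotaB b) m)))
  = zbar (d * n) (nat_of_ord (aget s m)) * lk (d * n) b m.
Proof.
move=> n0; elim/BB_ind: b s m => [|x y IHx IHy|x IH|||] s m m0.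
- by rewrite !gmulf1 wlab1 !lk1 dmul1 // !perm1 mulg1 mul1g.
- have xm0 : braid_perm (iotaB x) m != ord0.
    by rewrite -(iotaB_perm0 x) (inj_eq (@perm_inj _ _)).
  rewrite !gmulfM wlabM !lkM dmulM // wpermM permM angle_perm -mulgA IHy //.
  by rewrite mulgA IHx // mulgA.
- have [m' em] : exists m', m = braid_perm (iotaB x) m'.
    by exists ((braid_perm (iotaB x))^-1 m); rewrite permKV.
  have m'0 : m' != ord0.
    by move: m0; rewrite em -{1}(iotaB_perm0 x) (inj_eq (@perm_inj _ _)).
  have := IH ((wperm (angle x))^-1 s) _ m'0; rewrite permKV em lkV.
  rewrite !gmulfV wlabV wpermV permK; set s' := _ s => e.
  have := lkV n (wlab (angle x) s') m'; rewrite angle_perm => ->.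
  apply: (mulgI (dmul d (lk n (wlab (angle x) s') m'))).
  rewrite !mulgA -dmulM // mulgV dmul1 // mul1g e.
  by rewrite mulgK.
- case: s => -[a b] c; rewrite angle_wlabt angle_wpermt lk_gen // iotaB_permt perm1.
  have -> : lk n (if a.+1 == d then bgen 0 else 1) m =
      if (m == 1%N :> nat) && (a.+1 == d) then zbar n 1 else 1.
    case: (a.+1 =P d) => _; rewrite ?lk1 ?andbF // lk_gen // andbT.
    by case: (m == 1%N :> nat); rewrite /= ?zbar0.
  have [m1|m1] := eqVneq (m : nat) 1%N; last first.
    by rewrite /= /aget (negbTE m1) dmul1 // zbar0 mul1g mulg1.
  rewrite /= /aget m1 /= -zbarD addn1 (zbar_succ d0 n0 (a : Zmod d)).
  have <- : zshift (zbar d 1) a = (a : Zmod d) * zbar d 1 by rewrite permE.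
  by case: eqP; rewrite ?dmul1.
- case: s => -[a b] c; rewrite angle_wlab1 angle_wperm1 lk_gen // zbar0 mulg1.
  have -> : lk n (if (a <= b)%N then bgen 1 else (bgen 1)^-1) m = 1.
    case: ifP => _; first by rewrite lk_gen //= zbar0.
    rewrite -[m](permKV (braid_perm (iotaB (bgen 1)))) lkV lk_gen //= zbar0 invg1 //.
  rewrite dmul1 // mul1g; congr (zbar _ (nat_of_ord _)).
  rewrite iotaB_1 /aget braid_perm_sigma //.
  by case: m m0 => [[|[|[|[|m]]]] ?].
- case: s => -[a b] c; rewrite angle_wlab2 angle_wperm2 lk_gen // zbar0 mulg1.
  have -> : lk n (if (b <= c)%N then bgen 2 else (bgen 2)^-1) m = 1.
    case: ifP => _; first by rewrite lk_gen //= zbar0.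
    rewrite -[m](permKV (braid_perm (iotaB (bgen 2)))) lkV lk_gen //= zbar0 invg1 //.
  rewrite dmul1 // mul1g; congr (zbar _ (nat_of_ord _)).
  rewrite iotaB_2 /aget braid_perm_sigma //.
  by case: m m0 => [[|[|[|[|m]]]] ?].
Qed.

End Angle.

(** * The root cocycle on pure braids *)

Section PureBraids.
Variables (d : nat) (d0 : (0 < d)%N).
Notation W := (angle d0).

Lemma pure_perm (p : P4) : braid_perm (val p) = 1.
Proof. exact/eqP/kerg_prop. Qed.

Lemma pure_perm0 (p : P4) : braid_perm (val p) ord0 = ord0.
Proof. by rewrite pure_perm perm1. Qed.

Lemma root_label_subproof (s : astate d) (p : P4) :
  braid_perm (iotaB (wlab (W (word0 (val p))) s)) == 1.
Proof. by rewrite angle_perm word0_iota ?pure_perm ?perm1. Qed.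

Definition root_label s p : P4 := Kerg (root_label_subproof s p).

Definition root_fun (p : P4) : wreath (astate d) P4 :=
  Wreath [ffun s => root_label s p] (wperm (W (word0 (val p)))).

Lemma root_funM : {morph root_fun : p q / p * q}.
Proof.
move=> p q; have e : word0 (val (p * q)) = word0 (val p) * word0 (val q).
  exact: (word0M _ (pure_perm0 p)).
apply: wreath_eq => s; last by rewrite wpermM /= e gmulfM permM.
rewrite wlabM !ffunE; apply/val_inj.
change (iotaB (wlab (W (word0 (val (p * q)))) s) =
  iotaB (wlab (W (word0 (val p))) s) *
  iotaB (wlab (W (word0 (val q))) (wperm (W (word0 (val p))) s))).
by rewrite e gmulfM wlabM gmulfM.
Qed.

Definition droot : gmorph P4 (wreath (astate d) P4) := mk_gmorph root_funM.

Lemma root_wperm p s : wperm (droot p) s = wperm (W (word0 (val p))) s.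
Proof. by []. Qed.

Lemma root_wlab p s (q : P4) :
  wlab (W (word0 (val p))) s = word0 (val q) -> wlab (droot p) s = q.
Proof.
move=> e; rewrite ffunE; apply/val_inj.
change (iotaB (wlab (W (word0 (val p))) s) = val q).
by rewrite e word0_iota // pure_perm0.
Qed.

Lemma lk_phi3 n (p : P4) (j : 'I_3) : lk n (word0 (val p)) (lift ord0 j) = phi3 n p j.
Proof. by rewrite /lk word0_iota ?pure_perm0 // [RHS]ffunE. Qed.

Lemma root_lk n p s (j : 'I_3) : (0 < n)%N ->
  dmul d (phi3 n (wlab (droot p) s) j)
    * zbar (d * n) (nat_of_ord (aget (wperm (droot p) s) (lift ord0 j)))
  = zbar (d * n) (nat_of_ord (aget s (lift ord0 j))) * phi3 (d * n) p j.
Proof.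
move=> n0; rewrite -!lk_phi3 root_wperm.
have := angle_lk d0 (word0 (val p)) s n0 (isT : lift ord0 j != ord0).
rewrite word0_iota ?pure_perm0 // pure_perm perm1 => <-.
congr (dmul d _ * _); rewrite /lk word0_iota ?pure_perm0 //.
by rewrite ffunE.
Qed.

(** By [root_lk], the final branches agree with the initial ones modulo [d]; once they are
    cancelled, the injectivity of [dmul] gives the linking numbers of the label. *)
Lemma root_tame n : (0 < n)%N -> tame (phi3 (d * n)) (phi3 n) droot.
Proof.
move=> n0 p pp s.
have pj (j : 'I_3) : phi3 (d * n) p j = 1 by rewrite pp ffunE.
have e (j : 'I_3) : nat_of_ord (aget (wperm (droot p) s) (lift ord0 j)) =
    nat_of_ord (aget s (lift ord0 j)).
  have := root_lk p s j n0; rewrite pj mulg1 => /(congr1 (@nat_of_ord _)).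
  move=> /(congr1 (zbar d)); rewrite zbar_red //.
  have R (a : nat) : zbar d (nat_of_ord (zbar (d * n) a)) = zbar d a.
    apply/zbar_eqP => //=; rewrite prednK ?muln_gt0 ?d0 // modn_dvdm // dvdn_mulr //.
  have dn1 x : zbar d (nat_of_ord (dmul d x : Zmod (d * n))) = 1.
    by rewrite R mulnC -zbar1X mulnC expgM zbar1X zbarN expg1n.
  by rewrite dn1 mul1g !R !zbar_val => ->.
split.
  have e1 : aget (wperm (droot p) s) 1 = aget s 1 by apply: ord_inj; apply: (e ord0).
  have e2 : aget (wperm (droot p) s) 2 = aget s 2.
    by apply: ord_inj; apply: (e (Ordinal (isT : (1 < 3)%N))).
  have e3 : aget (wperm (droot p) s) 3 = aget s 3.
    by apply: ord_inj; apply: (e (Ordinal (isT : (2 < 3)%N))).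
  case: s (wperm (droot p) s) e1 e2 e3 {e} => -[a b] c [[a' b'] c'].
  by rewrite /aget /= => -> -> ->.
apply/ffunP => j; apply: (dmul_inj d0 n0); rewrite [in RHS]ffunE dmul1 //.
apply: (mulIg (zbar (d * n) (nat_of_ord (aget s (lift ord0 j))))).
by have := root_lk p s j n0; rewrite e pj mulg1 mul1g.
Qed.

Lemma word0_sigma i : (0 < i < 3)%N -> word0 (sigma i) = bgen i.
Proof.
case/andP=> i0 i3; rewrite /word0 position0_sigma // ffunE /slab /=.
by rewrite inordK // i0.
Qed.

Lemma sigma_perm0 i : (0 < i < 3)%N -> braid_perm (sigma i) ord0 = ord0.
Proof.
case/andP=> i0 i3; apply: ord_inj; rewrite braid_perm_sigma //=.
by case: i i0 i3 => [|[|[|i]]].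
Qed.

Lemma sigma0_perm0 : braid_perm (sigma 0 * sigma 0) ord0 = ord0.
Proof. by rewrite gmulfM -{1}braid_perm_sigmaV // mulVg perm1. Qed.

Lemma word0_sigma0 : word0 (sigma 0 * sigma 0) = bgen 0.
Proof.
have g0 : position0 (sigma 0) = position0_gen (inord 0) by apply: position0_sigma.
rewrite /word0 gmulfM wlabM g0 !ffunE /= swap_permE inordK //=.
by rewrite /slab /= mul1g.
Qed.

Lemma word0_x01 : word0 (val (x_ 0 1)) = bgen 0.
Proof.
change (word0 (artin_conj 0 1 * sigma 0 ^+ 2 * (artin_conj 0 1)^-1) = bgen 0).
by rewrite /artin_conj /= big_nil mul1g invg1 mulg1 expgS expg1 word0_sigma0.
Qed.

Lemma word0_x12 : word0 (val (x_ 1 2)) = bgen 1 * bgen 1.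
Proof.
change (word0 (artin_conj 1 2 * sigma 1 ^+ 2 * (artin_conj 1 2)^-1) = bgen 1 * bgen 1).
by rewrite /artin_conj /= big_nil mul1g invg1 mulg1 expgS expg1 word0M ?sigma_perm0 // word0_sigma.
Qed.

Lemma word0_x23 : word0 (val (x_ 2 3)) = bgen 2 * bgen 2.
Proof.
change (word0 (artin_conj 2 3 * sigma 2 ^+ 2 * (artin_conj 2 3)^-1) = bgen 2 * bgen 2).
by rewrite /artin_conj /= big_nil mul1g invg1 mulg1 expgS expg1 word0M ?sigma_perm0 // word0_sigma.
Qed.

Lemma word0_x02 : word0 (val (x_ 0 2)) = bgen 1 * bgen 0 * (bgen 1)^-1.
Proof.
change (word0 (artin_conj 0 2 * sigma 0 ^+ 2 * (artin_conj 0 2)^-1) =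
  bgen 1 * bgen 0 * (bgen 1)^-1).
rewrite /artin_conj /= big_cons big_nil mulg1 expgS expg1.
have p0 : braid_perm (sigma 1 * (sigma 0 * sigma 0)) ord0 = ord0.
  by rewrite gmulfM permM sigma_perm0 // sigma0_perm0.
by rewrite (word0M _ p0) word0M ?sigma_perm0 // word0V ?sigma_perm0 // word0_sigma0 !word0_sigma.
Qed.

Lemma word0_x13 : word0 (val (x_ 1 3)) = bgen 2 * (bgen 1 * bgen 1) * (bgen 2)^-1.
Proof.
change (word0 (artin_conj 1 3 * sigma 1 ^+ 2 * (artin_conj 1 3)^-1) =
  bgen 2 * (bgen 1 * bgen 1) * (bgen 2)^-1).
rewrite /artin_conj /= big_cons big_nil mulg1 expgS expg1.
have p0 : braid_perm (sigma 2 * (sigma 1 * sigma 1)) ord0 = ord0.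
  by rewrite !gmulfM !permM !sigma_perm0.
by rewrite (word0M _ p0) !word0M ?sigma_perm0 // word0V ?sigma_perm0 // !word0_sigma.
Qed.

Lemma word0_pureM (p q : P4) : word0 (val (p * q)) = word0 (val p) * word0 (val q).
Proof. exact: (word0M _ (pure_perm0 p)). Qed.

End PureBraids.

(** * Values of the root cocycle on the arguments of the pentagon *)

Section RootValues.
Variables (d : nat) (d0 : (0 < d)%N).
Notation W := (angle d0).
Notation o := (ord0 : 'I_d.-1.+1).
Implicit Types a : 'I_d.-1.+1.

Lemma root_wlab_if p s (b : bool) :
  wlab (W (word0 (val p))) s = (if b then word0 (val p) else 1) ->
  wlab (droot d0 p) s = if b then p else 1.
Proof.
move=> e; apply: root_wlab; rewrite e; case: b {e} => //.
by rewrite /word0 [val 1]/(1 : B4) gmulf1 wlab1.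
Qed.

Lemma angle_wlab2V a b c :
  wlab (W (bgen 2)^-1) (a, b, c) = (if (c <= b)%N then bgen 2 else (bgen 2)^-1)^-1.
Proof.
rewrite gmulfV wlabV; congr (_ ^-1).
have -> : (wperm (W (bgen 2)))^-1 (a, b, c) = (a, c, b).
  by apply: (@perm_inj _ (wperm (W (bgen 2)))); rewrite permKV angle_wperm2.
exact: angle_wlab2.
Qed.

Lemma leqo a : (a <= o)%N = (a == o).
Proof. by rewrite leqn0. Qed.

Lemma root_x01 a : wlab (droot d0 (x_ 0 1)) (a, o, o) = if a.+1 == d then x_ 0 1 else 1.
Proof. by apply: root_wlab_if; rewrite word0_x01 angle_wlabt. Qed.

Lemma move_x01 a : wperm (droot d0 (x_ 0 1)) (a, o, o) = (zshift (zbar d 1) a, o, o).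
Proof. by rewrite root_wperm word0_x01 angle_wpermt. Qed.

(** If [a] is not 0, the two crossings have opposite signs and cancel: roots with distinct arguments
    do not wind around each other. *)
Lemma root_x12 a : wlab (droot d0 (x_ 1 2)) (a, o, o) = if a == o then x_ 1 2 else 1.
Proof.
apply: root_wlab_if; rewrite word0_x12 gmulfM wlabM angle_wperm1 !angle_wlab1 leqo.
by case: eqP => [->//|_]; rewrite leq0n mulVg.
Qed.

Lemma root_x12x13 a : wlab (droot d0 (x_ 1 2 * x_ 1 3)) (a, o, o) =
  if a == o then x_ 1 2 * x_ 1 3 else 1.
Proof.
apply: root_wlab_if; rewrite word0_pureM word0_x12 word0_x13.
rewrite !gmulfM !wlabM !wpermM !(angle_wperm1, angle_wperm2).
rewrite angle_wlab2V angle_wlab2 !angle_wlab1 leqo leqnn leq0n.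
by case: (a == o) => //; rewrite !mulVg ?mul1g ?mulg1 mulgV.
Qed.

Lemma root_x02x12 a : wlab (droot d0 (x_ 0 2 * x_ 1 2)) (o, a, o) =
  if a.+1 == d then x_ 0 2 * x_ 1 2 else 1.
Proof.
apply: root_wlab_if; rewrite word0_pureM word0_x12 word0_x02.
rewrite mulgA mulgKV !gmulfM !wlabM !wpermM !(angle_wpermt, angle_wperm1).
rewrite angle_wlabt !angle_wlab1 leq0n zshift1_val //.
by case: ifP => _; rewrite ?mulg1 // mulgV.
Qed.

Lemma move_x02x12 a : wperm (droot d0 (x_ 0 2 * x_ 1 2)) (o, a, o) = (o, zshift (zbar d 1) a, o).
Proof.
rewrite root_wperm word0_pureM word0_x12 word0_x02 mulgA mulgKV.
by rewrite !gmulfM !wpermM !(angle_wpermt, angle_wperm1).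
Qed.

Lemma root_x23 a : wlab (droot d0 (x_ 2 3)) (o, a, o) = if a == o then x_ 2 3 else 1.
Proof.
apply: root_wlab_if; rewrite word0_x23 gmulfM wlabM angle_wperm2 !angle_wlab2 leqo.
by case: eqP => [->//|_]; rewrite leq0n mulVg.
Qed.

(** The full twist on the strands 0, 1, 2 turns both roots together. For [x_01 x_02] alone the label
    would be [x_12 ^ -1] when [a + 1] differs from [d]; the factor [x_12] compensates for it. *)
Lemma root_x012 a : wlab (droot d0 (x_ 0 1 * x_ 0 2 * x_ 1 2)) (a, a, o) =
  if a.+1 == d then x_ 0 1 * x_ 0 2 * x_ 1 2 else 1.
Proof.
apply: root_wlab_if; rewrite !word0_pureM word0_x12 word0_x02 word0_x01.
rewrite !mulgA mulgKV !gmulfM !wlabM !wpermM !(angle_wpermt, angle_wperm1).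
rewrite !angle_wlabt !angle_wlab1 !zshift1_val //.
case: ifP => _; rewrite ?leq0n ?leqnn // ltnn !mul1g mulg1.
exact: mulVg.
Qed.

Lemma move_x012 a : wperm (droot d0 (x_ 0 1 * x_ 0 2 * x_ 1 2)) (a, a, o) =
  (zshift (zbar d 1) a, zshift (zbar d 1) a, o).
Proof.
rewrite root_wperm !word0_pureM word0_x12 word0_x02 word0_x01 !mulgA mulgKV.
by rewrite !gmulfM !wpermM !(angle_wpermt, angle_wperm1).
Qed.

Lemma root_x13x23 a : wlab (droot d0 (x_ 1 3 * x_ 2 3)) (a, a, o) =
  if a == o then x_ 1 3 * x_ 2 3 else 1.
Proof.
apply: root_wlab_if; rewrite word0_pureM word0_x23 word0_x13.
rewrite !mulgA mulgKV !gmulfM !wlabM !wpermM !(angle_wperm1, angle_wperm2).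
rewrite !angle_wlab2 !angle_wlab1 leqo.
by case: eqP => [->//|_]; rewrite leq0n mulgKV mulVg.
Qed.

Lemma root_x12_o : wlab (droot d0 (x_ 1 2)) (o, o, o) = x_ 1 2.
Proof. by rewrite root_x12 eqxx. Qed.

Lemma root_x23_o : wlab (droot d0 (x_ 2 3)) (o, o, o) = x_ 2 3.
Proof. by rewrite root_x23 eqxx. Qed.

End RootValues.

(** By the relation of length 4 in [BB], already [bgen 1] commutes with the word of [x_01 x_02], and
    [x_12] is its square. *)
Lemma x012_commute : commute (x_ 1 2) (x_ 0 1 * x_ 0 2).
Proof.
have e4 := BB_rel4.
apply/val_inj; change (val (x_ 1 2) * val (x_ 0 1 * x_ 0 2) = val (x_ 0 1 * x_ 0 2) * val (x_ 1 2)).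
rewrite -[val (x_ 1 2)]word0_iota ?pure_perm0 // -[val (x_ 0 1 * _)]word0_iota ?pure_perm0 //.
rewrite word0_pureM word0_x12 word0_x01 word0_x02 -!gmulfM; congr (iotaB _).
have C : commute (bgen 1) (bgen 0 * (bgen 1 * bgen 0 * (bgen 1)^-1)).
  by apply: (mulIg (bgen 1)); rewrite !mulgA !mulgKV e4.
exact: (commute_sym (commuteM (commute_sym C) (commute_sym C))).
Qed.

Lemma x123_commute : commute (x_ 1 2) (x_ 1 3 * x_ 2 3).
Proof.
have e3 := BB_rel3.
apply/val_inj; change (val (x_ 1 2) * val (x_ 1 3 * x_ 2 3) = val (x_ 1 3 * x_ 2 3) * val (x_ 1 2)).
rewrite -[val (x_ 1 2)]word0_iota ?pure_perm0 // -[val (x_ 1 3 * _)]word0_iota ?pure_perm0 //.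
rewrite word0_pureM word0_x12 word0_x13 word0_x23 -!gmulfM; congr (iotaB _).
have C : commute (bgen 1) (bgen 2 * (bgen 1 * bgen 1) * (bgen 2)^-1 * (bgen 2 * bgen 2)).
  rewrite /commute !mulgA !mulgKV e3.
  have -> : bgen 2 * bgen 1 * bgen 1 * bgen 2 * bgen 1 =
    bgen 2 * bgen 1 * (bgen 1 * bgen 2 * bgen 1) by rewrite !mulgA.
  by rewrite e3 !mulgA.
exact: (commute_sym (commuteM (commute_sym C) (commute_sym C))).
Qed.

(** * The mixed pentagon *)

Lemma lift2_inc (l : nat) (G H : groupType) (phi : gmorph G H) (u v : G) a :
  lift2 (inc u) (inc v) a = inc (lift2 u v a) :> completion l phi.
Proof.
elim/F2_ind: a => [|a b IHa IHb|a IH||].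
- by rewrite !gmulf1.
- by rewrite !gmulfM IHa IHb.
- by rewrite !gmulfV IH.
- by rewrite !lift2x.
- by rewrite !lift2y.
Qed.

Section TransferAt2.
Variables (l : nat) (S : finType) (G H G' H' : groupType).
Variables (phi : gmorph G H) (phi' : gmorph G' H') (W : gmorph G (wreath S G')).
Hypothesis tW : tame phi phi' W.
Variables (d n : nat) (d0 : (0 < d)%N) (n0 : (0 < n)%N).
Variables (u v : G) (u' v' : G') (s : Zmod d -> S).
Hypothesis pu : phi u ^+ (d * n) = 1.
Hypothesis pv : phi v = 1.
Hypothesis pu' : phi' u' ^+ n = 1.
Hypothesis pv' : phi' v' = 1.
Hypothesis mu : forall i, wperm (W u) (s i) = s (i * zbar d 1).
Hypothesis wu : forall i : Zmod d, wlab (W u) (s i) = if (nat_of_ord i).+1 == d then u' else 1.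
Hypothesis wv : forall i : Zmod d, wlab (W v) (s i) = if i == ord0 then v' else 1.

Lemma wlab_orbit k : (k <= d)%N ->
  wlab (W (u ^+ k)) (s 1) = (if k == d then u' else 1) /\ wperm (W (u ^+ k)) (s 1) = s (zbar d k).
Proof.
elim: k => [|k IH] kd; first by rewrite gmulf1 wlab1 wperm1 zbar0 (ltn_eqF d0).
have [IHl IHp] := IH (ltnW kd).
rewrite expgSr gmulfM wlabM wpermM IHl IHp mu wu (ltn_eqF kd) mul1g -zbarD addn1.
have -> : nat_of_ord (zbar d k) = k by rewrite /= prednK // modn_small.
by [].
Qed.

(** [u] outputs only at the last step of a turn, so [u ^ d] read from the state 0 outputs [u'], as
    the transfer principle requires. *)
Lemma transfer_at2 (c : completion l (phi2 (d * n))) : proj c = 1 ->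
  wext W (s 1) (at2 c u v : completion l phi) =
  at2 (wext (dwreath d Fx) ord0 c : completion l (phi2 n)) u' v' :> completion l phi'.
Proof.
apply: (transfer tW d0 n0 (s := s)); rewrite ?proj_inc //.
- by move=> i; rewrite (wact_inc tW).
- by move=> i; rewrite (wext_inc tW) wv; case: ifP => _; rewrite ?gmulf1.
- rewrite -gmulfXn (wext_inc tW).
  by have [-> _] := wlab_orbit (leqnn d); rewrite eqxx.
Qed.

End TransferAt2.

Section QuotientLevel.
Variables (l : nat) (G H : groupType) (phi : gmorph G H) (T : groupType) (chi : gmorph G T).
Hypothesis finT : finite_set [set: T].
Hypothesis chi_phi : forall g, chi g = 1 -> phi g = 1.
Hypothesis chi_l : forall g, phi g = 1 -> exists k, chi g ^+ (l ^ k) = 1.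

Lemma qlevel_subproof : is_level l phi [set g | chi g = 1].
Proof.
split=> /=; first exact: gmulf1.
- by move=> a b pa pb; rewrite gmulfF pa pb divgg.
- exact: chi_phi.
- by move=> g a pa; rewrite gmulfF gmulfM pa mulg1 divgg.
- apply: sub_finite_set (finite_image (fun t => [set g | chi g = t]) finT).
  move=> _ [g _ <-]; exists (chi g) => //.
  apply/seteqP; split=> [h /= e|_ [m /= pm <-]]; last by rewrite gmulfM pm mulg1.
  by exists (g^-1 * h); rewrite ?mulVKg //= gmulfM gmulfV e mulVg.
- by move=> g /chi_l[k e]; exists k; rewrite /= gmulfXn.
Qed.

Definition qlevel : level l phi := Level qlevel_subproof.

End QuotientLevel.

(** * The degree in x as an element of Z_l(N) *)

Section Degree.
Variables (l N : nat) (l0 : (0 < l)%N) (N0 : (0 < N)%N) (k : nat).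
Notation M := (N * l ^ k)%N.

Let lk0 : (0 < l ^ k)%N. Proof. by rewrite expn_gt0 l0. Qed.

(** The kernel of the reduction from [Z/(N l^k)Z] to [Z/NZ] is cyclic of order [l^k]. *)
Lemma Zmod_red_exp (v : Zmod M) : zbar N (nat_of_ord v) = 1 -> v ^+ (l ^ k) = 1.
Proof.
rewrite -{2}[v]zbar_val -(zbar0 N) => /zbar_eqP -/(_ N0); rewrite mod0n => e.
have -> : nat_of_ord v = (nat_of_ord v %/ N * N)%N by rewrite {1}(divn_eq (nat_of_ord v) N) e addn0.
move: (nat_of_ord v %/ N)%N => q.
by rewrite -zbar1X -expgM -mulnA (mulnC q) expgM zbar1X zbarN expg1n.
Qed.

Lemma phi2_level_sub g : phi2 M g = 1 -> phi2 N g = 1.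
Proof. by apply: phi2_dvd. Qed.

Lemma phi2_level_l g : phi2 N g = 1 -> exists j, phi2 M g ^+ (l ^ j) = 1.
Proof. by move=> e; exists k; apply: Zmod_red_exp; rewrite phi2_red. Qed.

Lemma crossings_red b (p : 'I_4 * 'I_4) :
  zbar N (nat_of_ord (wlab (crossings M b) p)) = wlab (crossings N b) p.
Proof.
elim/pres_ind: b p => [|a b IHa IHb|a IH|i] p.
- by rewrite !gmulf1 !wlab1 /= zbar0.
- by rewrite !gmulfM !wlabM zbar_red // IHa IHb !crossings_perm.
- rewrite !gmulfV !wlabV.
  have -> : (wperm (crossings M a))^-1 p = (wperm (crossings N a))^-1 p.
    apply: (@perm_inj _ (wperm (crossings M a))); rewrite permKV.
    rewrite crossings_perm -(crossings_perm N) permKV //.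
  apply: (mulgI (wlab (crossings N a) ((wperm (crossings N a))^-1 p))).
  by rewrite -{1}IH -zbar_red // !mulgV /= zbar0.
- have -> : crossings M (pres_gen braid_rel i) = crossing M i by apply: pres_lift_gen.
  have -> : crossings N (pres_gen braid_rel i) = crossing N i by apply: pres_lift_gen.
  rewrite !ffunE; apply/zbar_eqP => //=.
  by rewrite prednK ?muln_gt0 ?N0 // modn_dvdm // dvdn_mulr.
Qed.

Lemma phi3_red (p : P4) (j : 'I_3) : zbar N (nat_of_ord (phi3 M p j)) = phi3 N p j.
Proof. by rewrite !ffunE crossings_red. Qed.

Lemma phi3_level_sub p : phi3 M p = 1 -> phi3 N p = 1.
Proof. by move=> e; apply/ffunP => j; rewrite -phi3_red e !ffunE /= zbar0. Qed.

Lemma ffun_expg (n m : nat) (f : {ffun 'I_3 -> Zmod n}) j : (f ^+ m) j = f j ^+ m.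
Proof. by elim: m => [|m IH]; rewrite ?expg0 ?ffunE // !expgS ffunE IH. Qed.

Lemma phi3_level_l p : phi3 N p = 1 -> exists j, phi3 M p ^+ (l ^ j) = 1.
Proof.
move=> e; exists k; apply/ffunP => j; rewrite ffun_expg [RHS]ffunE.
by apply: Zmod_red_exp; rewrite phi3_red e ffunE.
Qed.

Let fin2 : finite_set [set: Zmod M].
Proof. exact: (@finite_finset 'I_M.-1.+1). Qed.

Let fin3 : finite_set [set: {ffun 'I_3 -> Zmod M}].
Proof. exact: (@finite_finset {ffun 'I_3 -> 'I_M.-1.+1}). Qed.

Definition deg2 : level l (phi2 N) := qlevel fin2 phi2_level_sub phi2_level_l.
Definition deg3 : level l (phi3 N) := qlevel fin3 phi3_level_sub phi3_level_l.

End Degree.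

(** The degree in [x] lives in [Z_l(N)], the limit of the [Z/(N l^k)Z]; its vanishing is tested on
    the levels that record it modulo each [N l^k]. *)
Definition deg_zero (l N : nat) (l0 : (0 < l)%N) (N0 : (0 < N)%N)
    (c : completion l (phi2 N)) := forall k, comp c (deg2 l0 N0 k) 1.

(** Since [w] commutes with both arguments, its occurrences gather at the end, with the degree of
    the word in [x] as exponent. *)
Lemma lift2_twist (G : groupType) (u v w : G) (a : F2) : commute w u -> commute w v ->
  exists2 z : int, forall N : nat, phi2 N a = gexpz (zbar N 1) z &
    lift2 (u * w) v a = lift2 u v a * gexpz w z.
Proof.
move=> wu wv.
have C b z : commute (gexpz w z) (lift2 u v b).
  have C' : commute w (lift2 u v b).
    elim/F2_ind: b => [|b c Cb Cc|b Cb||].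
    - by rewrite gmulf1; apply: commute1.
    - by rewrite gmulfM; apply: commuteM.
    - by rewrite gmulfV; apply: commuteV.
    - by rewrite lift2x.
    - by rewrite lift2y.
  apply: commute_sym; case: z => m /=; last apply: commuteV; apply: commuteX; exact: commute_sym.
elim/F2_ind: a => [|a b [y ey fy] [z ez fz]|a [z ez fz]||].
- by exists 0%R => [N|]; rewrite ?gmulf1 //= mulg1.
- exists (y + z)%R => [N|]; first by rewrite gmulfM ey ez gexpzD.
  by rewrite !gmulfM fy fz gexpzD mulgA -(mulgA _ (gexpz w y)) C !mulgA.
- exists (- z)%R => [N|]; first by rewrite gmulfV ez gexpzN.
  by rewrite !gmulfV fz invgM gexpzN -gexpzN -gmulfV C.
- by exists 1%R => [N|]; rewrite ?(phi2x N 1) ?lift2x /= ?expg1.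
- by exists 0%R => [N|]; rewrite ?phi2y ?lift2y //= mulg1.
Qed.

(** A representative of [c] at a fine enough level has degree divisible by [N l^k], and then the
    power of [w] given by [lift2_twist] lies in [M]. *)
Lemma at2_twist (l N : nat) (l0 : (0 < l)%N) (N0 : (0 < N)%N) (G H : groupType)
    (phi : gmorph G H) (c : completion l (phi2 N)) (u v w : G) :
  deg_zero l0 N0 c -> commute w u -> commute w v ->
  phi u ^+ N = 1 -> phi v = 1 -> phi w = 1 ->
  at2 c (u * w) v = at2 c u v :> completion l phi.
Proof.
move=> dc wu wv pu pv pw; apply: completion_eq => M.
have K : forall a, phi2 N a = 1 -> proj (lift2 (inc u) (inc v) a : completion l phi) = 1.
  by apply: lift2_ker; rewrite ?proj_inc.
have K' : forall a, phi2 N a = 1 -> proj (lift2 (inc (u * w)) (inc v) a : completion l phi) = 1.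
  by apply: lift2_ker; rewrite ?proj_inc // gmulfM pw mulg1.
have wN : phi w ^+ N = 1 by rewrite pw expg1n.
have [k Mk] := zpow_level wN M.
have [a ca] := comp_ex (levelI (deg2 l0 N0 k) (levelI (pull K M) (pull K' M))) c.
have da : phi2 (N * l ^ k) a = 1.
  have := compIl ca; rewrite (comp_repr (dc k)) => /lcosE.
  by rewrite invg1 mul1g.
rewrite (extE (compIr (compIr ca))) (extE (compIl (compIr ca))) !lift2_inc !comp_inc.
have [z ez ->] := lift2_twist a wu wv.
apply/esym/lcos_eqP; rewrite mulKg.
have /gexpz_zbar1 := etrans (esym (ez _)) da.
rewrite muln_gt0 N0 expn_gt0 l0 => /(_ isT)/dvdzP[y ->].
by rewrite mulrC gexpzMn; apply: level_gexpz.
Qed.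

(** [dwreath_tame] is applied with [n l^k] in place of [n]: a degree divisible by [d n l^k] gives a
    label of degree divisible by [n l^k]. *)
Lemma deg_zero_delta (l d n : nat) (l0 : (0 < l)%N) (d0 : (0 < d)%N) (n0 : (0 < n)%N)
    (N0 : (0 < d * n)%N) (c : completion l (phi2 (d * n))) :
  deg_zero l0 N0 c -> deg_zero l0 n0 (wext (dwreath d Fx) ord0 c).
Proof.
move=> dc k; have tD := dwreath_tame d0 n0.
have [a ca] := comp_ex (levelI (deg2 l0 N0 k) (wpull tD (deg2 l0 n0 k))) c.
have da : phi2 (d * n * l ^ k) a = 1.
  have := compIl ca; rewrite (comp_repr (dc k)) => /lcosE.
  by rewrite invg1 mul1g.
rewrite (wextE ord0 (compIr ca)); apply/lcosE; rewrite mulg1; apply: levelV => /=.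
have nk : (0 < n * l ^ k)%N by rewrite muln_gt0 n0 expn_gt0 l0.
by rewrite -mulnA in da; have [] := dwreath_tame d0 nk da ord0.
Qed.

Lemma lift2_in_ker (G H : groupType) (phi : gmorph G H) (u v : G) a :
  phi u = 1 -> phi v = 1 -> phi (lift2 u v a) = 1.
Proof.
move=> pu pv; elim/F2_ind: a => [|a b IHa IHb|a IH||].
- by rewrite !gmulf1.
- by rewrite !gmulfM IHa IHb mulg1.
- by rewrite !gmulfV IH invg1.
- by rewrite lift2x.
- by rewrite lift2y.
Qed.

Lemma phi3_pure N i j : (0 < i < j)%N -> (j < 4)%N -> phi3 N (x_ i j) = 1.
Proof.
case: i => // i /andP[_ ij] j4; rewrite phi3_x ?ij //.
by apply/ffunP => k; rewrite !ffunE zbar0.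
Qed.

Lemma phi3_expN N p : phi3 N p ^+ N = 1.
Proof. by apply/ffunP => j; rewrite ffun_expg Zmod_exp ffunE. Qed.

Lemma phi3M N p q (j : 'I_3) : phi3 N (p * q) j = phi3 N p j * phi3 N q j.
Proof. by rewrite gmulfM ffunE. Qed.

Lemma coord_lift2 N (u v : P4) (j : 'I_3) a : phi3 N u j = zbar N 1 -> phi3 N v j = 1 ->
  phi3 N (lift2 u v a) j = phi2 N a.
Proof.
move=> uj vj; elim/F2_ind: a => [|a b IHa IHb|a IH||].
- by rewrite !gmulf1 ffunE.
- by rewrite [lift2 _ _ _]gmulfM phi3M IHa IHb gmulfM.
- by rewrite !gmulfV ffunE IH.
- by rewrite lift2x uj (phi2x N 1).
- by rewrite lift2y vj phi2y.
Qed.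

Lemma coord_lift2_1 N (u v : P4) (j : 'I_3) a : phi3 N u j = 1 -> phi3 N v j = 1 ->
  phi3 N (lift2 u v a) j = 1.
Proof.
move=> uj vj; elim/F2_ind: a => [|a b IHa IHb|a IH||].
- by rewrite !gmulf1 ffunE.
- by rewrite [lift2 _ _ _]gmulfM phi3M IHa IHb mulg1.
- by rewrite !gmulfV ffunE IH invg1.
- by rewrite lift2x uj.
- by rewrite lift2y vj.
Qed.

Section Pentagon.
Variables (l : nat) (l0 : (0 < l)%N).

Lemma phi3_12_13 N : phi3 N (x_ 1 2 * x_ 1 3) = 1.
Proof. by rewrite gmulfM !phi3_pure ?mulg1. Qed.

Lemma phi3_13_23 N : phi3 N (x_ 1 3 * x_ 2 3) = 1.
Proof. by rewrite gmulfM !phi3_pure ?mulg1. Qed.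

Lemma at2_ker N (N0 : (0 < N)%N) (u v : P4) : phi3 N v = 1 ->
  forall a, phi2 N a = 1 -> proj (lift2 (inc u) (inc v) a : completion l (phi3 N)) = 1.
Proof. by move=> pv; apply: lift2_ker; rewrite ?proj_inc ?phi3_expN. Qed.

Lemma at2f_ker N (u v : P4) : phi3 N u = 1 -> phi3 N v = 1 ->
  forall a, triv F2 a = 1 -> proj (lift2 (inc u) (inc v) a : completion l (phi3 N)) = 1.
Proof. by move=> pu pv a _; rewrite lift2_inc proj_inc lift2_in_ker. Qed.

(* The strands 0 and 1 have linking number 0 in f(x_12, x_23) and in
   g(x_02 x_12, x_23), and the x-degree of g in the three other factors. *)
Lemma pentagon_deg_zero N (N0 : (0 < N)%N) (f : prol l F2) (g : completion l (phi2 N)) :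
  mixed_pentagon f g -> deg_zero l0 N0 g.
Proof.
move=> pent k; set L := deg3 l0 N0 k.
have K1 := at2_ker N0 (x_ 0 1) (phi3_12_13 N).
have K2 := at2_ker N0 (x_ 0 2 * x_ 1 2) (phi3_pure N (isT : 0 < 2 < 3)%N isT).
have K3 := at2_ker N0 (x_ 0 1 * x_ 0 2) (phi3_13_23 N).
have K4 := at2_ker N0 (x_ 0 1) (phi3_pure N (isT : 0 < 1 < 2)%N isT).
have Kf := at2f_ker (phi3_pure N (isT : 0 < 1 < 2)%N isT) (phi3_pure N (isT : 0 < 2 < 3)%N isT).
have [a ca] := comp_ex (levelI (deg2 l0 N0 k) (levelI (levelI (pull K1 L) (pull K2 L))
  (levelI (pull K3 L) (pull K4 L)))) g.
have [b cb] := comp_ex (pull Kf L) f.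
have e1 := extE (compIl (compIl (compIr ca))); have e2 := extE (compIr (compIl (compIr ca))).
have e3 := extE (compIl (compIr (compIr ca))); have e4 := extE (compIr (compIr (compIr ca))).
have ef := extE cb; rewrite !lift2_inc !comp_inc in e1 e2 e3 e4 ef.
set M := (N * l ^ k)%N.
have := congr1 (fun c => comp c L) pent.
rewrite /= e1 e2 e3 e4 ef !lcos_mul => /lcos_eqP /= eL.
have {eL} eL : phi3 M (lift2 (x_ 0 1) (x_ 1 2 * x_ 1 3) a * lift2 (x_ 0 2 * x_ 1 2) (x_ 2 3) a) =
    phi3 M (lift2 (x_ 1 2) (x_ 2 3) b * lift2 (x_ 0 1 * x_ 0 2) (x_ 1 3 * x_ 2 3) a *
      lift2 (x_ 0 1) (x_ 1 2) a).
  apply: (mulgI (phi3 M (lift2 (x_ 0 1) (x_ 1 2 * x_ 1 3) a *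
    lift2 (x_ 0 2 * x_ 1 2) (x_ 2 3) a))^-1).
  by rewrite mulVg -gmulfV -gmulfM; apply/esym; exact: eL.
have {eL} := congr1 (fun h : {ffun 'I_3 -> Zmod M} => h ord0) eL.
have c01 : phi3 M (x_ 0 1) ord0 = zbar M 1 by rewrite phi3_x // ffunE.
have c02 : phi3 M (x_ 0 2) ord0 = 1 by rewrite phi3_x // ffunE /= zbar0.
have c12 : phi3 M (x_ 1 2) ord0 = 1 by rewrite phi3_pure // ffunE.
have c13 : phi3 M (x_ 1 3) ord0 = 1 by rewrite phi3_pure // ffunE.
have c23 : phi3 M (x_ 2 3) ord0 = 1 by rewrite phi3_pure // ffunE.
rewrite !phi3M (coord_lift2_1 _ (u := x_ 0 2 * x_ 1 2)) ?phi3M ?c02 ?c12 ?mulg1 //.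
rewrite (coord_lift2_1 _ (u := x_ 1 2)) // mul1g.
rewrite !coord_lift2 ?phi3M ?c01 ?c02 ?c12 ?c13 ?c23 ?mulg1 // => ea.
have {ea} ea : phi2 M a = 1 by apply: (mulgI (phi2 M a)); rewrite -ea mulg1.
rewrite (comp_repr (compIl ca)); apply/lcosE; rewrite mulg1.
by apply: levelV.
Qed.

Lemma deg_zero_proj N (N0 : (0 < N)%N) (g : completion l (phi2 N)) :
  deg_zero l0 N0 g -> proj g = 1.
Proof. by move=> /(_ 0%N)/projE ->; rewrite gmulf1. Qed.

Variables (d n : nat) (d0 : (0 < d)%N) (n0 : (0 < n)%N).
Variables (f : prol l F2) (g : completion l (phi2 (d * n))).
Hypothesis pent : mixed_pentagon f g.

Let N0 : (0 < d * n)%N. Proof. by rewrite muln_gt0 d0. Qed.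
Let dg : deg_zero l0 N0 g. Proof. exact: pentagon_deg_zero pent. Qed.
Let pg : proj g = 1. Proof. exact: deg_zero_proj dg. Qed.

(** The root cocycle at the state [(0, 0, 0)] is applied to the pentagon of [g]. The orbits
    [(i, 0, 0)], [(0, i, 0)] and [(i, i, 0)] feed the transfer principle for the factors in [g]; the
    factor in [f] is preserved. *)
Lemma pentagon_delta (hN : (0 < d * n)%N) (hNN : (n %| d * n)%N) :
  mixed_pentagon f (delta_g hN hNN g).
Proof.
have tR := root_tame d0 n0.
rewrite delta_gE //; set g' : completion l (phi2 n) := wext _ _ g.
have dg' : deg_zero l0 n0 g' by apply: deg_zero_delta dg.
pose o := (ord0 : 'I_d.-1.+1); pose so : astate d := (o, o, o).
have sh (i : Zmod d) : zshift (zbar d 1) i = i * zbar d 1 by rewrite permE.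
have p12 N : phi3 N (x_ 1 2) = 1 by apply: phi3_pure.
have p23 N : phi3 N (x_ 2 3) = 1 by apply: phi3_pure.
have R1 : wext (droot d0) so (at2 g (x_ 0 1) (x_ 1 2 * x_ 1 3) : completion l (phi3 (d * n))) =
    at2 g' (x_ 0 1) (x_ 1 2 * x_ 1 3) :> completion l (phi3 n).
  apply: (transfer_at2 tR d0 n0 (s := fun i : Zmod d => (i, o, o))) => //;
    rewrite ?phi3_expN ?phi3_12_13 //.
  - by move=> i; rewrite move_x01 sh.
  - by move=> i; apply: root_x01.
  - by move=> i; apply: root_x12x13.
have R2 : wext (droot d0) so (at2 g (x_ 0 2 * x_ 1 2) (x_ 2 3) : completion l (phi3 (d * n))) =
    at2 g' (x_ 0 2 * x_ 1 2) (x_ 2 3) :> completion l (phi3 n).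
  apply: (transfer_at2 tR d0 n0 (s := fun i : Zmod d => (o, i, o))) => //;
    rewrite ?phi3_expN ?p23 //.
  - by move=> i; rewrite move_x02x12 sh.
  - by move=> i; apply: root_x02x12.
  - by move=> i; apply: root_x23.
have R3 :
    wext (droot d0) so (at2 g (x_ 0 1 * x_ 0 2) (x_ 1 3 * x_ 2 3) :
      completion l (phi3 (d * n))) =
    at2 g' (x_ 0 1 * x_ 0 2) (x_ 1 3 * x_ 2 3) :> completion l (phi3 n).
  (* Multiplying the first argument by [x_12] changes the value of neither [g] nor [g'], both of
     degree zero. *)
  have c1 := x012_commute; have c2 := x123_commute.
  rewrite -(at2_twist (N0 := N0) dg c1 c2) ?phi3_expN ?phi3_13_23 ?p12 //.
  rewrite -(at2_twist (N0 := n0) dg' c1 c2) ?phi3_expN ?phi3_13_23 ?p12 //.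
  apply: (transfer_at2 tR d0 n0 (s := fun i : Zmod d => (i, i, o))) => //;
    rewrite ?phi3_expN ?phi3_13_23 //.
  - by move=> i; rewrite move_x012 sh.
  - by move=> i; apply: root_x012.
  - by move=> i; apply: root_x13x23.
have R4 : wext (droot d0) so (at2 g (x_ 0 1) (x_ 1 2) : completion l (phi3 (d * n))) =
    at2 g' (x_ 0 1) (x_ 1 2) :> completion l (phi3 n).
  apply: (transfer_at2 tR d0 n0 (s := fun i : Zmod d => (i, o, o))) => //;
    rewrite ?phi3_expN ?p12 //.
  - by move=> i; rewrite move_x01 sh.
  - by move=> i; apply: root_x01.
  - by move=> i; apply: root_x12.
(* [x_12] and [x_23] fix the state [(0, 0, 0)] and output themselves there. *)
have Rf (h : prol l F2) :
    wext (droot d0) so (at2 h (x_ 1 2) (x_ 2 3) : completion l (phi3 (d * n))) =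
    at2 h (x_ 1 2) (x_ 2 3) :> completion l (phi3 n).
  have Kf N := at2f_ker (p12 N) (p23 N).
  have ph : proj h = 1 :> Zmod 1 by apply/val_inj; case: (proj h) => -[].
  move: h ph; apply: (@cont_eq _ _ _ _ _ _ _
    (fun f => wext (droot d0) so (at2 f (x_ 1 2) (x_ 2 3) : completion l (phi3 (d * n))))
    (fun f => at2 f (x_ 1 2) (x_ 2 3))).
  - apply: (@cont_comp _ _ _ _ _ _ _ _ _ _ (wext (droot d0) so)); first exact: cont_wext.
    exact: cont_ext (Kf _).
  - exact: cont_ext (Kf _).
  move=> a _; rewrite /at2 /sub2 !(ext_inc (Kf _)) !lift2_inc (wext_inc tR); congr (inc _).
  have M b : wperm (droot d0 (lift2 (x_ 1 2) (x_ 2 3) b)) so = so.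
    by have [] := tR _ (lift2_in_ker b (p12 _) (p23 _)) so.
  elim/F2_ind: a => [|a b IHa IHb|a IH||].
  - by rewrite !gmulf1 wlab1.
  - by rewrite [lift2 _ _ (a * b)]gmulfM gmulfM wlabM M IHa IHb.
  - rewrite [lift2 _ _ a^-1]gmulfV gmulfV wlabV.
    have -> : (wperm (droot d0 (lift2 (x_ 1 2) (x_ 2 3) a)))^-1 so = so.
      by apply: (@perm_inj _ (wperm (droot d0 (lift2 (x_ 1 2) (x_ 2 3) a)))); rewrite permKV M.
    by rewrite IH.
  - by rewrite lift2x root_x12_o.
  - by rewrite lift2y root_x23_o.
have pf : proj (at2 f (x_ 1 2) (x_ 2 3) : completion l (phi3 (d * n))) = 1.
  apply: proj_ext; first exact: at2f_ker.
  by apply/val_inj; case: (proj f) => -[].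
have pat u v : phi3 (d * n) v = 1 -> proj (at2 g u v : completion l (phi3 (d * n))) = 1.
  by move=> pv; apply: proj_sub2; rewrite ?proj_inc ?phi3_expN.
have := congr1 (wext (droot d0) so : _ -> completion l (phi3 n)) pent.
(* Every factor has trivial projection, so all of them are read from the same state. *)
rewrite !(wextM tR) !(wact_ker tR) ?projM ?pat ?pf ?phi3_12_13 ?phi3_13_23 ?mulg1 //.
by rewrite R1 R2 R3 R4 Rf.
Qed.

End Pentagon.

(** * The map on GTM *)

Section DeltaGtmProperties.
Variables (l d n : nat) (hl : prime l) (hN : (0 < d * n)%N) (hNN : (n %| d * n)%N).

Let l0 : (0 < l)%N. Proof. exact: prime_gt0. Qed.
Let d0 : (0 < d)%N. Proof. by move: hN; rewrite muln_gt0 => /andP[]. Qed.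
Let n0 : (0 < n)%N. Proof. by move: hN; rewrite muln_gt0 => /andP[]. Qed.

(** This comes from the mixed pentagon, which forces degree zero; the stage [k = 0] is the
    triviality in [Z/NZ]. *)
Lemma GTM_proj (q : gtm_elt l (d * n)) : GTM_semigroup q -> proj (gt_g q) = 1.
Proof.
by case=> nu [_ [_ _ _ _ /(pentagon_deg_zero l0 hN)/deg_zero_proj]].
Qed.

Lemma GTM_semigroup_delta (q : gtm_elt l (d * n)) :
  GTM_semigroup q -> GTM_semigroup (delta_gtm hN hNN q).
Proof.
move=> sq; have pq := GTM_proj sq; case: sq => nu [lamE [f1 f2 f3 hex pent]].
exists nu; split=> //; split=> //; first exact: hexagon_delta.
exact: pentagon_delta.
Qed.

Lemma zl_redM (a b : zl l (d * n)) : zl_red hNN (a * b)%R = (zl_red hNN a * zl_red hNN b)%R.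
Proof.
apply: zl_eq => k /=; have dv : (zlmod l n k %| zlmod l (d * n) k)%Z.
  by rewrite dvdzE /= dvdn_mul.
by rewrite modz_dvdm // modzMm.
Qed.

Lemma zl_red1 : zl_red hNN (1 : zl l (d * n))%R = 1%R.
Proof.
apply: zl_eq => k /=; have dv : (zlmod l n k %| zlmod l (d * n) k)%Z.
  by rewrite dvdzE /= dvdn_mul.
by rewrite modz_dvdm.
Qed.

Lemma delta_gtm_mul (q1 q2 : gtm_elt l (d * n)) : GTM_semigroup q1 -> GTM_semigroup q2 ->
  mod_unit d (gt_mu q2) ->
  delta_gtm hN hNN (gtm_mul q1 q2) = gtm_mul (delta_gtm hN hNN q1) (delta_gtm hN hNN q2).
Proof.
move=> /GTM_proj; case: q1 => lam1 mu1 f1 g1 /= pg1.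
move=> /GTM_proj; case: q2 => lam2 mu2 f2 g2 /= pg2 u2.
by rewrite /delta_gtm /= zl_redM delta_g_mul.
Qed.

Lemma delta_gtm1 : delta_gtm hN hNN (gtm_one l (d * n)) = gtm_one l n.
Proof.
have tD := dwreath_tame d0 n0.
by rewrite /delta_gtm /= zl_red1 delta_gE ?proj1g // (wext1 tD).
Qed.

(** The equality [mu mu' = 1] is read in [Z/NZ] and reduced modulo [d]. *)
Lemma gtm_mul_unit (q q' : gtm_elt l (d * n)) :
  gtm_mul q q' = gtm_one l (d * n) -> mod_unit d (gt_mu q).
Proof.
move=> /(congr1 (fun r => (gt_mu r 0%N %% d)%Z)).
case: q q' => lam mu f g [lam' mu' f' g'] e; exists (mu' 0%N).
have dv : (d %| zlmod l (d * n) 0)%Z by rewrite dvdzE /= muln1 dvdn_mulr.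
by move: e; rewrite /= !modz_dvdm.
Qed.

End DeltaGtmProperties.

Local Close Scope group_scope.
Local Close Scope classical_set_scope.

Theorem proposition9p1 (l N N' : nat) (hl : prime l) (hN : 0 < N) (hN' : 0 < N')
    (hNN : N' %| N) :
  [/\ forall q : gtm_elt l N, GTM_semigroup q ->
        (exists h : prol l (kerg (phi2 N)), ker_inj h = gt_g q) /\
        GTM_semigroup (delta_gtm hN hNN q),
      forall q1 q2 : gtm_elt l N, GTM_semigroup q1 -> GTM_semigroup q2 ->
        mod_unit (N %/ N') (gt_mu q2) ->
        delta_gtm hN hNN (gtm_mul q1 q2) =
          gtm_mul (delta_gtm hN hNN q1) (delta_gtm hN hNN q2),
      forall q : gtm_elt l N, GTM q -> GTM (delta_gtm hN hNN q)
    & forall q1 q2 : gtm_elt l N, GTM q1 -> GTM q2 ->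
        delta_gtm hN hNN (gtm_mul q1 q2) =
          gtm_mul (delta_gtm hN hNN q1) (delta_gtm hN hNN q2)].
Proof.
have [d eN] := dvdnP hNN; subst N; rewrite mulnK //; split=> [q sq|||q1 q2].
- split; last exact: GTM_semigroup_delta.
  by exists (wext (ker_cocycle _) ord0 (gt_g q)); apply/ker_inj_surj/(GTM_proj hl).
- exact: delta_gtm_mul.
- move=> q [sq [q' [sq' qq' q'q]]]; split; first exact: GTM_semigroup_delta.
  exists (delta_gtm hN hNN q'); split; first exact: GTM_semigroup_delta.
    (* The product rule asks for the invertibility of the second factor, here [q'], which comes from
       the other equation [q' q = 1]. *)
    by rewrite -delta_gtm_mul ?qq' ?delta_gtm1 //; apply: gtm_mul_unit q'q.
  by rewrite -delta_gtm_mul ?q'q ?delta_gtm1 //; apply: gtm_mul_unit qq'.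
- move=> [s1 _] [s2 [q' [_ qq' _]]]; apply: delta_gtm_mul => //.
  exact: gtm_mul_unit qq'.
Qed.
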